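(* Let $\mu,\nu\in\mathcal P_2(\mathbb R^n)$ and let $\pi\in\Pi(\mu,\nu)$ be an arbitrary coupling. Let $(X_t,Y_t)_{t\ge0}$ be the solution of the orthogonal coupling dynamics (OCD) $$\dot X_t=-\nabla_xc(X_t,Y_t)+\mathbb E_{p_t}[\nabla_xc(X_t,Y_t)\mid X_t],\qquad \dot Y_t=-\nabla_yc(X_t,Y_t)+\mathbb E_{p_t}[\nabla_yc(X_t,Y_t)\mid Y_t],$$ with initial condition $(X_0,Y_0)\sim\pi$, where $p_t$ is the joint law of $(X_t,Y_t)$, with density $\rho_t$. Suppose the Regularity Assumption (stated in the context) holds. Then $\rho_t$ is a weak solution of the Vlasov-type equation $$\partial_t\rho_t-\nabla_x\cdot\big(\rho_t\,\mathsf S_{p_t,x}[\nabla_xc]\big)-\nabla_y\cdot\big(\rho_t\,\mathsf S_{p_t,y}[\nabla_yc]\big)=0 ,$$ where $$\mathsf S_{p_t,x}[\nabla_xc](x,y)=\nabla_xc(x,y)-\mathbb E_{(X_t,Y_t)\sim p_t}[\nabla_xc(X_t,Y_t)\mid X_t=x],$$ $$\mathsf S_{p_t,y}[\nabla_yc](x,y)=\nabla_yc(x,y)-\mathbb E_{(X_t,Y_t)\sim p_t}[\nabla_yc(X_t,Y_t)\mid Y_t=y].$$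
   Context: Notation. $\mathcal P_2(\mathbb R^m)$ is the set of Borel probability measures on $\mathbb R^m$ with finite second moment; $\Pi(\mu,\nu)$ is the set of joint measures in $\mathcal P_2(\mathbb R^n\times\mathbb R^n)$ with marginals $\mu,\nu\in\mathcal P_2(\mathbb R^n)$. $c:\mathbb R^{2n}\to\mathbb R$ is a non-negative smooth cost function. $X_t,Y_t$ are $\mathbb R^n$-valued square-integrable random variables on a common probability space. Weak solution: for a velocity field $(v_{1,t},v_{2,t})$, $\rho_t$ is a weak solution of $\partial_t\rho_t+\nabla_x\cdot(\rho_tv_{1,t})+\nabla_y\cdot(\rho_tv_{2,t})=0$ if for all $g\in C_c^\infty(\mathbb R^{2n})$, $\frac{d}{dt}\int g\,\rho_t\,dx\,dy=\int(\nabla_xg\cdot v_{1,t}+\nabla_yg\cdot v_{2,t})\,\rho_t\,dx\,dy$; i.e. derivatives are understood in the distributional sense. Regularity Assumption. For each $t\ge0$ the joint law $p_t$ of $(X_t,Y_t)$ admits a Lebesgue density $\rho_t\in L^1(\mathbb R^{2n})$ with finite second moment. Moreover: (1) $t\mapsto\rho_t$ is weakly continuous in $L^1$. (2) The velocity field $v_t=(v_{1,t},v_{2,t})$ (the right-hand side of the dynamics, as a function of $(x,y)$) satisfies $v_t\in L^2(p_t)$ and $v_t\rho_t\in L^1(\mathbb R^{2n})$. (3) $c\in C^1(\mathbb R^{2n})$ and $|\nabla_xc(x,y)|+|\nabla_yc(x,y)|\le C(1+|x|+|y|)$ for some constant $C$. (4) Conditional expectations such as $\mathbb E_{p_t}[\nabla_xc(X_t,Y_t)\mid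 X_t=x]$ exist in $L^2(\mu)$ and define measurable functions (and likewise for $y$ with $L^2(\nu)$). (5) There is $L>0$ such that for all $p,q\in\Pi(\mu,\nu)$, $\|\mathbb E_p[\nabla_xc(X,Y)\mid X]-\mathbb E_q[\nabla_xc(X,Y)\mid X]\|_{L^2(\mu)}\le L\,W_2(p,q)$, where $W_2$ is the 2-Wasserstein distance, and similarly for the conditional expectation with respect to $Y$. *)

(* Defs.v *)
(* R^n is 'rV[R]_n and R^{2n} is 'rV[R]_n * 'rV[R]_n, for a realType R. *)
From HB Require Import structures.
From mathcomp Require Import all_boot all_order all_algebra.
From mathcomp Require Import all_classical all_reals all_analysis.
From mathcomp Require Import measurable_realfun.

Set Implicit Arguments.
Unset Strict Implicit.
Unset Printing Implicit Defensive.
Set SsrOldRewriteGoalsOrder.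

Import Order.TTheory GRing.Theory Num.Theory.
Import numFieldNormedType.Exports.

Local Open Scope classical_set_scope.
Local Open Scope ring_scope.

Definition mx_borel_display : measure_display.
Proof. exact: default_measure_display. Qed.

Section mx_borel.
Context {R : realType} {m n : nat}.

Definition mx_borel : set (set 'M[R]_(m, n)) := <<s [set U | open U] >>.

Let mx_borel0 : mx_borel set0.
Proof. exact: sigma_algebra0. Qed.

Let mx_borelC A : mx_borel A -> mx_borel (~` A).
Proof. by move=> mA; rewrite -setTD; exact: sigma_algebraCD. Qed.

Let mx_borel_bigcup (F : (set 'M[R]_(m, n))^nat) :
  (forall i, mx_borel (F i)) -> mx_borel (\bigcup_i F i).
Proof. exact: sigma_algebra_bigcup. Qed.

HB.instance Definition _ := @isMeasurable.Build mx_borel_display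
  'M[R]_(m, n) mx_borel mx_borel0 mx_borelC mx_borel_bigcup.

Lemma measurable_mx_coord (i : 'I_m) (j : 'I_n) :
  measurable_fun [set: 'M[R]_(m, n)] (fun M => M i j).
Proof.
apply: (measurability _ (RGenOpens.measurableE R)) => _ [_ [a [b ->]] <-].
rewrite setTI; apply: sub_sigma_algebra => /=.
apply: open_comp; last exact: interval_open.
by move=> M _; exact: coord_continuous.
Qed.

Let box (q : 'M[rat]_(m, n) * nat) : set 'M[R]_(m, n) :=
  [set M | forall i j, `|ratr (q.1 i j) - M i j| < q.2.+1%:R^-1].

Let open_bigcup_box (U : set 'M[R]_(m, n)) : open U ->
  U = \bigcup_q (if `[< box q `<=` U >] then box q else set0).
Proof.
move=> oU; apply/seteqP; split => M; last first.
  by case=> q _; case: ifPn => // /asboolP; exact.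
move=> UM; have /nbhs_ballP[e /= e0 eU] : nbhs M U by exact: open_nbhs_nbhs.
have [k ke] : exists k : nat, k.+1%:R^-1 < e / 2.
  exists (Num.truncn (e / 2)^-1).
  by rewrite invf_plt ?posrE ?divr_gt0// truncnS_gt.
have k0 : 0 < k.+1%:R^-1 :> R by rewrite invr_gt0.
have qP i j : exists q : rat, `|ratr q - M i j| < k.+1%:R^-1.
  have /rat_in_itvoo[q] : M i j - k.+1%:R^-1 < M i j + k.+1%:R^-1.
    by rewrite ltrD2l gtrN.
  by rewrite in_itv/= => qM; exists q; rewrite ltr_distl.
pose Q : 'M[rat]_(m, n) := \matrix_(i, j) projT1 (cid (qP i j)).
have QM i j : `|ratr (Q i j) - M i j| < k.+1%:R^-1.
  by rewrite mxE; case: cid.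
exists (Q, k) => //; case: asboolP => // -[] N QN; apply: eU; split => // i j.
rewrite /ball/= -(subrK (ratr (Q i j)) (M i j)) -addrA.
rewrite (le_lt_trans (ler_normD _ _))// (splitr e) ltrD//.
  by rewrite distrC (lt_trans (QM i j)).
by rewrite (lt_trans (QN i j)).
Qed.

Lemma measurable_fun_mxP d (T : measurableType d) (f : T -> 'M[R]_(m, n)) :
  measurable_fun [set: T] f <->
  forall i j, measurable_fun [set: T] (fun x => f x i j).
Proof.
split=> [mf i j|mf].
  exact: (measurableT_comp (measurable_mx_coord i j)).
apply: (@measurability _ _ T _ setT f [set U | open U] erefl) => _ [U oU <-].
rewrite setTI (open_bigcup_box oU) preimage_bigcup.
apply: countable_bigcupT_measurable => [|q]; first exact: countableP.
case: ifPn => _; last first.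
  by rewrite preimage_set0.
rewrite (_ : _ @^-1` _ = \bigcap_(ij : 'I_m * 'I_n)
    (fun x => `|ratr (q.1 ij.1 ij.2) - f x ij.1 ij.2|) @^-1`
      `]-oo, q.2.+1%:R^-1[); last first.
  apply/seteqP; split=> [x qx [i j] _|x qx i j] /=.
    by rewrite in_itv/=; exact: qx.
  by have := qx (i, j) Logic.I; rewrite /= in_itv.
rewrite -[X in measurable X]setCK setC_bigcap; apply: measurableC.
apply: countable_bigcupT_measurable => [|[i j]]; first exact: countableP.
apply: measurableC.
rewrite -[X in measurable X]setTI.
suff : measurable_fun [set: T] (fun x => `|ratr (q.1 i j) - f x i j|).
  by apply.
apply: measurableT_comp => //; apply: measurable_funB => //.
Qed.

End mx_borel.

Lemma sigma_finite_product d1 d2 (T1 : measurableType d1)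
    (T2 : measurableType d2) (R : realType)
    (m1 : {sigma_finite_measure set T1 -> \bar R})
    (m2 : {sigma_finite_measure set T2 -> \bar R}) :
  sigma_finite setT (m1 \x m2)%E.
Proof.
have /sigma_finiteP[F [TF ndF Foo]] := sigma_finiteT m1.
have /sigma_finiteP[G [TG ndG Goo]] := sigma_finiteT m2.
exists (fun n => F n `*` G n).
  rewrite -setXTT TF TG predeqE => -[x y]; split=> [[/= [n _ Fnx] [k _ Gky]]|].
    exists (maxn n k) => //; split.
    - by move: x Fnx; exact/subsetPset/ndF/leq_maxl.
    - by move: y Gky; exact/subsetPset/ndG/leq_maxr.
  by move=> [n _ []/= ? ?]; split; exists n.
move=> k; have [? ?] := Foo k; have [? ?] := Goo k.
split; first exact: measurableX.
by rewrite product_measure1E// lte_mul_pinfty// ge0_fin_numE.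
Qed.

Section lebesgue_rV.
Context {R : realType}.

Definition rV_cons n (p : measurableTypeR R * 'rV[R]_n) : 'rV[R]_n.+1 :=
  \row_i oapp (p.2 ord0) p.1 (unlift ord0 i).

Definition rV_uncons n (v : 'rV[R]_n.+1) : measurableTypeR R * 'rV[R]_n :=
  (v ord0 ord0, \row_j v ord0 (lift ord0 j)).

Lemma rV_consK n : cancel (@rV_cons n) (@rV_uncons n).
Proof.
case=> x v; rewrite /rV_uncons mxE unlift_none/=; congr pair.
by apply/rowP => j; rewrite !mxE liftK.
Qed.

Lemma measurable_rV_cons n :
  measurable_fun [set: measurableTypeR R * 'rV[R]_n] (@rV_cons n).
Proof.
apply/measurable_fun_mxP => i j.
rewrite (_ : (fun _ => _) = fun p : measurableTypeR R * 'rV[R]_n =>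
  oapp (p.2 ord0) p.1 (unlift ord0 j)); last by apply/funext => p; rewrite mxE.
case: unliftP => [k _|_] /=; last exact: measurable_fst.
exact: (measurableT_comp (measurable_mx_coord ord0 k)).
Qed.

Lemma measurable_rV_uncons n : measurable_fun [set: 'rV[R]_n.+1] (@rV_uncons n).
Proof.
apply: measurable_fun_pair; first exact: measurable_mx_coord.
apply/measurable_fun_mxP => i j.
rewrite (_ : (fun _ => _) = fun v : 'rV[R]_n.+1 => v ord0 (lift ord0 j)).
  exact: measurable_mx_coord.
by apply/funext => v; rewrite mxE.
Qed.

Section lebesgue_cons.
Variables (n : nat) (mu : {sigma_finite_measure set 'rV[R]_n -> \bar R}).

Definition lebesgue_cons : set 'rV[R]_n.+1 -> \bar R :=
  pushforward (lebesgue_measure \x mu)%E (@rV_cons n).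

Let lebesgue_cons0 : lebesgue_cons set0 = 0%E.
Proof. by rewrite /lebesgue_cons /pushforward preimage_set0 measure0. Qed.

Let lebesgue_cons_ge0 A : (0 <= lebesgue_cons A)%E.
Proof. rewrite /lebesgue_cons /pushforward; exact: measure_ge0. Qed.

Let lebesgue_cons_sigma_additive : semi_sigma_additive lebesgue_cons.
Proof.
move=> F mF tF mUF; have mc := @measurable_rV_cons n.
rewrite /lebesgue_cons /pushforward preimage_bigcup.
apply: measure_semi_sigma_additive.
- by move=> i; rewrite -[X in measurable X]setTI; exact: mc.
- apply/trivIsetP => /= i j _ _ ij; rewrite -preimage_setI.
  by move/trivIsetP : tF => /(_ _ _ _ _ ij) ->//; rewrite preimage_set0.
- by rewrite -preimage_bigcup -[X in measurable X]setTI; exact: mc.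
Qed.

HB.instance Definition _ := isMeasure.Build _ _ _ lebesgue_cons
  lebesgue_cons0 lebesgue_cons_ge0 lebesgue_cons_sigma_additive.

Let lebesgue_cons_sigma_finite : sigma_finite setT lebesgue_cons.
Proof.
have [F TF Foo] := sigma_finite_product (@lebesgue_measure R) mu.
exists (fun k => @rV_uncons n @^-1` F k).
  by rewrite -preimage_bigcup -TF preimage_setT.
move=> k; have [mF oo] := Foo k; split.
  by rewrite -[X in measurable X]setTI; exact: measurable_rV_uncons.
rewrite /lebesgue_cons /pushforward (_ : _ @^-1` _ = F k)//.
by apply/seteqP; split=> p; rewrite /preimage/= rV_consK.
Qed.

HB.instance Definition _ := Measure_isSigmaFinite.Build _ _ _ lebesgue_cons
  lebesgue_cons_sigma_finite.

End lebesgue_cons.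

(* Lebesgue measure on R^n; lebesgue_rV_box below gives its values on boxes. *)
Fixpoint lebesgue_rV n : {sigma_finite_measure set 'rV[R]_n -> \bar R} :=
  if n is k.+1 then lebesgue_cons (lebesgue_rV k)
  else \d_ (0 : 'rV[R]_0).

Lemma lebesgue_rV_box n (A : 'I_n -> set R) : (forall i, measurable (A i)) ->
  lebesgue_rV n [set v | forall i, A i (v ord0 i)] =
  (\prod_(i < n) (@lebesgue_measure R (A i)))%E.
Proof.
elim: n A => [|n IH] A mA.
  rewrite big_ord0 /= diracE mem_set//=; by case.
rewrite big_ord_recl -IH//.
pose B := [set v : 'rV[R]_n | forall i, A (lift ord0 i) (v ord0 i)].
have mB : measurable B.
  rewrite (_ : B = \bigcap_(i : 'I_n)
      (fun v => v ord0 i) @^-1` A (lift ord0 i)); last first.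
    by apply/seteqP; split=> [v Bv i _|v Bv i]; [exact: Bv|exact: (Bv i)].
  rewrite -[X in measurable X]setCK setC_bigcap; apply: measurableC.
  apply: countable_bigcupT_measurable => [|i]; first exact: countableP.
  apply: measurableC; rewrite -[X in measurable X]setTI.
  by apply: measurable_mx_coord => //; exact: mA.
rewrite -(product_measure1E (@lebesgue_measure R) (lebesgue_rV n))//.
congr product_measure1; apply/seteqP; split=> [[x v] /= Av|[x v] /= [Ax Bv] i].
  split; first by have := Av ord0; rewrite mxE unlift_none.
  by move=> i; have := Av (lift ord0 i); rewrite mxE liftK.
  by rewrite mxE; case: unliftP => [k ->|->] //=; exact: Bv.
exact: (mA ord0).
Qed.

Definition lebesgue_rV2 n : set ('rV[R]_n * 'rV[R]_n) -> \bar R :=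
  (lebesgue_rV n \x lebesgue_rV n)%E.
HB.instance Definition _ n := Measure.on (@lebesgue_rV2 n).
HB.instance Definition _ n := Measure_isSigmaFinite.Build _ _ _
  (@lebesgue_rV2 n) (sigma_finite_product (lebesgue_rV n) (lebesgue_rV n)).

End lebesgue_rV.

Arguments lebesgue_rV2 R n A : clear implicits.

Section euclidean.
Context {R : realType} {n : nat}.
Implicit Types u v : 'rV[R]_n.

Definition dotv u v : R := \sum_(i < n) u ord0 i * v ord0 i.

(* The library norm `|v| on 'rV[R]_n is the sup norm. *)
Definition enorm v : R := Num.sqrt (dotv v v).

Definition enorm2 (z : 'rV[R]_n * 'rV[R]_n) : R :=
  Num.sqrt (enorm z.1 ^+ 2 + enorm z.2 ^+ 2).

End euclidean.

Section integrability.
Context d {T : measurableType d} {R : realType} {n : nat}.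
Variable m : {measure set T -> \bar R}.

Definition in_L1 (f : T -> 'rV[R]_n) : Prop :=
  forall i, m.-integrable [set: T] (fun x => (f x ord0 i)%:E).

Definition in_L2 (f : T -> 'rV[R]_n) : Prop :=
  measurable_fun [set: T] f /\
  ('N[m]_2%:E[EFin \o enorm \o f] < +oo)%E.

End integrability.

Section couplings.
Context {R : realType}.

Definition is_coupling d1 d2 (T1 : measurableType d1) (T2 : measurableType d2)
    (g : probability (T1 * T2)%type R) (p : probability T1 R)
    (q : probability T2 R) : Prop :=
  (forall A, measurable A -> g (A `*` [set: T2]) = p A) /\
  (forall B, measurable B -> g ([set: T1] `*` B) = q B).

Context {n : nat}.
Implicit Types (mu nu : probability 'rV[R]_n R).
Implicit Types (p q : probability ('rV[R]_n * 'rV[R]_n)%type R).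

Definition in_P2 mu : Prop := (\int[mu]_x (enorm x ^+ 2)%:E < +oo)%E.

Definition in_Pi mu nu p : Prop :=
  (\int[p]_z (enorm2 z ^+ 2)%:E < +oo)%E /\ is_coupling p mu nu.

Definition W2 p q : \bar R :=
  ereal_inf [set ('N[g]_2%:E[EFin \o (fun w => enorm2 (w.1 - w.2)%R)])%E
            | g in [set g | is_coupling g p q]].

End couplings.

Section conditional_expectation.
Context {R : realType} d d' (T : measurableType d) (U : measurableType d').

(* m is a version of u |-> E_p[f | pr = u], a function determined only up to a
   null set of the law of pr under p. *)
Definition is_condexp n (p : probability T R) (pr : T -> U)
    (f : T -> 'rV[R]_n) (m : U -> 'rV[R]_n) : Prop :=
  [/\ measurable_fun [set: U] m, in_L1 p f, in_L1 p (m \o pr) &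
      forall i A, measurable A ->
        (\int[p]_(z in pr @^-1` A) (m (pr z) ord0 i)%:E =
         \int[p]_(z in pr @^-1` A) (f z ord0 i)%:E)%E].

End conditional_expectation.

Section calculus.
Context {R : realType}.

(* f'(t) = l along the half-line [0, +oo[: two-sided for t > 0, one-sided at
   t = 0. *)
Definition derive_halfline (V : normedModType R) (f : R -> V) (t : R) (l : V) :
    Prop :=
  (fun h => h^-1 *: (f (t + h) - f t)) @ within [set h | 0 <= t + h] 0^' --> l.

(* On a finite-dimensional space, the usual C^k: all iterated directional
   derivatives up to order k exist and are continuous. *)
Fixpoint is_Ck (V : normedModType R) (k : nat) (f : V -> R) : Prop :=
  continuous f /\
  if k is l.+1 then forall v, (forall z, derivable f z v) /\ is_Ck l ('D_v f)
  else True.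

Definition smooth (V : normedModType R) (f : V -> R) : Prop :=
  forall k, is_Ck k f.

Definition test_function (V : normedModType R) (g : V -> R) : Prop :=
  smooth g /\ compact (closure [set z | g z != 0]).

Context {n : nat}.
Implicit Types (f : 'rV[R]_n * 'rV[R]_n -> R) (z : 'rV[R]_n * 'rV[R]_n).

Definition grad_x f z : 'rV[R]_n :=
  \row_i 'D_(delta_mx ord0 i, 0 : 'rV[R]_n) f z.

Definition grad_y f z : 'rV[R]_n :=
  \row_i 'D_(0 : 'rV[R]_n, delta_mx ord0 i) f z.

End calculus.

Section joint_law.
Context d (T : measurableType d) {R : realType} {n : nat}.
Variables (P : probability T R) (X Y : {mfun T >-> 'rV[R]_n}).

Definition pair_rv (w : T) : 'rV[R]_n * 'rV[R]_n := (X w, Y w).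

Let measurable_pair_rv : measurable_fun [set: T] pair_rv.
Proof. exact: measurable_fun_pair. Qed.

HB.instance Definition _ := isMeasurableFun.Build _ _ _ _ pair_rv
  measurable_pair_rv.

Definition joint_law : probability ('rV[R]_n * 'rV[R]_n)%type R :=
  distribution P pair_rv.

End joint_law.

Section OCD.
Context {R : realType} {n : nat}.
Local Notation E := ('rV[R]_n).

(* rho is a weak solution of
   d_t rho + div_x (rho v1) + div_y (rho v2) = 0 on [0, +oo[. *)
Definition weak_solution (rho : R -> E * E -> R) (v1 v2 : R -> E * E -> E) :
    Prop :=
  forall g : E * E -> R, test_function g -> forall t, 0 <= t ->
  let rhs z := dotv (grad_x g z) (v1 t z) + dotv (grad_y g z) (v2 t z) in
  [/\ (lebesgue_rV2 R n).-integrable setT (fun z => (g z * rho t z)%:E),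
      (lebesgue_rV2 R n).-integrable setT (fun z => (rhs z * rho t z)%:E) &
      derive_halfline (fun s => \int[lebesgue_rV2 R n]_z (g z * rho s z)) t
        (\int[lebesgue_rV2 R n]_z (rhs z * rho t z))].

(* The operators S_{p,x}[grad_x c] and S_{p,y}[grad_y c], where m is a version
   of the conditional expectation given the first (resp. second) variable. *)
Definition S_x (c : E * E -> R) (m : E -> E) (z : E * E) : E :=
  grad_x c z - m z.1.

Definition S_y (c : E * E -> R) (m : E -> E) (z : E * E) : E :=
  grad_y c z - m z.2.

Variables (c : E * E -> R) (mX mY : R -> E -> E).

(* Velocity field of the dynamics, mX t and mY t being versions of
   x |-> E_{p_t}[grad_x c | X_t = x] and y |-> E_{p_t}[grad_y c | Y_t = y]. *)
Definition ocd_vx (t : R) (z : E * E) : E := - grad_x c z + mX t z.1.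
Definition ocd_vy (t : R) (z : E * E) : E := - grad_y c z + mY t z.2.

Variables (d : measure_display) (T : measurableType d) (P : probability T R).
Variables X Y : R -> {mfun T >-> E}.

Local Notation p t := (joint_law P (X t) (Y t)).

(* The conditional expectations enter the dynamics through the versions mX and
   mY; almost every path solves the ODE at every time t >= 0. *)
Definition ocd_solution : Prop :=
  [/\ forall t, 0 <= t -> is_condexp (p t) fst (grad_x c) (mX t),
      forall t, 0 <= t -> is_condexp (p t) snd (grad_y c) (mY t) &
      {ae P, forall w, forall t, 0 <= t ->
        derive_halfline (fun s => X s w) t (ocd_vx t (X t w, Y t w)) /\
        derive_halfline (fun s => Y s w) t (ocd_vy t (X t w, Y t w))}].

Variables (mu nu : probability E R) (rho : R -> E * E -> R).

Record regularity : Prop := Regularity {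
  reg_density : forall t, 0 <= t ->
    (lebesgue_rV2 R n).-integrable setT (EFin \o rho t) /\
    forall A, measurable A ->
      p t A = (\int[lebesgue_rV2 R n]_(z in A) (rho t z)%:E)%E ;
  reg_moment : forall t, 0 <= t ->
    (\int[lebesgue_rV2 R n]_z (enorm2 z ^+ 2 * rho t z)%:E < +oo)%E ;
  reg_weak_continuous : forall phi : E * E -> R,
    measurable_fun setT phi ->
    ('N[lebesgue_rV2 R n]_+oo[EFin \o phi] < +oo)%E ->
    {within `[0, +oo[, continuous
      (fun t => \int[lebesgue_rV2 R n]_z (phi z * rho t z))} ;
  reg_velocity_L2 : forall t, 0 <= t ->
    in_L2 (p t) (ocd_vx t) /\ in_L2 (p t) (ocd_vy t) ;
  reg_velocity_L1 : forall t, 0 <= t ->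
    in_L1 (lebesgue_rV2 R n) (fun z => rho t z *: ocd_vx t z) /\
    in_L1 (lebesgue_rV2 R n) (fun z => rho t z *: ocd_vy t z) ;
  reg_C1 : is_Ck 1 c ;
  reg_growth : exists C : R, forall x y : E,
    enorm (grad_x c (x, y)) + enorm (grad_y c (x, y))
      <= C * (1 + enorm x + enorm y) ;
  reg_condexp : forall t, 0 <= t ->
    in_L2 mu (mX t) /\ in_L2 nu (mY t) ;
  reg_lipschitz : exists2 L : R, 0 < L &
    forall q1 q2, in_Pi mu nu q1 -> in_Pi mu nu q2 ->
    (forall a b : E -> E,
      is_condexp q1 fst (grad_x c) a -> is_condexp q2 fst (grad_x c) b ->
      ('N[mu]_2%:E[EFin \o (fun x => enorm (a x - b x)%R)] <= L%:E * W2 q1 q2)%E) /\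
    (forall a b : E -> E,
      is_condexp q1 snd (grad_y c) a -> is_condexp q2 snd (grad_y c) b ->
      ('N[nu]_2%:E[EFin \o (fun y => enorm (a y - b y)%R)] <= L%:E * W2 q1 q2)%E)
}.

End OCD.

(* Main.v *)
From HB Require Import structures.
Require Import Defs.
From mathcomp Require Import all_boot all_order all_algebra.
From mathcomp Require Import all_classical all_reals all_analysis.
From mathcomp Require Import measurable_realfun ring lra.

(** Along almost every path the process Z_t = (X_t, Y_t) is differentiable at
    every time, with velocity V_t given by the dynamics.  For a test function
    g the chain rule gives (g(Z_t))' = grad g(Z_t) . V_t, and taking
    expectations gives the weak equation for the law p_t of Z_t, hence for its
    density.  The whole difficulty is to differentiate under the expectation:
    the conditional expectations that enter V_t are given separately for each
    time, and nothing bounds V_t uniformly in time a priori.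

    Mean value inequality.  If f is differentiable at every point of [a, b],
    with f' <= u and u >= 0 measurable, then f(b) - f(a) is at most the integral
    of u, infinite or not ([increment_le_integral]).  Applied path by path and
    combined with Tonelli, it shows that E f_b - E f_a is at
    most K (b - a) as soon as the expected derivative is at most K and the
    expected absolute derivative is bounded ([expected_mean_value]).

    Moments.  A conditional expectation contracts L1 and grad c grows linearly,
    so that E |V_t| <= C (1 + E |Z_t|).  At this point E |Z_t| is only known to
    be finite at each time and lower semicontinuous in time.  A Baire argument
    turns this into local boundedness: on an interval where the moment is
    bounded, the mean value inequality controls it by its value at any single
    point, so times of local unboundedness would accumulate at times where the
    moment is arbitrarily large ([locally_bounded_of_bootstrap]).

    Marginals.  For a function of X_t alone the expected derivative vanishes,
    because the x-velocity is orthogonal to the functions of X_t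
    ([condexp_orthogonal]).  Hence the expectation of such a function is
    constant in time, and the law of X_t is mu for every t; similarly the law of
    Y_t is nu ([marginal_x], [marginal_y]).  So p_t is a coupling of mu and nu.

    Continuity in time.  As the marginals are fixed, second moments are
    constant, and pathwise continuity improves to continuity in L2; therefore
    W2 (p_s, p_t) tends to 0 as s tends to t ([W2_continuous]).  The Lipschitz
    hypothesis then makes the conditional expectations continuous in time, and
    weak continuity of the densities in L1 takes care of the other factors:
    s |-> E [grad g(Z_s) . V_s] is continuous ([drift_continuous]).  The mean
    value inequality on short intervals, for g and for - g, identifies this
    function with the derivative of E g(Z_s) ([weak_formulation]). *)

Set Implicit Arguments.
Unset Strict Implicit.
Unset Printing Implicit Defensive.

Import Order.TTheory GRing.Theory Num.Theory.
Import numFieldNormedType.Exports.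

Local Open Scope classical_set_scope.
Local Open Scope ring_scope.

(** * The mean value inequality for everywhere differentiable functions *)

Section real_induction.
Context {R : realType}.

(** The continuous analogue of induction along [a, b]: consider the supremum of
    the points below which S holds. *)
Lemma real_induction (a b : R) (S : R -> Prop) : a <= b -> S a ->
  (forall x, a <= x -> x < b -> (forall y, a <= y <= x -> S y) ->
    exists2 d, 0 < d & forall y, x < y -> y < x + d -> y <= b -> S y) ->
  (forall x, a < x -> x <= b -> (forall y, a <= y -> y < x -> S y) -> S x) ->
  forall x, a <= x <= b -> S x.
Proof.
move=> ab Sa right_step left_step.
pose A := [set x | a <= x <= b /\ forall y, a <= y <= x -> S y].
have Aa : A a.
  split; first by rewrite lexx ab.
  by move=> y /andP[ay ya]; rewrite (_ : y = a)//; apply/le_anti/andP.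
have Ab : has_ubound A by exists b => x [/andP[]].
have sA : has_sup A by split; [exists a|].
set s := sup A.
have as_ : a <= s by exact: ub_le_sup.
have sb : s <= b by apply: ge_sup; [exists a|move=> x [/andP[]]].
have Slt y : a <= y -> y < s -> S y.
  move=> ay ys; have ys0 : 0 < s - y by rewrite subr_gt0.
  have [x [_ Ax]] := sup_adherent ys0 sA; rewrite subKr => yx.
  by apply: Ax; rewrite ay ltW.
have Ss : S s.
  have [as'|sa] := ltP a s; first exact: left_step.
  by rewrite (_ : s = a)//; apply/le_anti; rewrite sa as_.
have As : forall y, a <= y <= s -> S y.
  move=> y /andP[ay]; rewrite le_eqVlt => /orP[/eqP->//|]; exact: Slt.
have [sltb|bs] := ltP s b; last first.
  by move=> x /andP[ax xb]; apply: As; rewrite ax (le_trans xb).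
have [d d0 sd] := right_step s as_ sltb As.
pose y := Num.min b (s + d / 2).
have sy : s < y by rewrite lt_min sltb/= ltrDl divr_gt0.
have /(ub_le_sup Ab) : A y.
  split; first by rewrite (le_trans as_ (ltW sy)) ge_min lexx.
  move=> z /andP[az zy]; have [zs|sz] := leP z s; first by apply: As; rewrite az.
  apply: sd => //.
    rewrite (le_lt_trans zy)// gt_min; apply/orP; right.
    by rewrite ltrD2l ltr_pdivrMr// ltr_pMr// ltr1n.
  by rewrite (le_trans zy)// ge_min lexx.
by rewrite leNgt -/s sy.
Qed.

End real_induction.

Section mean_value_integral.
Context {R : realType}.
Local Notation lam := (@lebesgue_measure R).

(** Cover the level set of u at height about k e by an open set O k of almost
    the same measure, and let H x be the sum over k of (k + 2) e times the
    measure of O k on ]a, x].  Near a point of level k the increments of H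
    dominate those of f, so that f x - f a <= H x by real induction, while H b
    exceeds the integral of u by little. *)
Lemma increment_le_integral (f u : R -> R) (a b : R) : a <= b ->
  (forall x, 0 <= u x) -> measurable_fun setT u ->
  (forall x e : R, a <= x <= b -> 0 < e -> exists2 d : R, 0 < d &
     forall y, a <= y <= b -> `|y - x| < d ->
       (x <= y -> f y - f x <= (u x + e) * (y - x)) /\
       (y <= x -> f x - f y <= (u x + e) * (x - y))) ->
  ((f b - f a)%:E <= \int[lam]_(x in `[a, b]) (u x)%:E)%E.
Proof.
move=> ab u0 mu fu; set I := (\int[lam]_(x in _) _)%E.
have muE : measurable_fun setT (EFin \o u) by exact/measurable_EFinP.
suff H (e : R) : 0 < e -> ((f b - f a)%:E <= I + (2 * e * (b - a) + e)%:E)%E.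
  apply/lee_addgt0Pr => e e0.
  have M0 : 0 < 2 * (b - a) + 1 :> R by rewrite ltr_wpDl// mulr_ge0// subr_ge0.
  have := H (e / (2 * (b - a) + 1)) (divr_gt0 e0 M0).
  rewrite (_ : 2 * _ * _ + _ = e)//; have := lt0r_neq0 M0.
  by move=> ?; field.
move=> e0.
pose E k := `[a, b]%classic `&` u @^-1` `[k%:R * e, k.+1%:R * e[%classic.
have mE k : measurable (E k).
  apply: measurableI => //; rewrite -[X in measurable X]setTI.
  by apply: mu => //; exact: measurable_itv.
have lamE k : (lam (E k) < +oo)%E.
  apply: (@le_lt_trans _ _ (lam `[a, b]%classic)).
    apply: le_measure; rewrite ?inE; [exact: mE|exact: measurable_itv|by move=> x []].
  by rewrite lebesgue_measure_itv/=; case: ifPn => _; rewrite -?EFinB ltry.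
(* One unit of e in the slope w k is for the mesh of the level sets, the other
   for the slack e in the hypothesis on difference quotients. *)
pose w k : R := k.+2%:R * e.
have w0 k : 0 < w k by rewrite mulr_gt0.
have eta0 k : 0 < (e / (2 ^ k.+1)%:R) / w k by rewrite !divr_gt0// ltr0n expn_gt0.
pose O k := sval (cid (lebesgue_regularity_outer (mE k) (lamE k) (eta0 k))).
have OP k : [/\ open (O k), E k `<=` O k &
    (lam (O k `\` E k) < ((e / (2 ^ k.+1)%:R) / w k)%:E)%E].
  by rewrite /O; case: cid.
have mO k : measurable (O k) by apply: open_measurable; have [] := OP k.
pose H x := (\sum_(k <oo) ((w k)%:E * lam (O k `&` `]a, x])))%E.
have wl0 k A : (0 <= (w k)%:E * lam A)%E by rewrite mule_ge0// lee_fin ltW.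
have Hge x y k : a <= x -> x <= y -> `]x, y] `<=` O k ->
    (H x + (w k * (y - x))%:E <= H y)%E.
  move=> ax xy xyO.
  have -> : H y = (H x + \sum_(k <oo) ((w k)%:E * lam (O k `&` `]x, y])))%E.
    rewrite -nneseriesD//; apply: eq_eseriesr => j _.
    rewrite -ge0_muleDr//; congr (_ * _)%E.
    have mI c d' : measurable (O j `&` `]c, d']) by apply: measurableI; [exact: mO|exact: measurable_itv].
    rewrite -measureU; [|exact: mI|exact: mI|]; last first.
      rewrite -subset0 => z/= [[_ +] [_]]; rewrite !in_itv/=.
      by move=> /andP[_ zx] /andP[]; rewrite ltNge zx.
    rewrite -setIUr; congr (lam (_ `&` _)); apply/seteqP; split=> z/=; rewrite !in_itv/=.
      by move=> /andP[az zy]; have [zx|xz] := leP z x; [left|right]; rewrite ?az ?zy.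
    by move=> [/andP[-> zx]|/andP[xz ->]]; rewrite ?(le_trans zx)// (le_lt_trans ax).
  rewrite leeD2l//.
  have := @nneseries_lim_ge R (fun j => (w j)%:E * lam (O j `&` `]x, y]))%E xpredT 0 k.+1.
  move=> /(_ (fun j _ _ => wl0 j _)); apply: le_trans.
  rewrite big_nat_recr//= (setIidr xyO) lebesgue_measure_itv/=.
  have s0 : (0 <= \sum_(0 <= i < k) (w i)%:E * lam (O i `&` `]x, y]))%E.
    by apply: sume_ge0 => i _; exact (wl0 _ _).
  move: xy s0; rewrite le_eqVlt => /orP[/eqP<- s0|xy s0].
    by rewrite lte_fin ltxx mule0 subrr mulr0 adde0.
  by rewrite lte_fin xy -EFinB -EFinM leeDr.
have cover x : a <= x <= b -> exists k, E k x.
  move=> xab; exists (Num.truncn (u x / e)); split => /=; rewrite in_itv/=//.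
  have /andP[h1 h2] := truncn_itv (divr_ge0 (u0 x) (ltW e0)).
  by rewrite -ler_pdivlMr// h1 -ltr_pdivrMr.
have loc x : a <= x <= b -> exists k, exists2 d, 0 < d &
   forall y, a <= y <= b -> `|y - x| < d -> [/\ O k y,
      (x <= y -> f y - f x <= w k * (y - x)) &
       (y <= x -> f x - f y <= w k * (x - y))].
  move=> xab; have [k Ek] := cover x xab; exists k.
  have [oO EO _] := OP k.
  have [r /= r0 rO] : nbhs_ball x (O k).
    by apply/nbhs_ballP; apply: open_nbhs_nbhs; split => //; exact: EO.
  have [d d0 fd] := fu x e xab e0.
  exists (Num.min r d); first by rewrite lt_min r0.
  move=> y yab; rewrite lt_min => /andP[yr yd].
  have [f1 f2] := fd y yab yd.
  have uw : u x + e <= w k.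
    case: Ek => _ /=; rewrite in_itv/= => /andP[_ /ltW uk].
    by rewrite /w -addn1 natrD mulrDl mul1r lerD2r.
  split.
  - by apply: rO; rewrite /ball/= distrC.
  - move=> xy; apply: (le_trans (f1 xy)); rewrite ler_wpM2r// subr_ge0//.
  - move=> xy; apply: (le_trans (f2 xy)); rewrite ler_wpM2r// subr_ge0//.
have main x : a <= x <= b -> ((f x - f a)%:E <= H x)%E.
  apply: (@real_induction R a b (fun x => ((f x - f a)%:E <= H x)%E)) => //.
  - by rewrite subrr; apply: nneseries_ge0 => k _ _; exact (wl0 _ _).
  - move=> {}x ax xb /(_ x); rewrite ax lexx => /(_ isT) Hx.
    have xab : a <= x <= b by rewrite ax ltW.
    have [k [d d0 kd]] := loc x xab.
    exists d => // y xy yd yb.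
    have near z : x < z -> z <= y -> a <= z <= b /\ `|z - x| < d.
      move=> xz zy; rewrite (le_trans ax (ltW xz)) (le_trans zy yb); split => //.
      by rewrite gtr0_norm ?subr_gt0// ltrBlDl (le_lt_trans zy).
    apply: le_trans (Hge x y k ax (ltW xy) _); last first.
      move=> z/=; rewrite in_itv/= => /andP[xz zy].
      by have [zab zd] := near z xz zy; have [] := kd z zab zd.
    have [yab dy] := near y xy (lexx _).
    have [_ /(_ (ltW xy)) fyx _] := kd y yab dy.
    rewrite (_ : f y - f a = (f x - f a) + (f y - f x)); last by ring.
    by rewrite EFinD leeD.
  - move=> {}x ax xb IH.
    have xab : a <= x <= b by rewrite ltW.
    have [k [d d0 kd]] := loc x xab.
    pose z := Num.max a (x - d / 2).
    have zx : z < x by rewrite gt_max ax ltrBlDr ltrDl divr_gt0.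
    have az : a <= z by rewrite le_max lexx.
    have near y : z <= y -> y <= x -> a <= y <= b /\ `|y - x| < d.
      move=> zy yx; rewrite (le_trans az zy) (le_trans yx xb); split => //.
      rewrite distrC ger0_norm ?subr_ge0// ltrBlDr -ltrBlDl.
      apply: lt_le_trans zy; rewrite /z lt_max; apply/orP; right.
      by rewrite ltrD2l ltrN2 ltr_pdivrMr// ltr_pMr// ltr1n.
    apply: le_trans (Hge z x k az (ltW zx) _); last first.
      move=> y/=; rewrite in_itv/= => /andP[zy yx].
      by have [yab yd] := near y (ltW zy) yx; have [] := kd y yab yd.
    have [zab dz] := near z (lexx _) (ltW zx).
    have [_ _ /(_ (ltW zx)) fyx] := kd z zab dz.
    rewrite (_ : f x - f a = (f z - f a) + (f x - f z)); last by ring.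
    by rewrite EFinD leeD// IH.
have /main/le_trans : a <= b <= b by rewrite ab lexx.
apply.
have tE : trivIset setT E.
  apply/trivIsetP => i j _ _; wlog ij : i j / (i < j)%N.
    move=> hw; rewrite neq_ltn => /orP[ij|ji]; first by apply: hw => //; rewrite neq_ltn ij.
    by rewrite setIC; apply: hw => //; rewrite neq_ltn ji.
  move=> _; rewrite -subset0 => x/= [[_ +] [_]]/=; rewrite !in_itv/=.
  move=> /andP[_ ui] /andP[uj _]; have := le_lt_trans uj ui.
  by rewrite ltr_pM2r// ltr_nat ltnS leqNgt ij.
have UE : \bigcup_k E k = `[a, b]%classic.
  apply/seteqP; split=> [x [k _ []]//|x /=].
  by rewrite in_itv/= => /cover[k Ek]; exists k.
apply: (@le_trans _ _ (\sum_(k <oo) (\int[lam]_(x in E k) (u x + 2 * e)%:E + (e / (2 ^ k.+1)%:R)%:E))%E).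
  apply: lee_nneseries => [k _ _|k _]; first exact (wl0 _ _).
  have [oO EO etaO] := OP k.
  have : (lam (O k `&` `]a, b]) <= lam (E k) + ((e / (2 ^ k.+1)%:R) / w k)%:E)%E.
    apply: (@le_trans _ _ (lam (O k))).
      apply: le_measure; rewrite ?inE; [|exact: mO|by move=> x []].
      by apply: measurableI; [exact: mO|exact: measurable_itv].
    rewrite -(setDUK EO) measureU; [|exact: mE|by apply: measurableD; [exact: mO|exact: mE]|]; last first.
      by rewrite setDE setIC -setIA setICl setI0.
    by rewrite leeD2l// ltW.
  have wk0 : (0 <= (w k)%:E)%E by rewrite lee_fin ltW.
  move=> /(lee_wpmul2l wk0)/le_trans; apply.
  rewrite ge0_muleDr; [|exact: measure_ge0|by rewrite lee_fin ltW].
  rewrite -EFinM mulrC divfK ?gt_eqF// leeD2r//.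
  rewrite -integral_cst; last exact: mE.
  apply: ge0_le_integral; first exact: mE.
  - by move=> x _; rewrite lee_fin ltW.
  - exact: measurable_cst.
  - by apply/measurable_EFinP; apply: measurable_funD; [exact: measurable_funTS|exact: measurable_cst].
  - move=> x [_ /=]; rewrite in_itv/= => /andP[ux _].
    by rewrite lee_fin /w -(addn2 k) natrD mulrDl lerD2r.
apply: le_trans (epsilon_trick _ _ (ltW e0)) _.
  by move=> k; apply: integral_ge0 => x _; rewrite lee_fin addr_ge0// mulr_ge0// ltW.
rewrite -ge0_integral_bigcup//; last 2 first.
- by apply/measurable_EFinP; apply: measurable_funD => //; exact: measurable_funTS.
- by move=> x _; rewrite lee_fin addr_ge0// mulr_ge0// ltW.
rewrite UE.
under eq_integral do rewrite EFinD.
rewrite ge0_integralD//; last 3 first.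
- by move=> x _; rewrite lee_fin.
- exact: measurable_funTS.
- by move=> x _; rewrite lee_fin mulr_ge0// ltW.
rewrite integral_cst//= lebesgue_measure_itv/= -addeA leeD2l//.
move: ab; rewrite le_eqVlt => /orP[/eqP<-|ab].
  by rewrite lte_fin ltxx mule0 subrr mulr0 ?add0r ?add0e.
by rewrite lte_fin ab -EFinB -EFinM -EFinD.
Qed.

End mean_value_integral.

(** * Local boundedness from a bootstrap inequality *)

Section local_boundedness.
Context {R : realType}.
Implicit Types (G : R -> R) (C a b s t : R).

Definition bounded_at G t := exists2 d : R, 0 < d & exists M, forall s, `|s - t| < d -> G s <= M.

Definition lower_semicont G := forall M t, M < G t ->
  exists2 d : R, 0 < d & forall s, `|s - t| < d -> M < G s.

(** The growth condition that a mean value inequality with speed at most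
    C (1 + G) yields; it applies only on intervals where G is already known to
    be bounded. *)
Definition bootstraps G C := forall a b M, a <= b ->
  (forall s, a <= s <= b -> G s <= M) ->
  forall s t, a <= s <= b -> a <= t <= b -> G t <= G s + C * (1 + M) * (b - a).

Lemma bounded_at_segment G a b : a <= b ->
  (forall t, a <= t <= b -> bounded_at G t) ->
  exists M, forall s, a <= s <= b -> G s <= M.
Proof.
move=> ab Gb.
have H : forall x, a <= x <= b -> exists M, forall s, a <= s <= x -> G s <= M.
  apply: (@real_induction R a b) => //.
  - by exists (G a) => s ass; rewrite (_ : s = a)//; apply/le_anti; rewrite andbC.
  - move=> x ax xb /(_ x); rewrite ax lexx => /(_ isT)[M GM].
    have [|d d0 [N GN]] := Gb x; first by rewrite ax (ltW xb).
    exists d => // y xy yd yb; exists (Num.max M N) => s /andP[as_ sy].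
    rewrite le_max; have [sx|xs] := leP s x; first by rewrite GM ?as_.
    rewrite GN ?orbT// gtr0_norm ?subr_gt0// ltrBlDl.
    exact: le_lt_trans yd.
  - move=> x ax xb IH.
    have [|d d0 [N GN]] := Gb x; first by rewrite (ltW ax) xb.
    pose y := Num.max a (x - d / 2).
    have yx : y < x by rewrite gt_max ax ltrBlDr ltrDl divr_gt0.
    have ay : a <= y by rewrite le_max lexx.
    have [M GM] := IH y ay yx.
    exists (Num.max M N) => s /andP[as_ sx].
    rewrite le_max; have [sy|ys] := leP s y; first by rewrite GM ?as_.
    rewrite GN ?orbT// distrC ger0_norm ?subr_ge0// ltrBlDr -ltrBlDl.
    apply: lt_trans ys; rewrite /y lt_max; apply/orP; right.
    by rewrite ltrD2l ltrN2 ltr_pdivrMr// ltr_pMr// ltr1n.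
by apply: H; rewrite ab lexx.
Qed.

(** The bootstrap, used with M the supremum of G, gives
    M <= G s + (1 + M) / 2.  Hence the bound depends on one value of G, and not
    on the bound M that was assumed. *)
Lemma bootstrap_bound G C a b M : (forall s, 0 <= G s) -> 0 <= C ->
  bootstraps G C -> a <= b -> C * (b - a) <= 1 / 2 ->
  (forall s, a <= s <= b -> G s <= M) ->
  forall s t, a <= s <= b -> a <= t <= b -> G t <= 2 * G s + 1.
Proof.
move=> G0 C0 Gg ab Cab GM s t sab tab.
pose B := sup [set G u | u in [set u | a <= u <= b]].
have ubB : has_ubound [set G u | u in [set u | a <= u <= b]].
  by exists M => _ [u uab <-]; exact: GM.
have GB u : a <= u <= b -> G u <= B by move=> uab; apply: ub_le_sup => //; exists u.
have B0 : 0 <= B by apply: le_trans (GB s sab).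
suff : B <= 2 * G s + 1 by apply: le_trans; exact: GB.
have : B <= G s + 1 / 2 * (1 + B).
  apply: ge_sup; first by exists (G s), s.
  move=> _ [u uab <-]; apply: le_trans (Gg a b B ab GB s u sab uab) _.
  by rewrite lerD2l mulrAC ler_wpM2r// addr_ge0.
by lra.
Qed.

(** Let a be the last point of unboundedness before u.  On ]a, u] the function
    is bounded on compact subintervals, hence bounded by 2 G u + 1 on all of
    ]a, u]; since G a is finite, the bootstrap on [a, u] then bounds G u in
    terms of G a only. *)
Lemma bad_points_right G C M t u : (forall s, 0 <= G s) -> 0 <= C ->
  bootstraps G C -> t < u -> C * (u - t) <= 1 / 2 ->
  ~ bounded_at G t ->
  (forall s, t <= s <= u -> ~ bounded_at G s -> G s <= M) -> 0 <= M ->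
  G u <= 2 * M + 1.
Proof.
move=> G0 C0 Gg tu Ctu tbad badM M0.
have [ugood|ubad] := pselect (bounded_at G u); last first.
  by have := badM u; rewrite ltW// lexx => /(_ isT ubad); lra.
pose K := [set s | t <= s <= u /\ ~ bounded_at G s].
have Kt : K t by split=> //; rewrite lexx ltW.
have ubK : has_ubound K by exists u => s [/andP[]].
have supK : has_sup K by split; [exists t|].
pose a := sup K.
have ta : t <= a by exact: ub_le_sup.
have au : a <= u by apply: ge_sup; [exists t|move=> s [/andP[]]].
have abad : ~ bounded_at G a.
  move=> [d d0 [N GN]].
  have [s [/andP[ts su] sbad] sa] := sup_adherent d0 supK.
  have Ks : K s by split=> //; rewrite ts su.
  have sa' : s <= a by exact: ub_le_sup.
  apply: sbad.
  exists (d - (a - s)); first by move: sa; rewrite -/a; lra.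
  exists N => y yd; apply: GN.
  rewrite -(subrK s y) -addrA (le_lt_trans (ler_normD _ _))//.
  by rewrite (distrC s) (ger0_norm (_ : 0 <= a - s)) ?subr_ge0//; lra.
have {}au : a < u.
  rewrite lt_neqAle au andbT; apply: contra_notN abad => /eqP->//.
have Ga : G a <= M by apply: badM => //; rewrite ta ltW.
have good s : a < s -> s <= u -> bounded_at G s.
  move=> as_ su; apply: contrapT => sbad; have : s <= a.
    by apply: ub_le_sup => //; split=> //; rewrite su (le_trans ta)// ltW.
  by rewrite leNgt as_.
have Ca a' : a <= a' -> C * (u - a') <= 1 / 2.
  move=> aa'; apply: le_trans Ctu; rewrite ler_wpM2l// lerD2l lerN2.
  exact: le_trans aa'.
have Gau s : a < s -> s <= u -> G s <= 2 * G u + 1.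
  move=> as_ su; have [||N GN] := @bounded_at_segment G s u => //.
    by move=> x /andP[sx xu]; apply: good => //; exact: lt_le_trans sx.
  apply: (bootstrap_bound G0 C0 Gg su (Ca _ (ltW as_)) GN); by rewrite ?lexx ?su.
have Gb s : a <= s <= u -> G s <= Num.max M (2 * G u + 1).
  move=> /andP[]; rewrite le_eqVlt => /orP[/eqP<- _|as_ su].
    by rewrite le_max Ga.
  by rewrite le_max Gau ?orbT.
have := bootstrap_bound G0 C0 Gg (ltW au) (Ca _ (lexx _)) Gb (s := a) (t := u).
rewrite !lexx (ltW au) => /(_ isT isT); lra.
Qed.

Lemma norm_opp_sub (x y : R) : `|- x - - y| = `|x - y|.
Proof. by rewrite -opprB opprK addrC -opprB normrN opprB addrC. Qed.

Lemma bounded_at_opp G t : bounded_at (fun s => G (- s)) t <-> bounded_at G (- t).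
Proof.
split=> -[d d0 [M GM]]; exists d => //; exists M => s sd.
  by rewrite -(opprK s); apply: GM; rewrite -norm_opp_sub opprK.
by apply: GM; rewrite norm_opp_sub.
Qed.

Lemma bootstraps_opp G C : bootstraps G C -> bootstraps (fun s => G (- s)) C.
Proof.
move=> Gg a b M ab GM s t sab tab.
have fl x : a <= x <= b -> - b <= - x <= - a by rewrite !lerN2 andbC.
have := Gg (- b) (- a) M; rewrite lerN2 => /(_ ab).
have -> : - a - - b = b - a by rewrite opprK addrC.
apply; [|exact: fl|exact: fl] => x xab; rewrite -(opprK x); apply: GM.
by rewrite lerNr lerNl andbC.
Qed.

(** Otherwise G would be at most M at all bad points near t, hence at most
    2 M + 1 near t by [bad_points_right] and its mirror image, and t would not
    be bad. *)
Lemma bad_points_dense G C M t r : (forall s, 0 <= G s) -> 0 <= C ->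
  bootstraps G C -> ~ bounded_at G t -> 0 < r ->
  exists s, [/\ `|s - t| < r, ~ bounded_at G s & M < G s].
Proof.
move=> G0 C0 Gg tbad r0; apply: contrapT => nex.
wlog M0 : M nex / 0 <= M.
  move=> hw; have [|M0] := leP 0 M; first exact: hw.
  apply: (hw 0) => // -[s [sr sbad Gs]]; apply: nex; exists s; split => //.
  exact: lt_trans Gs.
have badM s : `|s - t| < r -> ~ bounded_at G s -> G s <= M.
  by move=> sr sbad; rewrite leNgt; apply/negP => Ms; apply: nex; exists s.
(* This length makes C times the length of the interval at most 1/2, as the
   bootstrap requires. *)
pose r' := Num.min r (1 / (2 * (C + 1))).
have C1 : 0 < 2 * (C + 1) by rewrite mulr_gt0// ltr_wpDl.
have r'0 : 0 < r' by rewrite lt_min r0 divr_gt0.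
have r'r : r' <= r by rewrite ge_min lexx.
have Cr' x : 0 <= x -> x < r' -> C * x <= 1 / 2.
  move=> x0; rewrite lt_min => /andP[_]; rewrite ltr_pdivlMr//.
  by move=> h; nra.
apply: (tbad); exists r' => //; exists (2 * M + 1) => u ur'.
have [ut|tu|->] := ltgtP u t.
- have utn : - t < - u by rewrite ltrN2.
  have := @bad_points_right (fun s => G (- s)) C M (- t) (- u).
  rewrite /= (opprK u) => h; apply: h => //.
  + exact: bootstraps_opp.
  + have -> : - u - - t = t - u by rewrite opprK addrC.
    by apply: Cr'; rewrite ?subr_ge0 ?ltW//; rewrite distrC gtr0_norm ?subr_gt0// in ur'.
  + by move=> /bounded_at_opp; rewrite opprK.
  + move=> s /andP[ts su] sbad; apply: badM.
      move: ur'; rewrite distrC gtr0_norm ?subr_gt0// => ur'.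
      rewrite ler0_norm; last by lra.
      by lra.
    by move=> sg; apply: sbad; apply/bounded_at_opp.
- apply: (bad_points_right G0 C0 Gg tu) => //.
  + by apply: Cr'; rewrite ?subr_ge0 ?ltW//; rewrite gtr0_norm ?subr_gt0// in ur'.
  + move=> s /andP[ts su]; apply: badM.
    move: ur'; rewrite gtr0_norm ?subr_gt0// => ur'.
    by rewrite ger0_norm ?subr_ge0//; lra.
- have := badM t; rewrite subrr normr0 => /(_ r0 tbad); lra.
Qed.

(** Baire's argument on the closed set of points where G is locally unbounded.
    By lower semicontinuity and [bad_points_dense], if this set is nonempty
    there are nested intervals, the k-th of which is centred at a bad point and
    has G > k on it; G would be infinite at a common point. *)
Theorem locally_bounded_of_bootstrap G C : (forall s, 0 <= G s) -> 0 <= C ->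
  lower_semicont G -> bootstraps G C ->
  forall a b, exists M, forall s, a <= s <= b -> G s <= M.
Proof.
move=> G0 C0 Glsc Gg a b.
have [ab|ba] := leP a b; last first.
  exists 0 => s /andP[as_ sb]; have := le_trans as_ sb.
  by rewrite leNgt ba.
apply: bounded_at_segment => // t0 _; apply: contrapT => t0bad.
(* An element of St is a pair (centre, radius) with a bad centre. *)
pose St := {p : R * R | 0 < p.2 /\ ~ bounded_at G p.1}.
have step (k : nat) (p : St) : {q : St | `|(sval q).1 - (sval p).1| + (sval q).2 <= (sval p).2 /\
    forall s, `|s - (sval q).1| <= (sval q).2 -> k%:R < G s}.
  apply: cid; case: p => -[t r] /= [r0 tbad].
  have r20 : 0 < r / 2 by rewrite divr_gt0.
  have [s [sr sbad Gs]] := bad_points_dense k%:R G0 C0 Gg tbad r20.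
  have [d d0 Gd] := Glsc _ _ Gs.
  have m0 : 0 < Num.min (r / 2) (d / 2) by rewrite lt_min r20 divr_gt0.
  have m1 : Num.min (r / 2) (d / 2) <= r / 2 by rewrite ge_min lexx.
  have m2 : Num.min (r / 2) (d / 2) <= d / 2 by rewrite ge_min lexx orbT.
  exists (exist _ (s, Num.min (r / 2) (d / 2)) (conj m0 sbad)) => /=; split.
    by move: sr; lra.
  by move=> x xs; apply: Gd; lra.
pose F := fix F k : St := if k is j.+1 then sval (step j (F j))
                          else exist _ (t0, 1) (conj ltr01 t0bad).
pose c k := (sval (F k)).1; pose r k := (sval (F k)).2.
have r0 k : 0 < r k by rewrite /r; case: (F k) => p [].
have Fnest k : `|c k.+1 - c k| + r k.+1 <= r k.
  by rewrite /c /r /=; case: (step k (F k)) => q /= [].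
have FG k s : `|s - c k.+1| <= r k.+1 -> k%:R < G s.
  by rewrite /c /r /=; case: (step k (F k)) => q /= [_]; apply.
have nest k j : `|c (k + j)%N - c k| + r (k + j)%N <= r k.
  elim: j => [|j IH]; first by rewrite addn0 subrr normr0 add0r.
  rewrite addnS; have := Fnest (k + j)%N.
  by have := ler_distD (c (k + j)%N) (c (k + j).+1) (c k); lra.
pose x := sup (range (fun k => c k - r k)).
have cr k j : c k - r k <= c j + r j.
  have h1 := nest k j; have := nest j k; rewrite addnC => h2.
  have := ler_norm (c (k + j)%N - c j); have := ler_norm (c k - c (k + j)%N).
  by rewrite (distrC (c k)); have := r0 (k + j)%N; lra.
have xin j : `|x - c j| <= r j.
  rewrite ler_distl; apply/andP; split.
    by apply: ub_le_sup; [exists (c 0%N + r 0%N) => _ [k _ <-]|exists j].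
  by apply: ge_sup; [exists (c 0%N - r 0%N), 0%N|move=> _ [k _ <-]].
have := FG (Num.truncn (G x)).+1 x (xin _).
by apply/negP; rewrite -leNgt ltW// truncnS_gt.
Qed.

End local_boundedness.

(** * Real-valued integrals over the whole space *)

Section integral_calculus.
Context d {T : measurableType d} {R : realType}.
Variable mu : {measure set T -> \bar R}.
Implicit Types f g : T -> R.

Definition L1 f := mu.-integrable [set: T] (EFin \o f).

Lemma L1_measurable f : L1 f -> measurable_fun setT f.
Proof. by move=> /integrableP[/measurable_EFinP]. Qed.

Lemma L1D f g : L1 f -> L1 g -> L1 (fun x => f x + g x).
Proof. by move=> Lf Lg; exact: (integrableD measurableT Lf Lg). Qed.

Lemma L1B f g : L1 f -> L1 g -> L1 (fun x => f x - g x).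
Proof. by move=> Lf Lg; exact: (integrableB measurableT Lf Lg). Qed.

Lemma L1Z (k : R) f : L1 f -> L1 (fun x => k * f x).
Proof. by move=> Lf; exact: (integrableZl measurableT k Lf). Qed.

Lemma L1_sum (I : Type) (s : seq I) (h : I -> T -> R) :
  (forall i, L1 (h i)) -> L1 (fun x => \sum_(i <- s) h i x).
Proof.
move=> Lh; rewrite /L1 (_ : EFin \o _ = fun x => (\sum_(i <- s) (h i x)%:E)%E).
  by apply: (integrable_sum measurableT) => i _; exact: Lh.
by apply/funext => x; rewrite /= sumEFin.
Qed.

Lemma L1_abs f : L1 f -> L1 (fun x => `|f x|).
Proof. by move=> Lf; exact: (integrable_abse Lf). Qed.

Lemma L1_le f g : measurable_fun setT f -> (forall x, `|f x| <= g x) ->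
  L1 g -> L1 f.
Proof.
move=> mf fg; apply: le_integrable => //; first exact/measurable_EFinP.
by move=> x _ /=; rewrite lee_fin (le_trans (fg x))// ler_norm.
Qed.

Lemma L1M f g (M : R) : measurable_fun setT f -> (forall x, `|f x| <= M) ->
  L1 g -> L1 (fun x => f x * g x).
Proof.
move=> mf fM Lg; apply: (@L1_le _ (fun x => M * `|g x|)).
- by apply: measurable_funM => //; exact: L1_measurable.
- by move=> x; rewrite normrM ler_wpM2r.
- by apply: L1Z; exact: L1_abs.
Qed.

Lemma L1_lty f : measurable_fun setT f ->
  (\int[mu]_x (`|f x|)%:E < +oo)%E -> L1 f.
Proof. by move=> mf h; apply/integrableP; split => //; exact/measurable_EFinP. Qed.

Lemma EFin_int f : L1 f -> (\int[mu]_x f x)%:E = (\int[mu]_x (f x)%:E)%E.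
Proof. by move=> Lf; rewrite /Rintegral fineK//; exact: integrable_fin_num. Qed.

Lemma intD f g : L1 f -> L1 g ->
  \int[mu]_x (f x + g x) = \int[mu]_x f x + \int[mu]_x g x.
Proof. exact: RintegralD. Qed.

Lemma intB f g : L1 f -> L1 g ->
  \int[mu]_x (f x - g x) = \int[mu]_x f x - \int[mu]_x g x.
Proof. exact: RintegralB. Qed.

Lemma intZ (k : R) f : L1 f -> \int[mu]_x (k * f x) = k * \int[mu]_x f x.
Proof. exact: RintegralZl. Qed.

Lemma int_sum (I : Type) (s : seq I) (h : I -> T -> R) :
  (forall i, L1 (h i)) ->
  \int[mu]_x (\sum_(i <- s) h i x) = \sum_(i <- s) \int[mu]_x h i x.
Proof.
move=> Lh; apply: EFin_inj; rewrite EFin_int; last exact: L1_sum.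
rewrite -sumEFin (eq_bigr (fun i => (\int[mu]_x (h i x)%:E)%E)); last first.
  by move=> i _; rewrite EFin_int.
rewrite -integral_sum//.
by apply: eq_integral => x _; rewrite sumEFin.
Qed.

Lemma int_le f g : L1 f -> L1 g -> (forall x, f x <= g x) ->
  \int[mu]_x f x <= \int[mu]_x g x.
Proof. by move=> Lf Lg fg; exact: le_Rintegral. Qed.

Lemma int_ge0 f : (forall x, 0 <= f x) -> 0 <= \int[mu]_x f x.
Proof. by move=> f0; exact: Rintegral_ge0. Qed.

Lemma int_abs f : L1 f -> `|\int[mu]_x f x| <= \int[mu]_x `|f x|.
Proof. by move=> Lf; exact: le_normr_Rintegral. Qed.

Lemma int_cvg (f_ : nat -> T -> R) f g :
  (forall n, measurable_fun setT (f_ n)) -> measurable_fun setT f ->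
  (forall x, f_ ^~ x @ \oo --> f x) -> L1 g ->
  (forall n x, `|f_ n x| <= g x) ->
  (fun n => \int[mu]_x f_ n x) @ \oo --> \int[mu]_x f x.
Proof.
move=> mf_ mf ff Lg fg.
have Lf_ n : L1 (f_ n) by exact: L1_le Lg.
have Lf : L1 f.
  apply: L1_le Lg => // x; apply: (cvgr_to_le (cvg_norm (ff x))).
  exact: nearW.
have [|||||_ _ +] := @dominated_convergence _ T R mu setT measurableT
    (fun n x => (f_ n x)%:E) (fun x => (f x)%:E) (fun x => (g x)%:E) => //.
- by move=> n; exact/measurable_EFinP.
- exact/measurable_EFinP.
- by apply: aeW => x _; apply: cvg_EFin; [exact: nearW|exact: ff].
- by apply: aeW => x n _; rewrite lee_fin.
move=> h; have : fine (\int[mu]_x (f_ n x)%:E)%E @[n --> \oo] --> fine (\int[mu]_x (f x)%:E)%E.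
  by apply: fine_cvg; rewrite fineK//; exact: integrable_fin_num.
by [].
Qed.

End integral_calculus.

Section finite_integral.
Context d {T : measurableType d} {R : realType}.
Variable P : probability T R.

Lemma L1_bounded (f : T -> R) (M : R) : measurable_fun setT f ->
  (forall x, `|f x| <= M) -> L1 P f.
Proof.
move=> mf fM; apply: (L1_le mf fM); exact: finite_measure_integrable_cst.
Qed.

Lemma L1_cst (k : R) : L1 P (cst k).
Proof. exact: finite_measure_integrable_cst. Qed.

Lemma int_cst (k : R) : \int[P]_x k = k.
Proof.
transitivity (k * fine (P setT)); first exact: (@Rintegral_cst _ _ _ P).
by rewrite probability_setT mulr1.
Qed.

End finite_integral.

(** * The mean value inequality in expectation *)

(** Differentiability relative to D, which gives a one-sided derivative at an
    end point of an interval. *)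
Definition deriv_on {R : realType} (D : set R) (f : R -> R) (x l : R) : Prop :=
  forall e : R, 0 < e -> exists2 d : R, 0 < d & forall y : R, D y ->
    `|y - x| < d -> `|f y - f x - l * (y - x)| <= e * `|y - x|.

Lemma deriv_on_continuous {R : realType} (D : set R) (f : R -> R) (x l e : R) :
  deriv_on D f x l -> 0 < e -> exists2 r : R, 0 < r &
  forall y, D y -> `|y - x| < r -> `|f y - f x| < e.
Proof.
move=> df e0; have [r r0 fr] := df 1 ltr01.
have L0 : 0 < 1 + `|l| by rewrite ltr_pwDl.
exists (Num.min r (e / (1 + `|l|))); first by rewrite lt_min r0 divr_gt0.
move=> y Dy; rewrite lt_min => /andP[yr ye].
have := fr y Dy yr; rewrite mul1r => h.
rewrite ltr_pdivlMr// in ye; apply: le_lt_trans ye.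
rewrite -(subrK (l * (y - x)) (_ - _)) (le_trans (ler_normD _ _))//.
by rewrite [leRHS]mulrDr mulr1 lerD// normrM mulrC.
Qed.

Lemma deriv_on_subset {R : realType} (D D' : set R) (f : R -> R) (x l : R) :
  D' `<=` D -> deriv_on D f x l -> deriv_on D' f x l.
Proof.
move=> DD df e e0; have [r r0 fr] := df e e0.
by exists r => // y /DD Dy; exact: fr.
Qed.

Lemma deriv_onZ {R : realType} (D : set R) (f : R -> R) (x l k : R) :
  deriv_on D f x l -> deriv_on D (fun y => k * f y) x (k * l).
Proof.
move=> df e e0; have k1 : 0 < 1 + `|k| by rewrite ltr_pwDl.
have [r r0 fr] := df (e / (1 + `|k|)) (divr_gt0 e0 k1).
exists r => // y Dy yr; have := fr y Dy yr.
rewrite (_ : _ - k * l * _ = k * (f y - f x - l * (y - x))); last by ring.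
rewrite normrM => h.
apply: (@le_trans _ _ ((1 + `|k|) * (e / (1 + `|k|) * `|y - x|))).
  by rewrite ler_pM// lerDr.
by rewrite mulrA mulrCA mulfV ?gt_eqF// mulr1.
Qed.

Section expected_mean_value.
Context d {T : measurableType d} {R : realType}.
Variable P : probability T R.
Local Notation lam := (@lebesgue_measure R).

Section tonelli.
Variable u : measurableTypeR R * T -> R.
Hypotheses (mu : measurable_fun setT u) (u0 : forall p, 0 <= u p).

Let muE : measurable_fun setT (fun p => (u p)%:E).
Proof. exact/measurable_EFinP. Qed.

Let u0E p : (0 <= (u p)%:E)%E.
Proof. by rewrite lee_fin. Qed.

Lemma tonelli_time_first :
  (\int[lam \x P]_p (u p)%:E = \int[lam]_s \int[P]_w (u (s, w))%:E)%E.
Proof. exact: (fubini_tonelli1 (fun p => (u p)%:E)). Qed.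

Lemma tonelli_swap :
  (\int[lam]_s \int[P]_w (u (s, w))%:E = \int[P]_w \int[lam]_s (u (s, w))%:E)%E.
Proof. exact: (fubini_tonelli (fun p => (u p)%:E)). Qed.

Lemma measurable_expectation :
  measurable_fun [set: measurableTypeR R] (fun s => \int[P]_w (u (s, w))%:E)%E.
Proof. exact: (measurable_fun_fubini_tonelli_F (fun p => (u p)%:E)). Qed.

Lemma measurable_time_integral :
  measurable_fun setT (fun w => \int[lam]_s (u (s, w))%:E)%E.
Proof. exact: (measurable_fun_fubini_tonelli_G (fun p => (u p)%:E)). Qed.

End tonelli.

(** Truncating the derivative at - N makes [increment_le_integral] applicable:
    f x + N x has derivative at most max (w x + N) 0. *)
Lemma deriv_on_increment (f : R -> R) (a b : R) (w : R -> R) (N : R) :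
  a <= b -> measurable_fun setT w ->
  (forall x, a <= x <= b -> deriv_on `[a, b] f x (w x)) ->
  ((f b - f a + N * (b - a))%:E <=
     \int[lam]_(x in `[a, b]) (Num.max (w x + N) 0)%:E)%E.
Proof.
move=> ab mw fw.
have := @increment_le_integral R (fun x => f x + N * x) (fun x => Num.max (w x + N) 0) a b ab.
rewrite (_ : f b + _ - _ = f b - f a + N * (b - a)); last by ring.
apply.
- by move=> x; rewrite le_max lexx orbT.
- by apply: measurable_maxr => //; exact: measurable_funD.
move=> x e xab e0; have [r r0 fr] := fw x xab e e0.
exists r => // y yab yr.
have := fr y; rewrite /= in_itv/= => /(_ yab yr).
have : w x + N <= Num.max (w x + N) 0 by rewrite le_max lexx.
set u := Num.max _ _ => wu.
rewrite ler_norml => /andP[h1 h2].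
split => [xy|yx].
  move: h2; rewrite ger0_norm ?subr_ge0// => h2.
  have : (w x + N) * (y - x) <= u * (y - x) by rewrite ler_wpM2r// subr_ge0.
  lra.
move: h1; rewrite ler0_norm ?subr_le0// => h1.
have : (w x + N) * (x - y) <= u * (x - y) by rewrite ler_wpM2r// subr_ge0.
lra.
Qed.

(** By [deriv_on_increment] and Tonelli, E f_b - E f_a + N (b - a) is at most
    the integral over [a, b] of E max (W_s + N) 0, which is at most
    K + N + E max (|W_s| - N) 0.  The last term, integrated in time, tends to 0
    as N grows, by dominated convergence. *)
Lemma expected_mean_value (f W : R -> T -> R) (a b M K : R) : a <= b ->
  measurable_fun [set: measurableTypeR R * T] (fun p => W p.1 p.2) ->
  (forall w x, a <= x <= b -> deriv_on `[a, b] (f^~ w) x (W x w)) ->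
  L1 P (f a) -> L1 P (f b) ->
  (forall s, a <= s <= b -> (\int[P]_w `|W s w|%:E <= M%:E)%E) ->
  (forall s, a <= s <= b -> \int[P]_w W s w <= K) ->
  \int[P]_w f b w - \int[P]_w f a w <= K * (b - a).
Proof.
move=> ab mW fW La Lb WM WK.
have mWs s : measurable_fun setT (W s).
  exact: (measurableT_comp mW (pair1_measurable s)).
have mWw w : measurable_fun [set: measurableTypeR R] (W^~ w).
  exact: (measurableT_comp mW (pair2_measurable w)).
have LW s : a <= s <= b -> L1 P (W s).
  by move=> sab; apply: L1_lty => //; apply: le_lt_trans (WM s sab) (ltry _).
pose I (s : measurableTypeR R) : R := \1_(`[a, b]%classic : set R) s.
have mI : measurable_fun setT I by exact: measurable_indic.
have I0 s : 0 <= I s by rewrite /I indicE; case: (_ \in _).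
have I1 s : a <= s <= b -> I s = 1.
  by move=> sab; rewrite /I indicE mem_set//= in_itv.
have Ino s : ~ (a <= s <= b) -> I s = 0.
  by move=> sab; rewrite /I indicE memNset//= in_itv.
pose r (N : nat) (p : measurableTypeR R * T) : R :=
  Num.max (`|W p.1 p.2| - N%:R) 0 * I p.1.
have mr N : measurable_fun setT (r N).
  apply: measurable_funM; last exact: measurableT_comp.
  apply: measurable_maxr => //; apply: measurable_funB => //.
  exact: measurableT_comp.
have r0 N p : 0 <= r N p by rewrite mulr_ge0// le_max lexx orbT.
pose rho N := (\int[lam \x P]_p (r N p)%:E)%E.
have lamI (k : R) : 0 <= k -> (\int[lam]_s (k * I s)%:E = (k * (b - a))%:E)%E.
  move=> k0; under eq_integral do rewrite EFinM.
  rewrite ge0_integralZl//; last 2 first.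
  - exact/measurable_EFinP.
  - by move=> s _; rewrite lee_fin.
  rewrite (integral_indic _ measurableT)//= setIT lebesgue_measure_itv/= lte_fin.
  move: ab; rewrite le_eqVlt => /orP[/eqP<-|->]; last by rewrite -EFinB -EFinM.
  by rewrite ltxx mule0 subrr mulr0.
have WMreal s : a <= s <= b -> \int[P]_w `|W s w| <= M.
  by move=> sab; rewrite -lee_fin EFin_int ?WM//; exact/L1_abs/LW.
have M0 : 0 <= M.
  by apply: le_trans (WMreal a _); [exact: int_ge0|rewrite lexx ab].
have mg : measurable_fun setT (fun p : measurableTypeR R * T => `|W p.1 p.2| * I p.1).
  by apply: measurable_funM; [exact: measurableT_comp|exact: measurableT_comp].
have g0 (p : measurableTypeR R * T) : 0 <= `|W p.1 p.2| * I p.1 by rewrite mulr_ge0.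
have Lg : L1 (lam \x P)%E (fun p : measurableTypeR R * T => `|W p.1 p.2| * I p.1).
  apply: L1_lty => //; under eq_integral do rewrite ger0_norm//.
  rewrite tonelli_time_first//.
  apply: (@le_lt_trans _ _ (\int[lam]_s (M * I s)%:E)%E); last by rewrite lamI// ltry.
  apply: ge0_le_integral => //.
  - by move=> s _; apply: integral_ge0 => w _; rewrite lee_fin (g0 (s, w)).
  - exact: (measurable_expectation mg).
  - by apply/measurable_EFinP; apply: measurable_funM.
  - move=> s _; have [sab|sab] := pselect (a <= s <= b).
      rewrite /= I1// mulr1; under eq_integral do rewrite mulr1; exact: WM.
    by rewrite /= Ino// mulr0; under eq_integral do rewrite mulr0; rewrite integral0.
have rg N p : `|r N p| <= `|W p.1 p.2| * I p.1.
  rewrite ger0_norm// ler_wpM2r// ge_max normr_ge0 andbT.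
  by rewrite lerBlDr lerDl.
have Lr N : L1 (lam \x P)%E (r N) by exact: L1_le Lg.
have rhoE N : rho N = (\int[(lam \x P)%E]_p r N p)%:E by rewrite EFin_int.
have rho0 : (rho N @[N --> \oo] --> 0)%E.
  rewrite (_ : rho = fun N => (\int[(lam \x P)%E]_p r N p)%:E); last exact/funext.
  apply: cvg_EFin; first exact: nearW.
  rewrite [X in _ --> X](_ : _ = \int[(lam \x P)%E]_p 0); last first.
    by rewrite /Rintegral integral0.
  apply: (@int_cvg _ _ _ (lam \x P)%E r (cst 0) _ mr _ _ Lg rg) => // p.
  apply: cvg_near_cst; near=> N.
  have WN : `|W p.1 p.2| <= N%:R by near: N; exact: nbhs_infty_ger.
  by rewrite /r max_r ?mul0r// subr_le0.
(* rho N is the cost of truncating W at - N. *)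
have step N : 0 <= K + N%:R ->
    ((\int[P]_w f b w - \int[P]_w f a w)%:E <= (K * (b - a))%:E + rho N)%E.
  move=> KN0.
  pose u (p : measurableTypeR R * T) : R := Num.max (W p.1 p.2 + N%:R) 0 * I p.1.
  have u0 p : 0 <= u p by rewrite mulr_ge0// le_max lexx orbT.
  have mu : measurable_fun setT u.
    apply: measurable_funM; last exact: measurableT_comp.
    by apply: measurable_maxr => //; exact: measurable_funD.
  have LN w : ((f b w - f a w + N%:R * (b - a))%:E <= \int[lam]_x (u (x, w))%:E)%E.
    apply: le_trans (deriv_on_increment N%:R ab (mWw w) (fW w)) _.
    rewrite integral_mkcond; apply: ge0_le_integral => //.
    - by move=> x _; rewrite erestrict_ge0// => ? _; rewrite lee_fin le_max lexx orbT.
    - apply/(measurable_restrictT _ _).1 => //.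
      by apply/measurable_EFinP; apply: measurable_funTS; apply: measurable_maxr => //; exact: measurable_funD.
    - by apply/measurable_EFinP; exact: (measurableT_comp mu (pair2_measurable w)).
    - move=> x _; rewrite /patch /u /=; case: ifPn => [|_]; last by rewrite lee_fin (u0 (x, w)).
      by rewrite inE/= in_itv/= => xab; rewrite I1// mulr1.
  have Eu s : (\int[P]_w (u (s, w))%:E <= ((K + N%:R) * I s)%:E + \int[P]_w (r N (s, w))%:E)%E.
    have [sab|sab] := pselect (a <= s <= b); last first.
      by rewrite /u /r/= Ino// !mulr0; under eq_integral do rewrite mulr0; rewrite integral0 add0e integral_ge0.
    have Lu : L1 P (fun w => u (s, w)).
      apply: (@L1_le _ _ _ P _ (fun w => `|W s w| + N%:R)).
      - exact: (measurableT_comp mu (pair1_measurable s)).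
      - move=> w; rewrite ger0_norm// /u /= I1// mulr1 ge_max addr_ge0// andbT.
        by rewrite lerD2r ler_norm.
      - by apply: L1D; [exact/L1_abs/LW|exact: L1_cst].
    have Lrs : L1 P (fun w => r N (s, w)).
      apply: (@L1_le _ _ _ P _ (fun w => `|W s w|)).
      - exact: (measurableT_comp (mr N) (pair1_measurable s)).
      - by move=> w; apply: le_trans (rg N (s, w)) _; rewrite /= I1// mulr1.
      - exact/L1_abs/LW.
    rewrite -(EFin_int Lu) -(EFin_int Lrs) -EFinD lee_fin I1// mulr1.
    have LWN : L1 P (fun w => W s w + N%:R) by apply: L1D; [exact: LW|exact: L1_cst].
    apply: (@le_trans _ _ (\int[P]_w (W s w + N%:R + r N (s, w)))).
      apply: int_le => //; first exact: L1D.
      move=> w; rewrite /u /r /= I1// !mulr1 ge_max; apply/andP; split.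
        by rewrite lerDl le_max lexx orbT.
      have : - W s w <= `|W s w| by rewrite -normrN ler_norm.
      have : `|W s w| - N%:R <= Num.max (`|W s w| - N%:R) 0 by rewrite le_max lexx.
      by lra.
    rewrite intD// intD//; [|exact: LW|exact: L1_cst].
    by rewrite int_cst lerD2r lerD2r WK.
  have total : (\int[P]_w \int[lam]_x (u (x, w))%:E <= ((K + N%:R) * (b - a))%:E + rho N)%E.
    rewrite -tonelli_swap// -lamI// /rho tonelli_time_first//.
    have mF := measurable_expectation (mr N) (r0 N).
    have mI' : measurable_fun setT (fun s : measurableTypeR R => ((K + N%:R) * I s)%:E).
      by apply/measurable_EFinP; apply: measurable_funM.
    rewrite -ge0_integralD//; last 2 first.
    - by move=> s _; rewrite lee_fin mulr_ge0.
    - by move=> s _; apply: integral_ge0 => w _; rewrite lee_fin.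
    apply: ge0_le_integral => //.
    - by move=> s _; apply: integral_ge0 => w _; rewrite lee_fin.
    - exact: measurable_expectation.
    - exact: emeasurable_funD.
  have mlu := measurable_time_integral mu u0.
  have ilu : P.-integrable setT (fun w => \int[lam]_x (u (x, w))%:E)%E.
    apply/integrableP; split=> //.
    under eq_integral do (rewrite gee0_abs; last by apply: integral_ge0 => x _; rewrite lee_fin).
    by apply: le_lt_trans total _; rewrite rhoE -EFinD ltry.
  have Lfba : L1 P (fun w => f b w - f a w + N%:R * (b - a)).
    by apply: L1D; [exact: L1B|exact: L1_cst].
  have := le_trans (le_integral measurableT Lfba ilu (fun w _ => LN w)) total.
  rewrite -EFin_int// intD//; [|exact: L1B|exact: L1_cst].
  rewrite intB// int_cst rhoE -!EFinD !lee_fin; lra.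
rewrite -lee_fin -[leRHS]adde0.
apply: (cvge_to_ge (f := fun N => ((K * (b - a))%:E + rho N)%E) (a := \oo)).
  by apply: cvgeD => //; exact: cvg_cst.
near=> N; apply: step; rewrite addrC -lerBlDr sub0r.
by near: N; exact: nbhs_infty_ger.
Unshelve. all: by end_near.
Qed.

End expected_mean_value.

(** * Joint measurability of paths and velocities *)

Section joint_measurability.
Context {R : realType}.

(** Used to discretise time: a countable choice between measurable functions. *)
Lemma measurable_fun_nat_switch d (T : measurableType d) (g : nat -> T -> R) (J : T -> nat) :
  (forall n, measurable_fun setT (g n)) ->
  (forall n, measurable [set x | J x = n]) ->
  measurable_fun setT (fun x => g (J x) x).
Proof.
move=> mg mJ _ A mA; rewrite setTI.
rewrite (_ : _ @^-1` _ = \bigcup_n ([set x | J x = n] `&` g n @^-1` A)).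
  apply: bigcupT_measurable => n; apply: measurableI; first exact: mJ.
  by rewrite -[X in measurable X]setTI; exact: mg.
apply/seteqP; split => [x gx|x [n _ [/= <-]]//]; by exists (J x).
Qed.

Lemma grid_near (s e : R) : 0 <= s -> 0 < e ->
  \forall k \near \oo, `|(Num.truncn (k.+1%:R * s))%:R / k.+1%:R - s| < e.
Proof.
move=> s0 e0; near=> k.
have k0 : 0 < k.+1%:R :> R by [].
have /andP[h1 h2] := truncn_itv (mulr_ge0 (ltW k0) s0).
set j := Num.truncn _ in h1 h2 *.
have h3 : j%:R / k.+1%:R <= s by rewrite ler_pdivrMr// mulrC.
rewrite distrC ger0_norm ?subr_ge0//.
have : k.+1%:R^-1 < e by near: k; exact: (near_infty_natSinv_lt (PosNum e0)).
apply: le_lt_trans.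
rewrite lerBlDr -(ler_pM2l k0) mulrDr mulfV ?gt_eqF// mulrCA mulfV ?gt_eqF// mulr1.
by rewrite addrC [leRHS]natr1 ltW.
Unshelve. all: by end_near.
Qed.

Context d {T : measurableType d}.
Variables z v : R -> T -> R.
Hypothesis mz : forall s, 0 <= s -> measurable_fun setT (z s).
Hypothesis dz : forall w s, 0 <= s -> deriv_on `[0, +oo[ (z^~ w) s (v s w).

(** The path is the limit of its values on the time grid of step 1 / (k + 1), by
    continuity.  Time is clamped at 0 to have a function on the whole line. *)
Lemma measurable_path_clamped :
  measurable_fun [set: measurableTypeR R * T] (fun p => z (Num.max p.1 0) p.2).
Proof.
pose J k (p : measurableTypeR R * T) := Num.truncn (k.+1%:R * Num.max p.1 0 : R).
pose g k (p : measurableTypeR R * T) : R := z ((J k p)%:R / k.+1%:R) p.2.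
apply: (@measurable_fun_cvg _ _ _ setT g) => [k|[s w] _].
  apply: (@measurable_fun_nat_switch _ _ (fun n (p : measurableTypeR R * T) => z (n%:R / k.+1%:R) p.2)).
    move=> n; have n0 : 0 <= n%:R / k.+1%:R :> R by rewrite divr_ge0.
    exact: (measurableT_comp (mz n0) measurable_snd).
  move=> n; rewrite (_ : [set p | _] =
      (fun p : measurableTypeR R * T => k.+1%:R * Num.max p.1 0) @^-1` `[n%:R, n.+1%:R[%classic).
    have mc : measurable_fun setT (fun p : measurableTypeR R * T => k.+1%:R * Num.max p.1 0 : R).
      apply: measurable_funM => //.
      by apply: measurable_maxr => //; exact: measurable_fst.
    by rewrite -[X in measurable X]setTI; apply: mc => //; exact: measurable_itv.
  apply/seteqP; split=> p /=; rewrite in_itv/=.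
    by move=> <-; apply: truncn_itv; rewrite mulr_ge0// le_max lexx orbT.
  by move=> ?; apply/eqP; rewrite /J truncn_eq// mulr_ge0// le_max lexx orbT.
have s0 : 0 <= Num.max s 0 by rewrite le_max lexx orbT.
apply/cvgrPdist_lt => e e0; have [r r0 zr] := deriv_on_continuous (dz w s0) e0.
near=> k; rewrite distrC; apply: zr; first by rewrite /= in_itv/= andbT divr_ge0.
by near: k; exact: grid_near.
Unshelve. all: by end_near.
Qed.

(** The velocity is a limit of difference quotients.  This is how joint
    measurability is obtained although the velocity field itself comes with no
    regularity in time. *)
Lemma measurable_velocity_clamped :
  measurable_fun [set: measurableTypeR R * T] (fun p => v (Num.max p.1 0) p.2).
Proof.
pose zz (p : measurableTypeR R * T) : R := z (Num.max p.1 0) p.2.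
pose sh k (p : measurableTypeR R * T) : measurableTypeR R * T := (Num.max p.1 0 + k.+1%:R^-1, p.2).
pose g k (p : measurableTypeR R * T) : R := k.+1%:R * (zz (sh k p) - zz p).
have msh k : measurable_fun setT (sh k).
  apply: measurable_fun_pair; last exact: measurable_snd.
  by apply: measurable_funD => //; apply: measurable_maxr => //; exact: measurable_fst.
apply: (@measurable_fun_cvg _ _ _ setT g) => [k|[s w] _].
  apply: measurable_funM => //; apply: measurable_funB; last exact: measurable_path_clamped.
  exact: (measurableT_comp measurable_path_clamped (msh k)).
have s0 : 0 <= Num.max s 0 by rewrite le_max lexx orbT.
rewrite /g /zz /sh/=; set s' := Num.max s 0 in s0 *.
apply/cvgrPdist_lt => e e0.
have e20 : 0 < e / 2 by rewrite divr_gt0.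
have [r r0 zr] := dz w s0 e20.
near=> k.
have k0 : 0 < k.+1%:R^-1 :> R by rewrite invr_gt0.
have kr : k.+1%:R^-1 < r by near: k; exact: (near_infty_natSinv_lt (PosNum r0)).
have sk0 : 0 <= s' + k.+1%:R^-1 by rewrite addr_ge0// ltW.
rewrite (max_l sk0).
have := zr (s' + k.+1%:R^-1); rewrite /= in_itv/= andbT => /(_ sk0).
rewrite [s' + _ - s']addrAC subrr add0r gtr0_norm// => /(_ kr) h.
have kK : k.+1%:R * k.+1%:R^-1 = 1 :> R by rewrite mulfV.
rewrite distrC.
rewrite (_ : _ - v s' w = k.+1%:R * (z (s' + k.+1%:R^-1) w - z s' w - v s' w * k.+1%:R^-1)); last first.
  by rewrite [in RHS]mulrBr [X in _ = _ - X]mulrCA kK mulr1.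
rewrite normrM gtr0_norm//; apply: (@le_lt_trans _ _ (e / 2)); last by rewrite ltr_pdivrMr// ltr_pMr// ltr1n.
by rewrite -(ler_pM2l (ltr0Sn R k)) in h; apply: le_trans h _; rewrite mulrCA kK mulr1.
Unshelve. all: by end_near.
Qed.

End joint_measurability.

(** * Differentiability of test functions *)

Section line_mean_value.
Context {R : realType} {V : normedModType R}.
Implicit Types (g : V -> R) (y e : V).

Lemma is_derive_line g y e (t : R) : (forall z, derivable g z e) ->
  is_derive t 1 (fun s : R => g (y + s *: e)) ('D_e g (y + t *: e)).
Proof.
move=> dg.
have E : (fun h : R => h^-1 *: (((fun s : R => g (y + s *: e)) \o shift t) (h *: 1) -
    g (y + t *: e))) =
    (fun h : R => h^-1 *: ((g \o shift (y + t *: e)) (h *: e) - g (y + t *: e))).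
  apply/funext => h /=; congr (_ *: (g _ - _)).
  by rewrite scalerDl [h *: 1]mulr1 addrCA.
split; first by rewrite /derivable E; exact: dg.
by rewrite /derive E.
Qed.

Lemma mean_value_line g y e (h : R) : (forall z, derivable g z e) ->
  exists2 c : R, `|c| <= `|h| & g (y + h *: e) - g y = h * 'D_e g (y + c *: e).
Proof.
move=> dg; pose f (s : R) := g (y + s *: e).
have fd x : is_derive x (1 : R) f ('D_e g (y + x *: e)) by exact: is_derive_line.
have fc (a b : R) : {within `[a, b], continuous f}.
  by apply: derivable_within_continuous => x _; have [] := fd x.
have [h0|h0] := leP 0 h.
  have [c] := MVT_segment h0 (fun x _ => fd x) (fc _ _).
  rewrite in_itv/= => /andP[c0 ch]; rewrite /f scale0r addr0 subr0 => E.
  by exists c; rewrite ?ger0_norm// E mulrC.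
have [c] := MVT_segment (ltW h0) (fun x _ => fd x) (fc _ _).
rewrite in_itv/= => /andP[hc c0]; rewrite /f scale0r addr0 sub0r => E.
exists c; first by rewrite !ler0_norm ?(ltW h0)// lerN2.
by rewrite -opprB E mulrN opprK mulrC.
Qed.

(** Continuous partial derivatives give a first-order expansion: change one
    coordinate at a time and apply the mean value theorem to each change. *)
Lemma directional_expansion (K : Type) (e : K -> V) g (s : seq K) (z : V) (eps : R) :
  (forall k, (forall z, derivable g z (e k)) /\ continuous ('D_(e k) g)) ->
  0 < eps -> exists2 d : R, 0 < d & forall h : K -> R, (forall k, `|h k| < d) ->
    `|g (z + \sum_(k <- s) h k *: e k) - g z - \sum_(k <- s) h k * 'D_(e k) g z|
      <= eps * \sum_(k <- s) `|h k|.
Proof.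
move=> C1 eps0; elim: s => [|k s [d1 d10 IH]].
  by exists 1 => // h _; rewrite !big_nil addr0 subr0 subrr normr0 mulr0.
have [dk Dk] := C1 k.
have /cvgrPdist_lt/(_ eps eps0)/nbhs_ballP[r /= r0 rD] := Dk z.
pose B : R := 1 + (`|e k| + \sum_(j <- s) `|e j|).
have B0 : 0 < B by rewrite ltr_pwDl// addr_ge0// sumr_ge0.
exists (Num.min d1 (r / B)); first by rewrite lt_min d10 divr_gt0.
move=> h hd.
have hd1 j : `|h j| < d1 by have := hd j; rewrite lt_min => /andP[].
have hr j : `|h j| < r / B by have := hd j; rewrite lt_min => /andP[].
rewrite !big_cons; set w := \sum_(j <- s) _.
have [c ch E] := mean_value_line (z + w) (h k) dk.
have near : `|'D_(e k) g z - 'D_(e k) g (z + w + c *: e k)| < eps.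
  apply: rD; rewrite -ball_normE /= opprD addrA opprD addrA subrr add0r -opprD normrN.
  apply: (@le_lt_trans _ _ (r / B * (`|e k| + \sum_(j <- s) `|e j|))).
    rewrite addrC mulrDr mulr_sumr (le_trans (ler_normD _ _))// lerD//.
      by rewrite normrZ ler_wpM2r// (le_trans ch)// ltW.
    rewrite (le_trans (ler_norm_sum _ _ _))// ler_sum// => j _.
    by rewrite normrZ ler_wpM2r// ltW.
  rewrite mulrAC ltr_pdivrMr// ltr_pM2l// /B; lra.
rewrite [z + _](_ : _ = z + w + h k *: e k); last by rewrite addrCA addrC.
rewrite (_ : _ - _ = (g (z + w + h k *: e k) - g (z + w) - h k * 'D_(e k) g z) +
   (g (z + w) - g z - \sum_(j <- s) h j * 'D_(e j) g z)); last by ring.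
rewrite mulrDr (le_trans (ler_normD _ _))// lerD//; last exact: IH.
rewrite E -mulrBr normrM mulrC ler_wpM2r// distrC ltW//.
Qed.

Lemma test_function_grad (g : V -> R) (v : V) : test_function g ->
  (forall z, derivable g z v) /\ continuous ('D_v g).
Proof. by move=> [/(_ 1%N) [_ /(_ v) [dg [cg _]]] _]. Qed.

Lemma compact_support_bounded (S : set V) (f : V -> R) : compact S ->
  continuous f -> (forall z, ~ S z -> f z = 0) ->
  exists M : R, forall z, `|f z| <= M.
Proof.
move=> cS cf f0.
have : compact (f @` S) by apply: continuous_compact => //; exact: continuous_subspaceT.
move=> /compact_bounded [M [Mr fM]]; exists (`|M| + 1) => z.
have M1 : M < `|M| + 1 by rewrite (le_lt_trans (ler_norm _))// ltrDl.
have [Sz|nSz] := pselect (S z); first by apply: (fM _ M1); exists z.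
by rewrite f0// normr0 addr_ge0.
Qed.

Lemma grad_support (g : V -> R) (v z : V) :
  ~ closure [set z | g z != 0] z -> 'D_v g z = 0.
Proof.
move=> nz.
have : \forall y \near z, g y = (cst 0) y.
  have : nbhs z (~` closure [set z | g z != 0]).
    by apply: open_nbhs_nbhs; split => //; apply: closed_openC; exact: closed_closure.
  apply: filterS => y ny /=; apply: contrapT => gy; apply: ny.
  by apply: subset_closure; exact/eqP.
by move=> /(near_eq_derive v)->; exact: derive_cst.
Qed.

Lemma support_closure (g : V -> R) (z : V) :
  ~ closure [set z | g z != 0] z -> g z = 0.
Proof.
by move=> nz; apply: contrapT => gz; apply: nz; apply: subset_closure; exact/eqP.
Qed.

End line_mean_value.

(** * Gradients on the product space and the chain rule *)

Section coordinates.
Context {R : realType} {n : nat}.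
Local Notation E := 'rV[R]_n.
Local Notation K := ('I_n + 'I_n)%type.
Implicit Types (z : E * E) (k : K).

(** Both factors are treated on the same footing: a point of the product space
    has coordinates indexed by the disjoint union of the two index sets. *)
Definition crd z k : R := match k with inl i => z.1 ord0 i | inr j => z.2 ord0 j end.

Definition bvec k : E * E := match k with
  | inl i => (delta_mx ord0 i, 0) | inr j => (0, delta_mx ord0 j) end.

Definition grd (f : E * E -> R) z k : R := 'D_(bvec k) f z.

Lemma crdB k z z' : crd (z - z') k = crd z k - crd z' k.
Proof. by case: k => i /=; rewrite !mxE. Qed.

Lemma sum_coords (F : K -> R) :
  \sum_k F k = \sum_(i < n) F (inl i) + \sum_(j < n) F (inr j).
Proof. exact: big_sumType. Qed.

Lemma dotv_grad (f : E * E -> R) z (a b : E) :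
  dotv (grad_x f z) a + dotv (grad_y f z) b = \sum_k grd f z k * crd (a, b) k.
Proof.
by rewrite sum_coords; congr (_ + _); apply: eq_bigr => i _; rewrite mxE.
Qed.

Lemma coords_expand z z' : z' = z + \sum_k (crd z' k - crd z k) *: bvec k.
Proof.
have sumv (v : E) : \sum_(i < n) v ord0 i *: delta_mx ord0 i = v.
  by apply/rowP => j; rewrite [in RHS](row_sum_delta v).
have -> : \sum_k (crd z' k - crd z k) *: bvec k = z' - z.
  rewrite (big_sumType _ _ _)/=.
  have -> : \sum_(i < n) (z'.1 ord0 i - z.1 ord0 i) *: (delta_mx ord0 i, 0) = (z'.1 - z.1, 0) :> E * E.
    rewrite -[z'.1 - z.1]sumv.
    elim/big_ind2: _ => [//|x1 x2 y1 y2 -> ->|i _].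
      by congr pair; rewrite /= addr0.
    by rewrite !mxE; congr pair; rewrite /= scaler0.
  have -> : \sum_(i < n) (z'.2 ord0 i - z.2 ord0 i) *: (0, delta_mx ord0 i) = (0, z'.2 - z.2) :> E * E.
    rewrite -[z'.2 - z.2]sumv.
    elim/big_ind2: _ => [//|x1 x2 y1 y2 -> ->|i _].
      by congr pair; rewrite /= addr0.
    by rewrite !mxE; congr pair; rewrite /= scaler0.
  by case: z z' => [x y] [x' y']; congr pair; rewrite /= ?addr0 ?add0r.
by rewrite addrC subrK.
Qed.

Lemma measurable_crd k : measurable_fun setT (crd^~ k).
Proof.
case: k => i /=.
  exact: (measurableT_comp (measurable_mx_coord ord0 i) measurable_fst).
exact: (measurableT_comp (measurable_mx_coord ord0 i) measurable_snd).
Qed.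

Lemma measurable_to_pair d (T : measurableType d) (Z : T -> E * E) :
  (forall k, measurable_fun setT (fun w => crd (Z w) k)) -> measurable_fun setT Z.
Proof.
move=> mZ; rewrite (_ : Z = fun w => ((Z w).1, (Z w).2)); last first.
  by apply/funext => w; case: (Z w).
apply: measurable_fun_pair; apply/measurable_fun_mxP => i j; rewrite (ord1 i).
  exact: (mZ (inl j)).
exact: (mZ (inr j)).
Qed.

(** The sigma-algebra on the product is the product of the Borel sigma-algebras;
    a continuous function is measurable for it because it factors through row
    vectors of length n + n, where open sets are measurable by definition. *)
Lemma continuous_measurable_pair (f : E * E -> R) : continuous f -> measurable_fun setT f.
Proof.
move=> cf.
pose split (v : 'rV[R]_(n + n)) : E * E := (lsubmx v, rsubmx v).
have -> : f = (f \o split) \o (fun z => row_mx z.1 z.2).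
  by apply/funext => -[x y]; rewrite /= /split row_mxKl row_mxKr.
have csplit : continuous split.
  move=> v U /nbhs_ballP[e e0 eU]; apply/nbhs_ballP; exists e => // w [_ vw].
  by apply: eU; split; split=> // i j; rewrite !mxE; exact: vw.
have cfs : continuous (f \o split) by move=> v; apply: continuous_comp; [exact: csplit|exact: cf].
apply: measurableT_comp.
  apply: (measurability _ (RGenOpens.measurableE R)) => _ [_ [a [b ->]] <-].
  rewrite setTI; apply: sub_sigma_algebra => /=.
  by apply: open_comp; [move=> v _; exact: cfs|exact: interval_open].
apply/measurable_fun_mxP => i j.
under eq_fun do rewrite mxE; case: split_ordP => l _.
  exact: (measurableT_comp (measurable_mx_coord i l) measurable_fst).
exact: (measurableT_comp (measurable_mx_coord i l) measurable_snd).
Qed.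

(** Frechet differentiability at every point, in coordinates.  The gradient phi
    is a datum, so that it can be required to be measurable and bounded. *)
Definition has_gradient (f : E * E -> R) (phi : E * E -> K -> R) : Prop :=
  forall z (e : R), 0 < e -> exists2 d : R, 0 < d & forall z',
    (forall k, `|crd z' k - crd z k| < d) ->
    `|f z' - f z - \sum_k phi z k * (crd z' k - crd z k)|
      <= e * \sum_k `|crd z' k - crd z k|.

Lemma test_function_has_gradient (g : E * E -> R) : test_function g ->
  has_gradient g (grd g).
Proof.
move=> tg z e e0.
have [d d0 gd] := directional_expansion (e := bvec) (index_enum K) z
  (fun k => test_function_grad (bvec k) tg) e0.
exists d => // z' zz'; have := gd (fun k => crd z' k - crd z k) zz'.
rewrite -coords_expand (eq_bigr (fun k => grd g z k * (crd z' k - crd z k)))//.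
by move=> k _; rewrite mulrC.
Qed.

Lemma common_radius (Q : K -> R -> Prop) :
  (forall k, exists2 d : R, 0 < d & Q k d) ->
  exists2 d : R, 0 < d & forall k, exists2 d', d <= d' & Q k d'.
Proof.
move=> H; pose r k := sval (cid2 (H k)).
have r0 k : 0 < r k by rewrite /r; case: cid2.
exists (\big[Num.min/1]_k r k); first by apply: lt_bigmin => // k _.
move=> k; exists (r k); first exact: bigmin_le.
by rewrite /r; case: cid2.
Qed.

Lemma gradient_chain (f : E * E -> R) (phi : E * E -> K -> R) (D : set R)
    (Z : R -> E * E) (s : R) (v : K -> R) : has_gradient f phi ->
  (forall k, deriv_on D (fun t => crd (Z t) k) s (v k)) ->
  deriv_on D (f \o Z) s (\sum_k phi (Z s) k * v k).
Proof.
move=> fphi dZ e e0.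
pose A : R := 1 + \sum_k `|phi (Z s) k|.
pose B : R := 1 + \sum_k (`|v k| + 1).
have A0 : 0 < A by rewrite ltr_pwDl// sumr_ge0.
have B0 : 0 < B by rewrite ltr_pwDl// sumr_ge0// => k _; rewrite addr_ge0.
pose e1 := e / 2 / B; pose e2 := Num.min 1 (e / 2 / A).
have e10 : 0 < e1 by rewrite !divr_gt0.
have e20 : 0 < e2 by rewrite lt_min ltr01 !divr_gt0.
have e21 : e2 <= 1 by rewrite ge_min lexx.
have e2A : e2 <= e / 2 / A by rewrite ge_min lexx orbT.
have [d1 d10 fd] := fphi (Z s) e1 e10.
have [d2 d20 Zd] := common_radius (fun k => dZ k e2 e20).
exists (Num.min d2 (d1 / B)); first by rewrite lt_min d20 divr_gt0.
move=> t Dt; rewrite lt_min => /andP[td2 td1].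
set h := t - s in td2 td1 *.
pose D_ k := crd (Z t) k - crd (Z s) k.
have Dv k : `|D_ k - v k * h| <= e2 * `|h|.
  by have [d' dd' /(_ t Dt)] := Zd k; apply; exact: lt_le_trans dd'.
have Dn k : `|D_ k| <= (`|v k| + 1) * `|h|.
  rewrite -(subrK (v k * h) (D_ k)) (le_trans (ler_normD _ _))// addrC mulrDl.
  by rewrite normrM lerD2l (le_trans (Dv k))// ler_wpM2r.
have sD : \sum_k `|D_ k| <= B * `|h|.
  rewrite /B mulrDl mul1r mulr_suml (le_trans (ler_sum _ (fun k _ => Dn k)))//.
  by rewrite lerDr.
have f1 : `|f (Z t) - f (Z s) - \sum_k phi (Z s) k * D_ k| <= e1 * \sum_k `|D_ k|.
  apply: fd => k; rewrite -/(D_ k) (le_lt_trans (Dn k))//.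
  apply: (@le_lt_trans _ _ (B * `|h|)); last by rewrite mulrC -ltr_pdivlMr.
  rewrite ler_wpM2r// /B (bigD1 k)//= addrCA lerDl addr_ge0// sumr_ge0//.
have f2 : `|\sum_k phi (Z s) k * D_ k - (\sum_k phi (Z s) k * v k) * h| <= A * e2 * `|h|.
  rewrite mulr_suml -sumrB (le_trans (ler_norm_sum _ _ _))//.
  rewrite -mulrA /A mulrDl mul1r ler_wpDl ?mulr_ge0 ?(ltW e20)// mulr_suml ler_sum// => k _.
  by rewrite -mulrA -mulrBr normrM ler_wpM2l.
rewrite -(subrK (\sum_k phi (Z s) k * D_ k) (f _ - f _)) -addrA.
rewrite (le_trans (ler_normD _ _))// (splitr e) mulrDl lerD//.
  apply: (le_trans f1); apply: (@le_trans _ _ (e1 * (B * `|h|))).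
    by rewrite ler_wpM2l// ltW.
  by rewrite mulrA /e1 divfK// gt_eqF.
apply: (le_trans f2); rewrite ler_wpM2r//.
by rewrite mulrC -ler_pdivlMr.
Qed.

End coordinates.

(** * Smooth approximations of orthants *)

Section soft_orthant.
Context {R : realType} {n : nat}.
Local Notation E := 'rV[R]_n.
Local Notation K := ('I_n + 'I_n)%type.
Variables (th : pred K) (a : K -> R).
Implicit Types (z : E * E) (m : nat).

Definition excess z k : R := Num.max (crd z k - a k) 0.
Definition penalty z : R := \sum_(k | th k) excess z k ^+ 2.
(** As m grows, these functions decrease to the indicator of the points whose
    coordinates k with th k are at most a k.  Squaring the excess makes them
    continuously differentiable. *)
Definition soft_orthant m z : R := (1 + m%:R * penalty z)^-1.
Definition soft_orthant_grad m z k : R :=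
  if th k then - (2 * m%:R * excess z k) * soft_orthant m z ^+ 2 else 0.

Lemma excess_ge0 z k : 0 <= excess z k.
Proof. by rewrite /excess le_max lexx orbT. Qed.

Lemma penalty_ge0 z : 0 <= penalty z.
Proof. by apply: sumr_ge0 => k _; exact: sqr_ge0. Qed.

Lemma soft_denom m z : 1 <= 1 + m%:R * penalty z.
Proof. by rewrite lerDl mulr_ge0// penalty_ge0. Qed.

Lemma soft_denom_gt0 m z : 0 < 1 + m%:R * penalty z.
Proof. exact: lt_le_trans (soft_denom m z). Qed.

Lemma soft_orthant_ge0 m z : 0 <= soft_orthant m z.
Proof. by rewrite invr_ge0 ltW// soft_denom_gt0. Qed.

Lemma soft_orthant_le1 m z : soft_orthant m z <= 1.
Proof. by rewrite invf_le1 ?soft_denom_gt0// soft_denom. Qed.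

Lemma soft_orthant_norm m z : `|soft_orthant m z| <= 1.
Proof. by rewrite ger0_norm ?soft_orthant_ge0// soft_orthant_le1. Qed.

(** With x the excess, 2 x <= 1 + x ^+ 2 <= 1 + m * penalty as soon as m >= 1. *)
Lemma soft_orthant_grad_norm m z k : `|soft_orthant_grad m z k| <= m%:R.
Proof.
rewrite /soft_orthant_grad; case: ifPn => [thk|_]; last by rewrite normr0.
set s := soft_orthant m z; set x := excess z k.
have x0 : 0 <= x := excess_ge0 z k.
have s0 : 0 <= s := soft_orthant_ge0 m z.
have s1 : s <= 1 := soft_orthant_le1 m z.
rewrite normrM normrN !ger0_norm ?mulr_ge0 ?exprn_ge0//.
have [->|m0] := posnP m; first by rewrite mulr0 !mul0r.
have m1 : 1 <= m%:R :> R by rewrite ler1n.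
have xp : x ^+ 2 <= penalty z.
  rewrite /penalty (bigD1 k)//= lerDl; apply: sumr_ge0 => j _; exact: sqr_ge0.
have sx : s * (2 * x) <= 1.
  rewrite mulrC ler_pdivrMr ?soft_denom_gt0// mul1r.
  have : penalty z <= m%:R * penalty z by rewrite ler_peMl// penalty_ge0.
  have := sqr_ge0 (x - 1); rewrite sqrrB1 -mulr_natl; lra.
rewrite [leLHS](_ : _ = m%:R * (s * (s * (2 * x)))); last by ring.
by rewrite ler_piMr// mulr_ile1// !mulr_ge0.
Qed.

Lemma measurable_excess k : measurable_fun setT (excess^~ k).
Proof.
apply: measurable_maxr => //; apply: measurable_funB => //.
exact: measurable_crd.
Qed.

Lemma measurable_penalty : measurable_fun setT penalty.
Proof.
rewrite /penalty; under eq_fun do rewrite big_mkcond/=.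
apply: measurable_sum => k; case: (th k) => //.
by apply: measurable_funX; exact: measurable_excess.
Qed.

Lemma measurable_soft_orthant m : measurable_fun setT (soft_orthant m).
Proof.
have mi : measurable_fun (`]0, +oo[%classic : set R) (@GRing.inv R).
  apply: open_continuous_measurable_fun; first exact: interval_open.
  by move=> x; rewrite inE/= in_itv/= andbT => x0; apply: inv_continuous; rewrite gt_eqF.
rewrite (_ : soft_orthant m = GRing.inv \o (fun z => 1 + m%:R * penalty z))//.
apply: (measurable_comp _ _ mi) => //.
- by move=> _ [z _ <-] /=; rewrite in_itv/= andbT soft_denom_gt0.
- apply: measurable_funD => //; apply: measurable_funM => //.
  exact: measurable_penalty.
Qed.

Lemma measurable_soft_orthant_grad m k : measurable_fun setT (fun z => soft_orthant_grad m z k).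
Proof.
rewrite /soft_orthant_grad; case: (th k) => //.
apply: measurable_funM; last by apply: measurable_funX; exact: measurable_soft_orthant.
apply: measurableT_comp => //; apply: measurable_funM => //; exact: measurable_excess.
Qed.

Lemma sqr_pos_part_expand (s t : R) :
  `|Num.max t 0 ^+ 2 - Num.max s 0 ^+ 2 - 2 * Num.max s 0 * (t - s)| <= (t - s) ^+ 2.
Proof.
have h1 := sqr_ge0 (t - s); have h2 := sqr_ge0 t; have h3 := sqr_ge0 s.
rewrite !expr2 in h1 h2 h3 *; rewrite ler_norml; apply/andP.
case: (leP t 0) => ht; case: (leP s 0) => hs; rewrite ?mulr0 ?mul0r.
- by split; lra.
- have : s * t <= 0 by rewrite pmulr_rle0. by split; nra.
- have : s * t <= 0 by rewrite mulr_le0_ge0// ltW. by split; nra.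
- by split; nra.
Qed.

(** The penalty has a quadratic remainder by [sqr_pos_part_expand], and so does
    1 / (1 + m u) as a function of u >= 0; the remainder of the composite is
    quadratic in the l1 distance S of the two points. *)
Lemma soft_orthant_has_gradient m : has_gradient (soft_orthant m) (soft_orthant_grad m).
Proof.
move=> z e e0.
pose L : R := 1 + \sum_k 2 * excess z k.
have L1' : 1 <= L by rewrite lerDl sumr_ge0// => k _; rewrite mulr_ge0// excess_ge0.
have L0 : 0 <= L by apply: le_trans L1'.
(* For S <= 1, L is a Lipschitz constant of the penalty and Q S ^+ 2 bounds the
   remainder. *)
pose Q : R := m%:R ^+ 2 * L ^+ 2 + m%:R + 1.
have Q0 : 0 < Q by rewrite ltr_wpDl// addr_ge0// mulr_ge0// exprn_ge0.
pose r : R := Num.min 1 (e / Q).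
have r0 : 0 < r by rewrite lt_min ltr01 divr_gt0.
exists (r / (#|{: K}|%:R + 1)); first by rewrite divr_gt0// ltr_wpDl.
move=> z' zz'; pose D k := crd z' k - crd z k.
rewrite -/(D _); set S := \sum_k `|D k|.
have S0 : 0 <= S by exact: sumr_ge0.
have Sr : S <= r.
  rewrite /S (@le_trans _ _ (\sum_(k : K) r / (#|{: K}|%:R + 1)))//.
    by apply: ler_sum => k _; exact/ltW/zz'.
  rewrite sumr_const -[leLHS]mulr_natl mulrA ler_pdivrMr ?ltr_wpDl//.
  by rewrite [leRHS]mulrDr mulr1 mulrC lerDl ltW.
have S1 : S <= 1 by apply: le_trans Sr _; rewrite ge_min lexx.
have SQ : S * Q <= e.
  by rewrite -ler_pdivlMr// (le_trans Sr)// ge_min lexx orbT.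
have DS k : `|D k| <= S by rewrite /S (bigD1 k)//= lerDl sumr_ge0.
set u := penalty z; set u' := penalty z'.
have u0 : 0 <= u := penalty_ge0 z.
have u'0 : 0 <= u' := penalty_ge0 z'.
pose G : R := \sum_(k | th k) 2 * excess z k * D k.
have uG : `|u' - u - G| <= S ^+ 2.
  rewrite /u' /u /penalty /G -sumrB -sumrB (le_trans (ler_norm_sum _ _ _))//.
  apply: (@le_trans _ _ (\sum_k `|D k| * S)); last by rewrite -mulr_suml expr2.
  rewrite [leRHS](bigID th)/= ler_wpDr//; first by apply: sumr_ge0 => k _; rewrite mulr_ge0.
  apply: ler_sum => k _.
  have := sqr_pos_part_expand (crd z k - a k) (crd z' k - a k).
  rewrite -/(excess z k) -/(excess z' k).
  rewrite (_ : crd z' k - a k - (crd z k - a k) = D k); last by rewrite /D; ring.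
  move=> /le_trans; apply; by rewrite -real_normK ?num_real// expr2 ler_wpM2l.
have uL : `|u' - u| <= L * S.
  rewrite -(subrK G (u' - u)) (le_trans (ler_normD _ _))//.
  rewrite /L mulrDl mul1r lerD//.
    by apply: (le_trans uG); rewrite expr2 ler_piMr.
  rewrite (le_trans (ler_norm_sum _ _ _))// mulr_suml.
  rewrite [leRHS](bigID th)/= ler_wpDr//.
    by apply: sumr_ge0 => k _; rewrite !mulr_ge0// excess_ge0.
  apply: ler_sum => k _; rewrite normrM ler_pM//.
  by rewrite ger0_norm// mulr_ge0// excess_ge0.
set F := soft_orthant m z; set F' := soft_orthant m z'.
have F0 : 0 <= F := soft_orthant_ge0 m z.
have F1 : F <= 1 := soft_orthant_le1 m z.
have F'0 : 0 <= F' := soft_orthant_ge0 m z'.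
have F'1 : F' <= 1 := soft_orthant_le1 m z'.
have -> : \sum_k soft_orthant_grad m z k * D k = - m%:R * F ^+ 2 * G.
  rewrite /G mulr_sumr [RHS]big_mkcond/=; apply: eq_bigr => k _.
  by rewrite /soft_orthant_grad -/F; case: ifP => _; [ring|rewrite mul0r].
have FF : F' - F + m%:R * F ^+ 2 * (u' - u) = m%:R ^+ 2 * (u' - u) ^+ 2 * F ^+ 2 * F'.
  have A0 := soft_denom_gt0 m z; have A'0 := soft_denom_gt0 m z'.
  rewrite /F /F' /soft_orthant -/u -/u'; field.
  by rewrite !gt_eqF.
have -> : F' - F - - m%:R * F ^+ 2 * G =
    m%:R ^+ 2 * (u' - u) ^+ 2 * F ^+ 2 * F' - m%:R * F ^+ 2 * (u' - u - G).
  by rewrite -FF; ring.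
have F21 : F ^+ 2 <= 1 by rewrite exprn_ile1.
have F20 : 0 <= F ^+ 2 by rewrite exprn_ge0.
apply: (@le_trans _ _ (Q * S * S)); last by rewrite ler_wpM2r// mulrC.
rewrite (le_trans (ler_normB _ _))//.
apply: (@le_trans _ _ (m%:R ^+ 2 * (L * S) ^+ 2 + m%:R * S ^+ 2)); last first.
  rewrite /Q; have : 0 <= S ^+ 2 by rewrite exprn_ge0. nra.
apply: lerD.
  have p0 : 0 <= m%:R ^+ 2 * (u' - u) ^+ 2 by apply: mulr_ge0; exact: sqr_ge0.
  have FF0 : 0 <= F ^+ 2 * F' by exact: mulr_ge0.
  rewrite -mulrA ger0_norm; last exact: mulr_ge0.
  rewrite (@le_trans _ _ (m%:R ^+ 2 * (u' - u) ^+ 2))//.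
    by rewrite ler_piMr// mulr_ile1.
  rewrite ler_wpM2l ?sqr_ge0// -[(u' - u) ^+ 2]real_normK ?num_real//.
  by rewrite lerXn2r// nnegrE// mulr_ge0.
rewrite normrM normrM (ger0_norm F20) ger0_norm//.
apply: ler_pM => //; first by rewrite mulr_ge0.
by rewrite ler_piMr.
Qed.

End soft_orthant.

(** * Laws are determined by orthants *)

Section orthants.
Context {R : realType} {n : nat}.
Local Notation E := 'rV[R]_n.
Local Notation K := ('I_n + 'I_n)%type.

Definition orthant (th : pred K) (a : K -> R) : set (E * E) :=
  [set z | forall k, th k -> crd z k <= a k].

Lemma soft_orthant_cvg th a (z : E * E) :
  soft_orthant th a m z @[m --> \oo] --> (\1_(orthant th a) z : R).
Proof.
have [za|za] := pselect (orthant th a z).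
  rewrite indicE mem_set//; apply: cvg_near_cst; apply: nearW => m.
  rewrite /soft_orthant /penalty big1 ?mulr0 ?addr0 ?invr1// => k thk.
  by rewrite /excess max_r ?expr0n// subr_le0 za.
rewrite indicE memNset//.
have p0 : 0 < penalty th a z.
  have /existsNP[k /not_implyP[thk /negP]] := za; rewrite -ltNge => ak.
  rewrite /penalty (bigD1 k)//= ltr_pwDl ?sumr_ge0// => [|j _]; last exact: sqr_ge0.
  by rewrite exprn_gt0// /excess lt_max subr_gt0 ak.
apply/cvgrPdist_lt => e e0; near=> m.
rewrite sub0r normrN ger0_norm ?soft_orthant_ge0// /soft_orthant.
rewrite invf_plt ?posrE ?soft_denom_gt0//.
have : (e * penalty th a z)^-1 < m%:R by near: m; exact: nbhs_infty_gtr.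
rewrite invfM ltr_pdivrMr// => h.
by rewrite ltr_wpDl.
Unshelve. all: by end_near.
Qed.

Lemma measurable_orthant th a : measurable (orthant th a).
Proof.
have -> : orthant th a = [set z | (penalty th a z <= 0)].
  apply/seteqP; split => z /= h.
    rewrite /penalty big1// => k thk.
    by rewrite /excess max_r ?expr0n// subr_le0 h.
  move=> k thk; rewrite leNgt; apply/negP => ak.
  have : penalty th a z = 0 by apply/le_anti; rewrite h penalty_ge0.
  move/eqP; rewrite psumr_eq0 => [|j _]; last exact: sqr_ge0.
  move=> /allP/(_ k (mem_index_enum _)); rewrite thk/= sqrf_eq0 => /eqP.
  by move/eqP; apply/negP; rewrite gt_eqF// /excess lt_max subr_gt0 ak.
rewrite -[X in measurable X]setTI.
have := measurable_penalty th a measurableT (measurable_itv `]-oo, (0 : R)]).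
by congr measurable; congr (_ `&` _); apply/seteqP; split => z /=; rewrite in_itv.
Qed.

(** Lower orthants form a pi-system that generates the Borel sets. *)
Lemma law_determined (p q : probability E R) :
  (forall a : 'I_n -> R, p [set x | forall i, x ord0 i <= a i] =
                         q [set x | forall i, x ord0 i <= a i]) ->
  forall A, measurable A -> p A = q A.
Proof.
move=> pq.
pose orth (a : 'I_n -> R) : set E := [set x | forall i, x ord0 i <= a i].
pose G : set (set E) := [set orth a | a in [set: 'I_n -> R]].
have Gm : G `<=` measurable.
  move=> _ [a _ <-]; rewrite (_ : orth a = \bigcap_(i : 'I_n) (fun x : E => x ord0 i) @^-1` `]-oo, a i]).
    rewrite -[X in measurable X]setCK setC_bigcap; apply: measurableC.
    apply: countable_bigcupT_measurable => [|i]; first exact: countableP.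
    apply: measurableC; rewrite -[X in measurable X]setTI.
    by apply: measurable_mx_coord => //; exact: measurable_itv.
  apply/seteqP; split=> x /= h i; last by have := h i Logic.I; rewrite /= in_itv.
  by move=> _ /=; rewrite in_itv/=; exact: h.
have mG : @measurable _ E = <<s G >>.
  apply/seteqP; split; last exact: (smallest_sub (@sigma_algebra_measurable _ _) Gm).
  have mcoord (i : 'I_n) : @measurable_fun _ _ (g_sigma_algebraType G) _ setT (fun x => x ord0 i).
    apply: (measurability _ (RGenOInfty.measurableE R)) => _ [_ [r ->] <-].
    rewrite setTI.
    have -> : (fun x : E => x ord0 i) @^-1` `]r, +oo[ =
        ~` \bigcup_k orth (fun j => if j == i then r else k%:R).
      apply/seteqP; split => x /=; rewrite in_itv/= andbT.
        by move=> rx [k _ /(_ i)]; rewrite eqxx leNgt rx.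
      move=> nx; rewrite ltNge; apply/negP => xr; apply: nx.
      exists (Num.truncn (\sum_i `|x ord0 i|)).+1 => // j /=; case: eqP => [->//|_].
      apply: (@le_trans _ _ (\sum_i `|x ord0 i|)); last exact/ltW/truncnS_gt.
      by rewrite (bigD1 j)//= (le_trans (ler_norm _))// lerDl sumr_ge0.
    apply: (@measurableC _ (g_sigma_algebraType G)).
    apply: (@bigcupT_measurable _ (g_sigma_algebraType G)) => k.
    by apply: sub_sigma_algebra; exists (fun j => if j == i then r else k%:R).
  have mid : @measurable_fun _ _ (g_sigma_algebraType G) E setT id.
    by apply/measurable_fun_mxP => i j; rewrite (ord1 i); exact: mcoord.
  by move=> A mA; have := mid measurableT A mA; rewrite setTI.
apply: (measure_unique G (fun k => orth (fun=> k%:R)) mG) => //.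
- move=> _ _ [a _ <-] [b _ <-]; exists (fun i => Num.min (a i) (b i)) => //.
  apply/seteqP; split => x /=.
    by move=> h; split => i; have := h i; rewrite le_min => /andP[].
  by move=> [h1 h2] i; rewrite le_min h1 h2.
- by move=> k; exists (fun=> k%:R).
- apply/seteqP; split => // x _.
  exists (Num.truncn (\sum_i `|x ord0 i|)).+1 => // i /=.
  apply: (@le_trans _ _ (\sum_i `|x ord0 i|)); last exact/ltW/truncnS_gt.
  by rewrite (bigD1 i)//= (le_trans (ler_norm _))// lerDl sumr_ge0.
- by move=> _ [a _ <-]; exact: pq.
- by move=> k; apply: le_lt_trans (probability_le1 _ _) _; [by apply: Gm; exists (fun=> k%:R)|rewrite ltry].
Qed.

End orthants.

(** * Processes whose mean speed is controlled by their first moment *)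

Lemma has_gradientN {R : realType} {n : nat} (f : 'rV[R]_n * 'rV[R]_n -> R) phi :
  has_gradient f phi -> has_gradient (fun z => - f z) (fun z k => - phi z k).
Proof.
move=> fphi z e e0; have [r r0 fr] := fphi z e e0; exists r => // z' zz'.
apply: le_trans (fr z' zz'); rewrite -normrN.
under eq_bigr do rewrite mulNr.
by rewrite sumrN le_eqVlt; apply/orP; left; apply/eqP; congr (`|_|); ring.
Qed.

Lemma cvg_sum_seq {R : realType} (I : Type) (s : seq I) (u : nat -> I -> R) (l : I -> R) :
  (forall i, u j i @[j --> \oo] --> l i) ->
  \sum_(i <- s) u j i @[j --> \oo] --> \sum_(i <- s) l i.
Proof.
move=> ul; elim: s => [|i s IH].
  by rewrite big_nil; under eq_fun do rewrite big_nil; exact: cvg_cst.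
by rewrite big_cons; under eq_fun do rewrite big_cons; exact: cvgD.
Qed.

Lemma cvg_minr {R : realType} (u : nat -> R) (l N : R) :
  u @ \oo --> l -> Num.min (u j) N @[j --> \oo] --> Num.min l N.
Proof.
move=> /cvgrPdist_lt ul; apply/cvgrPdist_lt => e /ul; apply: filterS => j.
apply: le_lt_trans; rewrite ler_norml.
have := ler_norm (l - u j); have := ler_norm (u j - l); rewrite (distrC (u j)) => h1 h2.
by apply/andP; case: (leP l N) => ?; case: (leP (u j) N) => ?; split; lra.
Qed.

Lemma clamp_lipschitz {R : realType} (x y : R) :
  `|Num.max x 0 - Num.max y 0| <= `|x - y|.
Proof.
rewrite ler_norml; have := ler_norm (x - y); have := ler_norm (y - x).
rewrite (distrC y) => h1 h2; apply/andP.
by case: (leP x 0) => ?; case: (leP y 0) => ?; split; lra.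
Qed.

Section process.
Context {R : realType} {n : nat} d {T : measurableType d}.
Local Notation E := 'rV[R]_n.
Local Notation K := ('I_n + 'I_n)%type.
Variables (P : probability T R) (Z : R -> T -> E * E) (V : R -> T -> K -> R).
Hypothesis mZ : forall s : R, 0 <= s -> measurable_fun setT (Z s).
Hypothesis dZ : forall w (s : R) k, 0 <= s ->
  deriv_on `[0, +oo[ (fun t => crd (Z t w) k) s (V s w k).
Hypothesis LZ : forall (s : R) k, 0 <= s -> L1 P (fun w => crd (Z s w) k).
Hypothesis LV : forall (s : R) k, 0 <= s -> L1 P (fun w => V s w k).
Variable C : R.
Hypothesis C0 : 0 <= C.

(** The first moment, extended to negative times by its value at time 0. *)
Definition moment s : R := \sum_k \int[P]_w `|crd (Z (Num.max s 0) w) k|.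

Hypothesis VC : forall (s : R) k, 0 <= s -> \int[P]_w `|V s w k| <= C * (1 + moment s).

Let max0 (s : R) : 0 <= Num.max s 0.
Proof. by rewrite le_max lexx orbT. Qed.

Let mcrd s k : 0 <= s -> measurable_fun setT (fun w => crd (Z s w) k).
Proof. by move=> s0; exact/L1_measurable/LZ. Qed.

Lemma measurable_Z_clamped :
  measurable_fun [set: measurableTypeR R * T] (fun p => Z (Num.max p.1 0) p.2).
Proof.
apply: measurable_to_pair => k.
exact: (measurable_path_clamped (z := fun s w => crd (Z s w) k)
  (v := fun s w => V s w k) (fun s => @mcrd s k) (fun w s => @dZ w s k)).
Qed.

Lemma measurable_V_clamped k :
  measurable_fun [set: measurableTypeR R * T] (fun p => V (Num.max p.1 0) p.2 k).
Proof.
exact: (measurable_velocity_clamped (z := fun s w => crd (Z s w) k)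
  (v := fun s w => V s w k) (fun s => @mcrd s k) (fun w s => @dZ w s k)).
Qed.

Lemma moment_ge0 s : 0 <= moment s.
Proof. by apply: sumr_ge0 => k _; exact: int_ge0. Qed.

(** The mean value inequality applies to signed differences; the absolute value
    is recovered by multiplying the path with the sign of the displacement
    between the two end points, which does not depend on time. *)
Lemma displacement_le k (a b M : R) : 0 <= a -> a <= b ->
  (forall s, a <= s <= b -> moment s <= M) ->
  \int[P]_w `|crd (Z b w) k - crd (Z a w) k| <= C * (1 + M) * (b - a).
Proof.
move=> a0 ab GM; have b0 := le_trans a0 ab.
pose sigma w : R := if 0 <= crd (Z b w) k - crd (Z a w) k then 1 else -1.
have s1 w : `|sigma w| <= 1.
  by rewrite /sigma; case: ifP; rewrite ?normrN normr1.
have msg : measurable_fun setT sigma.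
  apply: measurable_fun_ifT => //; apply: measurable_fun_ler => //.
  by apply: measurable_funB; exact: mcrd.
have clamp s : a <= s <= b -> Num.max s 0 = s.
  by move=> /andP[as_ _]; rewrite max_l// (le_trans a0).
have -> : \int[P]_w `|crd (Z b w) k - crd (Z a w) k| =
    \int[P]_w (sigma w * crd (Z b w) k) - \int[P]_w (sigma w * crd (Z a w) k).
  rewrite -intB; [|exact: (L1M (M := 1) msg s1 (LZ k b0))|exact: (L1M (M := 1) msg s1 (LZ k a0))].
  by apply: eq_Rintegral => w _; rewrite -mulrBr /sigma; case: leP => h; rewrite ?mul1r ?mulN1r; [rewrite ger0_norm|rewrite ltr0_norm].
apply: (@expected_mean_value _ _ _ P (fun s w => sigma w * crd (Z s w) k)
  (fun s w => sigma w * V (Num.max s 0) w k) a b (C * (1 + M)) (C * (1 + M))) => //.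
- apply: measurable_funM; first exact: (measurableT_comp msg measurable_snd).
  exact: measurable_V_clamped.
- move=> w s sab; rewrite clamp//; apply: deriv_onZ.
  have s0 : 0 <= s by move/andP: sab => [/(le_trans a0)].
  apply: deriv_on_subset (dZ w k s0) => y /=; rewrite !in_itv/= andbT.
  by move=> /andP[/(le_trans a0)].
- exact: (L1M (M := 1) msg s1 (LZ k a0)).
- exact: (L1M (M := 1) msg s1 (LZ k b0)).
- move=> s sab; have s0 : 0 <= s by move/andP: sab => [/(le_trans a0)].
  rewrite clamp// -EFin_int; last exact/L1_abs/(L1M (M := 1) msg s1 (LV k s0)).
  rewrite lee_fin; apply: (@le_trans _ _ (\int[P]_w `|V s w k|)).
    apply: int_le; [exact/L1_abs/(L1M (M := 1) msg s1 (LV k s0))|exact/L1_abs/LV|].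
    by move=> w; rewrite normrM ler_piMl.
  by apply: (le_trans (VC k s0)); rewrite ler_wpM2l// lerD2l GM.
- move=> s sab; have s0 : 0 <= s by move/andP: sab => [/(le_trans a0)].
  rewrite clamp//; apply: (@le_trans _ _ (\int[P]_w `|V s w k|)).
    apply: int_le; [exact: (L1M (M := 1) msg s1 (LV k s0))|exact/L1_abs/LV|].
    by move=> w; rewrite (le_trans (ler_norm _))// normrM ler_piMl.
  by apply: (le_trans (VC k s0)); rewrite ler_wpM2l// lerD2l GM.
Qed.

Lemma moment_bootstraps : bootstraps moment (#|{: K}|%:R * C).
Proof.
move=> a b M ab GM s t sab tab.
have clamp2 x : Num.max (Num.max x 0) 0 = Num.max x 0 :> R by rewrite max_l.
have main x y : a <= x <= b -> a <= y <= b -> x <= y ->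
    forall k, \int[P]_w `|crd (Z (Num.max y 0) w) k - crd (Z (Num.max x 0) w) k|
      <= C * (1 + M) * (b - a).
  move=> xab yab xy k.
  have M0 : 0 <= 1 + M by have := le_trans (moment_ge0 x) (GM x xab); lra.
  apply: (@le_trans _ _ (C * (1 + M) * (Num.max y 0 - Num.max x 0))).
    apply: displacement_le => //.
      by rewrite ge_max !le_max xy lexx !orbT.
    move=> u /andP[xu uy]; have u0 : 0 <= u := le_trans (max0 x) xu.
    have [yu|uy'] := leP y u.
      have -> : moment u = moment y; last by exact: GM.
      suff uE : Num.max u 0 = Num.max y 0 by rewrite /moment uE.
      by rewrite (max_l u0); apply/le_anti; rewrite uy ge_max yu u0.
    move: xu; rewrite ge_max => /andP[xu _].
    by apply: GM; move: xab yab => /andP[ax _] /andP[_ yb]; apply/andP; lra.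
  rewrite ler_wpM2l ?mulr_ge0//.
  move: xab yab => /andP[ax xb] /andP[ay yb].
  by rewrite /Num.max; case: ifPn; case: ifPn; rewrite -?leNgt; lra.
have main2 k : \int[P]_w `|crd (Z (Num.max t 0) w) k| -
    \int[P]_w `|crd (Z (Num.max s 0) w) k| <= C * (1 + M) * (b - a).
  have Lx x : L1 P (fun w => `|crd (Z (Num.max x 0) w) k|) by exact/L1_abs/LZ.
  rewrite -intB//.
  have [st|ts] := leP s t.
    apply: le_trans (main s t sab tab st k); apply: int_le.
    - exact: L1B.
    - by apply/L1_abs/L1B; exact: LZ.
    - by move=> w; exact: lerB_dist.
  apply: le_trans (main t s tab sab (ltW ts) k); apply: int_le.
  - exact: L1B.
  - by apply/L1_abs/L1B; exact: LZ.
  - by move=> w; rewrite distrC; exact: lerB_dist.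
rewrite -lerBlDl /moment -sumrB (le_trans (ler_sum _ (fun k _ => main2 k)))//.
by rewrite sumr_const -[leLHS]mulr_natl !mulrA.
Qed.

(** A moment is the supremum of truncated moments, and these are continuous in
    time by dominated convergence. *)
Lemma moment_lower_semicont : lower_semicont moment.
Proof.
pose h (s : R) w : R := \sum_k `|crd (Z (Num.max s 0) w) k|.
have Lh s : L1 P (h s) by apply: L1_sum => k; exact/L1_abs/LZ.
have mh s : measurable_fun setT (h s) by exact: L1_measurable.
have h0 s w : 0 <= h s w by apply: sumr_ge0.
have momE s : moment s = \int[P]_w h s w.
  by rewrite /h int_sum// => k; exact/L1_abs/LZ.
move=> M t Mt.
have mmin N s : measurable_fun setT (fun w => Num.min (h s w) N%:R).
  by apply: measurable_minr.
have cvgN : (fun N => \int[P]_w Num.min (h t w) N%:R) @ \oo --> moment t.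
  rewrite momE; apply: (int_cvg _ _ _ (Lh t)) => // [w|N w].
    apply: cvg_near_cst; near=> N; rewrite min_l//.
    by near: N; exact: nbhs_infty_ger.
  by rewrite ger0_norm ?ge_min ?lexx// le_min h0/=.
have [N MN] : exists N : nat, M < \int[P]_w Num.min (h t w) N%:R.
  by have [N _ /(_ N (leqnn _))] := cvgr_gt _ cvgN _ Mt; exists N.
apply: contrapT => nex.
have sP (j : nat) : {s : R | `|s - t| < j.+1%:R^-1 /\ moment s <= M}.
  apply: cid; apply: contrapT => nj; apply: nex; exists j.+1%:R^-1 => // s sj.
  by rewrite ltNge; apply/negP => sM; apply: nj; exists s.
pose s j := sval (sP j).
have st j : `|s j - t| < j.+1%:R^-1 by rewrite /s; case: (sP j) => ? [].
have sM j : moment (s j) <= M by rewrite /s; case: (sP j) => ? [].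
have hs w : h (s j) w @[j --> \oo] --> h t w.
  apply: (cvg_sum_seq (u := fun j k => `|crd (Z (Num.max (s j) 0) w) k|)) => k; apply: cvg_norm; apply/cvgrPdist_lt => e e0.
  have [r r0 zr] := deriv_on_continuous (dZ w k (max0 t)) e0.
  near=> j; rewrite distrC; apply: zr; first by rewrite /= in_itv/= max0.
  apply: le_lt_trans (clamp_lipschitz _ _) _; apply: lt_trans (st j) _.
  by near: j; exact: (near_infty_natSinv_lt (PosNum r0)).
have cvgs : (fun j => \int[P]_w Num.min (h (s j) w) N%:R) @ \oo --> \int[P]_w Num.min (h t w) N%:R.
  apply: (int_cvg _ _ _ (L1_cst P N%:R)) => // [w|j w].
    exact: cvg_minr.
  by rewrite ger0_norm ?ge_min ?lexx ?orbT// le_min h0/=.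
have : \int[P]_w Num.min (h t w) N%:R <= M.
  apply: (cvgr_to_le cvgs); apply: nearW => j; apply: le_trans (sM j).
  rewrite momE; apply: int_le => //; last by move=> w; rewrite ge_min lexx.
  apply: L1_le (Lh (s j)) => // w.
  by rewrite ger0_norm ?ge_min ?lexx// le_min h0/=.
by rewrite leNgt MN.
Unshelve. all: by end_near.
Qed.

Lemma moment_locally_bounded (b : R) : exists M, forall s, 0 <= s <= b -> moment s <= M.
Proof.
apply: (locally_bounded_of_bootstrap moment_ge0 _ moment_lower_semicont moment_bootstraps).
by rewrite mulr_ge0.
Qed.

Lemma expected_increment_le (f : E * E -> R) (phi : E * E -> K -> R) (Mf B : R) (a b L : R) :
  has_gradient f phi -> measurable_fun setT f ->
  (forall k, measurable_fun setT (phi^~ k)) ->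
  (forall z, `|f z| <= Mf) -> (forall z k, `|phi z k| <= B) ->
  0 <= a -> a <= b ->
  (forall s, a <= s <= b -> \int[P]_w (\sum_k phi (Z s w) k * V s w k) <= L) ->
  \int[P]_w f (Z b w) - \int[P]_w f (Z a w) <= L * (b - a).
Proof.
move=> fphi mf mphi fM phiB a0 ab WL; have b0 := le_trans a0 ab.
have clamp s : a <= s <= b -> Num.max s 0 = s.
  by move=> /andP[as_ _]; rewrite max_l// (le_trans a0).
have s0 s : a <= s <= b -> 0 <= s by move=> /andP[/(le_trans a0)].
have [M GM] := moment_locally_bounded b.
have LfZ s : 0 <= s -> L1 P (fun w => f (Z s w)).
  by move=> ?; apply: (@L1_bounded _ _ _ _ _ Mf) => //; exact: (measurableT_comp mf (mZ _)).
have {}phiB z k : `|phi z k| <= `|B| by rewrite (le_trans (phiB z k))// ler_norm.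
have B0 : 0 <= `|B|.
  exact: normr_ge0.
apply: (@expected_mean_value _ _ _ P (fun s w => f (Z s w))
  (fun s w => \sum_k phi (Z (Num.max s 0) w) k * V (Num.max s 0) w k) a b
  (#|{: K}|%:R * (`|B| * (C * (1 + M)))) L) => //.
- apply: measurable_sum => k; apply: measurable_funM.
    exact: (measurableT_comp (mphi k) measurable_Z_clamped).
  exact: measurable_V_clamped.
- move=> w s sab; rewrite clamp//.
  apply: (gradient_chain (Z := fun s => Z s w) fphi) => k.
  apply: deriv_on_subset (dZ w k (s0 s sab)) => y /=; rewrite !in_itv/= andbT.
  by move=> /andP[/(le_trans a0)].
- exact: LfZ.
- exact: LfZ.
- move=> s sab; rewrite clamp//; have ss := s0 s sab.
  have LpV k : L1 P (fun w => phi (Z s w) k * V s w k).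
    apply: (L1M (M := `|B|)) => //; last exact: LV.
    exact: (measurableT_comp (mphi k) (mZ ss)).
  have LsV : L1 P (fun w => \sum_k phi (Z s w) k * V s w k) by exact: L1_sum.
  rewrite -EFin_int; last exact: L1_abs.
  rewrite lee_fin; apply: (@le_trans _ _ (\int[P]_w (\sum_k `|B| * `|V s w k|))).
    apply: int_le; [exact: L1_abs|by apply: L1_sum => k; exact/L1Z/L1_abs/LV|].
    move=> w; rewrite (le_trans (ler_norm_sum _ _ _))// ler_sum// => k _.
    by rewrite normrM ler_wpM2r.
  rewrite int_sum; last by move=> k; exact/L1Z/L1_abs/LV.
  rewrite mulr_natl -sumr_const ler_sum// => k _.
  rewrite intZ; last exact/L1_abs/LV.
  rewrite ler_wpM2l// (le_trans (VC k ss))// ler_wpM2l// lerD2l GM// ss.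
  by move/andP: sab => [].
- by move=> s sab; rewrite clamp//; exact: WL.
Qed.

Section observable.
Variables (f : E * E -> R) (phi : E * E -> K -> R) (Mf B : R).
Hypotheses (fphi : has_gradient f phi) (mf : measurable_fun setT f).
Hypothesis mphi : forall k, measurable_fun setT (phi^~ k).
Hypotheses (fM : forall z, `|f z| <= Mf) (phiB : forall z k, `|phi z k| <= B).

Let LfZ s : 0 <= s -> L1 P (fun w => f (Z s w)).
Proof.
move=> s0; exact: (L1_bounded P (measurableT_comp mf (mZ s0)) (fun w => fM _)).
Qed.

Let LphiV s k : 0 <= s -> L1 P (fun w => phi (Z s w) k * V s w k).
Proof.
move=> s0; apply: (L1M (M := B)) => //; last exact: LV.
exact: (measurableT_comp (mphi k) (mZ s0)).
Qed.

(** Apply [expected_increment_le] to - f. *)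
Lemma expected_increment_ge (a b L : R) : 0 <= a -> a <= b ->
  (forall s, a <= s <= b -> L <= \int[P]_w (\sum_k phi (Z s w) k * V s w k)) ->
  L * (b - a) <= \int[P]_w f (Z b w) - \int[P]_w f (Z a w).
Proof.
move=> a0 ab WL.
have intN h : L1 P h -> \int[P]_w (- h w) = - \int[P]_w h w.
  by move=> Lh; under eq_Rintegral do rewrite -mulN1r; rewrite intZ// mulN1r.
have := @expected_increment_le (fun z => - f z) (fun z k => - phi z k)
  Mf B a b (- L) (has_gradientN fphi).
rewrite !intN; [|exact: LfZ|by apply: LfZ; exact: le_trans ab].
move=> h; suff : - (\int[P]_w f (Z b w)) - - (\int[P]_w f (Z a w)) <= - L * (b - a) by lra.
apply: h => //.
- exact: measurableT_comp.
- by move=> k; apply: measurableT_comp => //; exact: mphi.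
- by move=> z; rewrite normrN.
- by move=> z k; rewrite normrN.
- move=> s sab; have s0 : 0 <= s by move/andP: sab => [/(le_trans a0)].
  rewrite lerNr; apply: le_trans (WL s sab) _.
  rewrite -intN; last by apply: L1_sum => k; under eq_fun do rewrite mulNr -mulN1r; exact/L1Z/LphiV.
  rewrite le_eqVlt; apply/orP; left; apply/eqP; apply: eq_Rintegral => w _.
  by rewrite -sumrN; apply: eq_bigr => k _; rewrite mulNr opprK.
Qed.

Lemma expectation_conserved (b : R) : 0 <= b ->
  (forall s k, 0 <= s <= b -> \int[P]_w (phi (Z s w) k * V s w k) = 0) ->
  \int[P]_w f (Z b w) = \int[P]_w f (Z 0 w).
Proof.
move=> b0 W0.
have W s : 0 <= s <= b -> \int[P]_w (\sum_k phi (Z s w) k * V s w k) = 0.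
  move=> sb; rewrite int_sum => [|k]; last by apply: LphiV; move/andP: sb => [].
  by rewrite big1// => k _; exact: W0.
apply/eqP; rewrite -subr_eq0; apply/eqP/le_anti/andP; split.
  have := expected_increment_le (L := 0) fphi mf mphi fM phiB (lexx 0) b0.
  by rewrite mul0r; apply=> s sb; rewrite W.
have := expected_increment_ge (L := 0) (lexx 0) b0.
by rewrite mul0r; apply=> s sb; rewrite W.
Qed.

End observable.

Section law_conservation.
Variable th : pred K.
Hypothesis orth : forall k, th k -> forall a m (s : R), 0 <= s ->
  \int[P]_w (soft_orthant_grad th a m (Z s w) k * V s w k) = 0.

(** The expectations of the smooth approximations are constant in time by
    [expectation_conserved]; let the approximation parameter tend to infinity. *)
Lemma orthant_conserved a (s : R) : 0 <= s ->
  P (Z s @^-1` orthant th a) = P (Z 0 @^-1` orthant th a).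
Proof.
move=> s0.
have flow m : \int[P]_w soft_orthant th a m (Z s w) = \int[P]_w soft_orthant th a m (Z 0 w).
  apply: (expectation_conserved (soft_orthant_has_gradient th a m)
   (measurable_soft_orthant th a m) (measurable_soft_orthant_grad th a m)
   (soft_orthant_norm th a m) (soft_orthant_grad_norm th a m) s0) => u k /andP[u0 _].
  have [thk|nthk] := boolP (th k); first exact: orth.
  rewrite (@eq_Rintegral _ _ _ P setT (cst 0)) => [|w _]; last first.
    by rewrite /soft_orthant_grad (negbTE nthk) mul0r.
  by rewrite /Rintegral integral0.
have lim u : 0 <= u -> (fun m => \int[P]_w soft_orthant th a m (Z u w)) @ \oo -->
    \int[P]_w (\1_(orthant th a) (Z u w) : R).
  move=> u0; apply: (int_cvg _ _ _ (L1_cst P 1)).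
  - by move=> m; exact: (measurableT_comp (measurable_soft_orthant th a m) (mZ u0)).
  - have mI : measurable_fun setT (\1_(orthant th a) : E * E -> R) by apply: measurable_indic; exact: measurable_orthant.
    exact: (measurableT_comp mI (mZ u0)).
  - by move=> w; exact: soft_orthant_cvg.
  - by move=> m w; exact: soft_orthant_norm.
have mO u : 0 <= u -> measurable (Z u @^-1` orthant th a).
  by move=> u0; rewrite -[X in measurable X]setTI; apply: mZ => //; exact: measurable_orthant.
have PE u : 0 <= u -> \int[P]_w (\1_(orthant th a) (Z u w) : R) = fine (P (Z u @^-1` orthant th a)).
  move=> u0; rewrite /Rintegral; congr fine.
  rewrite -[X in _ = P X]setIT -(integral_indic P measurableT (mO u u0)).
  by apply: eq_integral => w _; rewrite !indicE.
have fP u : 0 <= u -> P (Z u @^-1` orthant th a) \is a fin_num.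
  by move=> u0; exact/fin_num_measure/mO.
rewrite -(fineK (fP s s0)) -(fineK (fP 0 (lexx 0))) -!PE//; congr EFin.
have := lim s s0; under eq_fun do rewrite flow.
by move=> h; exact: (cvg_unique _ h (lim 0 (lexx 0))).
Qed.

End law_conservation.

End process.

(** * Conditional expectations *)

Section staircase.
Context {R : realType}.

(** The sum counts the integers of [1, N + 1] below (N + 1) t, that is the
    integer part of (N + 1) t.  So bounded functions are uniform limits of
    averages of indicators of their superlevel sets. *)
Lemma staircase_approx (N : nat) (t : R) : 0 <= t <= 1 ->
  `|t - N.+1%:R^-1 * \sum_(j < N.+1) (j.+1%:R <= N.+1%:R * t)%R%:R| <= N.+1%:R^-1.
Proof.
move=> /andP[t0 t1].
have N0 : 0 < N.+1%:R :> R by [].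
have Nt0 : 0 <= N.+1%:R * t by rewrite mulr_ge0.
have /andP[h1 h2] := truncn_itv Nt0.
set q := Num.truncn _ in h1 h2.
have qN : (q <= N.+1)%N.
  by rewrite -(ler_nat R) (le_trans h1)// ler_piMr.
have cnt M : (\sum_(j < M) (j < q)%N)%N = minn M q.
  elim: M => [|M IH]; first by rewrite big_ord0 min0n.
  rewrite big_ord_recr/= IH; have [Mq|] := boolP (M < q)%N; last rewrite -leqNgt => Mq.
    by rewrite (minn_idPl (ltnW Mq)) (minn_idPl Mq) addn1.
  by rewrite (minn_idPr Mq) (minn_idPr (leqW Mq)) addn0.
have -> : \sum_(j < N.+1) (j.+1%:R <= N.+1%:R * t)%R%:R = q%:R :> R.
  rewrite -(minn_idPr qN) -cnt natr_sum; apply: eq_bigr => j _; congr (_%:R).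
  by rewrite -truncn_ge_nat.
have E : t - N.+1%:R^-1 * q%:R = N.+1%:R^-1 * (N.+1%:R * t - q%:R).
  by rewrite mulrBr mulKf ?gt_eqF.
rewrite E normrM ger0_norm ?invr_ge0 ?(ltW N0)// ler_piMr ?invr_ge0//.
by rewrite ger0_norm ?subr_ge0// lerBlDr addrC natr1 ltW.
Qed.

End staircase.

Section condexp.
Context {R : realType} d d' (T : measurableType d) (U : measurableType d') {n : nat}.
Variables (p : probability T R) (pr : T -> U) (f : T -> 'rV[R]_n) (m : U -> 'rV[R]_n).
Hypotheses (mpr : measurable_fun setT pr) (mE : is_condexp p pr f m).

Let mm (i : 'I_n) : measurable_fun setT (fun u => m u ord0 i).
Proof. by case: mE => /measurable_fun_mxP. Qed.

Lemma condexp_indic i (A : set U) : measurable A ->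
  \int[p]_z (\1_A (pr z) * (m (pr z) ord0 i - f z ord0 i)) = 0.
Proof.
case: mE => _ Lf Lm mfA mA.
have mprA : measurable (pr @^-1` A) by rewrite -[X in measurable X]setTI; exact: mpr.
have mI : measurable_fun setT (fun z => \1_A (pr z) : R).
  by apply: (measurableT_comp _ mpr); exact: measurable_indic.
have I1 z : `|\1_A (pr z) : R| <= 1 by rewrite indicE; case: (_ \in _); rewrite ?normr1 ?normr0.
have E (h : T -> R) : \int[p]_z (\1_A (pr z) * h z) = \int[p]_(z in pr @^-1` A) h z.
  rewrite [RHS]Rintegral_mkcond; apply: eq_Rintegral => z _.
  rewrite /patch indicE; have [zA|zA] := pselect (A (pr z)).
    by rewrite !mem_set// mul1r.
  by rewrite !memNset// mul0r.
under eq_Rintegral do rewrite mulrBr.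
rewrite intB; [|exact: (L1M (M := 1) mI I1 (Lm i))|exact: (L1M (M := 1) mI I1 (Lf i))].
apply/eqP; rewrite subr_eq0; apply/eqP.
rewrite (E (fun z => m (pr z) ord0 i)) (E (fun z => f z ord0 i)).
by rewrite /Rintegral mfA.
Qed.

(** True for indicators by definition of a conditional expectation, hence for
    [0, 1]-valued functions by [staircase_approx], hence for bounded ones after
    an affine change. *)
Lemma condexp_orthogonal i (phi : U -> R) (B : R) : measurable_fun setT phi ->
  (forall u, `|phi u| <= B) ->
  \int[p]_z (phi (pr z) * (m (pr z) ord0 i - f z ord0 i)) = 0.
Proof.
move=> mphi phiB; pose g z := m (pr z) ord0 i - f z ord0 i.
have Lg : L1 p g by case: mE => _ Lf Lm _; apply: L1B; [exact: Lm|exact: Lf].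
rewrite -/(g _).
have unit_case (psi : U -> R) : measurable_fun setT psi ->
    (forall u, 0 <= psi u <= 1) -> \int[p]_z (psi (pr z) * g z) = 0.
  move=> mpsi psi01.
  have psin u : `|psi u| <= 1 by have /andP[? ?] := psi01 u; rewrite ger0_norm.
  have mpsipr := measurableT_comp mpsi mpr.
  apply/eqP; rewrite -normr_le0; apply/ler_addgt0Pr => e e0; rewrite add0r.
  have I0 : 0 <= \int[p]_z `|g z| by exact: int_ge0.
  pose N := Num.truncn ((\int[p]_z `|g z|) / e).
  have Ne : N.+1%:R^-1 * \int[p]_z `|g z| <= e.
    by rewrite mulrC ler_pdivrMr// mulrC -ler_pdivrMr// ltW// truncnS_gt.
  pose A (j : 'I_N.+1) : set U := [set u | j.+1%:R <= N.+1%:R * psi u].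
  have mA j : measurable (A j).
    rewrite (_ : A j = (fun u => N.+1%:R * psi u) @^-1` `[j.+1%:R, +oo[).
      rewrite -[X in measurable X]setTI.
      have := @measurable_funM _ _ _ setT (cst N.+1%:R) psi (measurable_cst _) mpsi.
      by apply => //; exact: measurable_itv.
    by apply/seteqP; split => u; rewrite /A /= in_itv/= andbT.
  have mIA j : measurable_fun setT (fun z => \1_(A j) (pr z) : R).
    by apply: (measurableT_comp _ mpr); exact: measurable_indic.
  have I1 j z : `|\1_(A j) (pr z) : R| <= 1.
    by rewrite indicE; case: (_ \in _); rewrite ?normr1 ?normr0.
  have LA j : L1 p (fun z => \1_(A j) (pr z) * g z) by exact: (L1M (M := 1)).
  pose st z : R := N.+1%:R^-1 * \sum_(j < N.+1) (\1_(A j) (pr z)).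
  have stE z : st z * g z = N.+1%:R^-1 * \sum_(j < N.+1) (\1_(A j) (pr z) * g z).
    by rewrite /st -mulrA mulr_suml.
  have Lst : L1 p (fun z => st z * g z).
    rewrite (_ : (fun z => _) = (fun z => N.+1%:R^-1 * \sum_(j < N.+1) (\1_(A j) (pr z) * g z))).
      by apply: L1Z; exact: L1_sum.
    exact/funext.
  have st0 : \int[p]_z (st z * g z) = 0.
    under eq_Rintegral do rewrite stE.
    rewrite intZ; last exact: L1_sum.
    rewrite int_sum// big1 ?mulr0// => j _; exact: condexp_indic.
  have Lpsi : L1 p (fun z => psi (pr z) * g z) by exact: (L1M (M := 1)).
  rewrite -[X in `|X|]subr0 -[X in `|_ - X|]st0 -intB//.
  apply: le_trans (int_abs _) _; first exact: L1B.
  apply: le_trans Ne; rewrite -intZ; last exact: L1_abs.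
  apply: int_le; [by apply: L1_abs; exact: L1B|by apply: L1Z; exact: L1_abs|].
  move=> z; rewrite -mulrBl normrM ler_wpM2r//.
  have -> : st z = N.+1%:R^-1 * \sum_(j < N.+1) (j.+1%:R <= N.+1%:R * psi (pr z))%R%:R.
    congr (_ * _); apply: eq_bigr => j _; rewrite indicE; congr (_%:R).
    by congr nat_of_bool; apply/idP/idP; rewrite inE.
  exact: staircase_approx.
have [B0|B0] := leP B 0.
  have phi0 u : phi u = 0 by apply/eqP; rewrite -normr_le0 (le_trans (phiB u)).
  by under eq_Rintegral do rewrite phi0 mul0r; rewrite /Rintegral integral0.
have B2 : 2 * B != 0 by rewrite mulf_neq0// gt_eqF.
have phiE z : phi (pr z) * g z = 2 * B * ((phi (pr z) + B) / (2 * B) * g z) - B * (1 * g z).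
  by field; rewrite gt_eqF.
have psi01 u : 0 <= (phi u + B) / (2 * B) <= 1.
  have := phiB u; rewrite ler_norml => /andP[h1 h2].
  have B20 : 0 < 2 * B by rewrite mulr_gt0.
  rewrite ler_pdivrMr// mul1r; apply/andP; split; last by lra.
  by rewrite divr_ge0 ?(ltW B20)//; lra.
have mpsi : measurable_fun setT (fun u => (phi u + B) / (2 * B)).
  by apply: measurable_funM => //; exact: measurable_funD.
have psin u : `|(phi u + B) / (2 * B)| <= 1 by have /andP[? ?] := psi01 u; rewrite ger0_norm.
have mpsipr := measurableT_comp mpsi mpr.
have L2 : L1 p (fun z => (phi (pr z) + B) / (2 * B) * g z).
  exact: (L1M (M := 1) mpsipr (fun z => psin (pr z)) Lg).
under eq_Rintegral do rewrite phiE.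
rewrite intB; last 2 first.
- exact: L1Z.
- by apply: L1Z; under eq_fun do rewrite mul1r.
rewrite intZ// (unit_case _ mpsi psi01) mulr0 intZ; last by under eq_fun do rewrite mul1r.
by rewrite (unit_case (cst 1)) ?mulr0 ?subr0// => u; rewrite ler01 lexx.
Qed.

(** Test the conditional expectation against its own sign. *)
Lemma condexp_contraction i :
  \int[p]_z `|m (pr z) ord0 i| <= \int[p]_z `|f z ord0 i|.
Proof.
case: (mE) => _ Lf Lm _.
pose s u : R := if 0 <= m u ord0 i then 1 else -1.
have s1 u : `|s u| <= 1 by rewrite /s; case: ifP; rewrite ?normrN normr1.
have ms : measurable_fun setT s.
  by apply: measurable_fun_ifT => //; apply: measurable_fun_ler.
have mspr := measurableT_comp ms mpr.
have L1m : L1 p (fun z => s (pr z) * m (pr z) ord0 i).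
  exact: (L1M (M := 1) mspr (fun z => s1 (pr z)) (Lm i)).
have L1f : L1 p (fun z => s (pr z) * f z ord0 i).
  exact: (L1M (M := 1) mspr (fun z => s1 (pr z)) (Lf i)).
have := condexp_orthogonal i ms s1.
under eq_Rintegral do rewrite mulrBr.
rewrite intB// => /eqP; rewrite subr_eq0 => /eqP.
rewrite (_ : \int[p]_z (_ * m _ _ _) = \int[p]_z `|m (pr z) ord0 i|); last first.
  apply: eq_Rintegral => z _; rewrite /s; case: leP => h.
    by rewrite mul1r ger0_norm.
  by rewrite mulN1r ltr0_norm.
move=> ->; apply: int_le => //; first by apply: L1_abs; exact: Lf.
by move=> z; rewrite (le_trans (ler_norm _))// normrM ler_piMl.
Qed.

End condexp.

(** * Change of variables, densities and L2 norms *)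

Section image_law.
Context d d' {T : measurableType d} {U : measurableType d'} {R : realType}.
Variables (P : probability T R) (q : probability U R) (Z : T -> U).
Hypotheses (mZ : measurable_fun setT Z).
Hypothesis qZ : forall A, measurable A -> q A = P (Z @^-1` A).

(** Names a measurable function so that it can carry the structure of a random
    variable. *)
Definition as_rv of measurable_fun setT Z : T -> U := Z.

HB.instance Definition _ := isMeasurableFun.Build _ _ _ _ (as_rv mZ) mZ.

Lemma ge0_int_law (f : U -> \bar R) : measurable_fun setT f -> (forall u, 0 <= f u)%E ->
  (\int[q]_u f u = \int[P]_w f (Z w))%E.
Proof.
move=> mf f0.
rewrite -(@ge0_integral_distribution _ _ _ _ R P (as_rv mZ : {mfun T >-> U}) f mf f0).
by apply: eq_measure_integral => A mA _; exact: qZ.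
Qed.

Lemma L1_law (f : U -> R) : measurable_fun setT f ->
  L1 P (fun w => f (Z w)) <-> L1 q f.
Proof.
move=> mf; have mfZ := measurableT_comp mf mZ.
have E : (\int[q]_u `|(f u)%:E| = \int[P]_w `|(f (Z w))%:E|)%E.
  rewrite (ge0_int_law (f := fun u => `|(f u)%:E|%E))//.
  by apply: measurableT_comp => //; exact/measurable_EFinP.
split=> /integrableP[_ h]; apply/integrableP; split; try exact/measurable_EFinP.
  by rewrite E.
by rewrite -E.
Qed.

Lemma int_law (f : U -> R) : L1 q f -> \int[q]_u f u = \int[P]_w f (Z w).
Proof.
move=> Lf; have mf := L1_measurable Lf.
have Lf' : L1 P (fun w => f (Z w)) by exact/L1_law.
rewrite /Rintegral; congr fine.
rewrite -(@integral_distribution _ _ _ _ R P (as_rv mZ : {mfun T >-> U}) (EFin \o f))//.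
  by apply: eq_measure_integral => A mA _; exact: qZ.
exact/measurable_EFinP.
Qed.

End image_law.

Section density.
Context d {T : measurableType d} {R : realType}.
Variables (p : probability T R) (lam : {sigma_finite_measure set T -> \bar R}).
Variable r : T -> R.
Hypothesis ir : L1 lam r.
Hypothesis pr : forall A, measurable A -> p A = (\int[lam]_(z in A) (r z)%:E)%E.

Let pl : p `<< lam.
Proof.
apply/null_content_dominatesP => A mA lA0; rewrite pr//.
apply: null_set_integral => //.
by apply: measurable_funTS; exact/measurable_EFinP/(L1_measurable ir).
Qed.

Let D := Radon_Nikodym_SigmaFinite.f p lam.

Let Dr : ae_eq lam setT D (EFin \o r).
Proof.
apply: integral_ae_eq => //.
- exact: Radon_Nikodym_SigmaFinite.f_integrable.
- by case/integrableP : ir.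
- move=> A _ mA; rewrite -Radon_Nikodym_SigmaFinite.f_integral//; exact: pr.
Qed.

Let mD : measurable_fun setT D.
Proof. exact: measurable_int (Radon_Nikodym_SigmaFinite.f_integrable pl). Qed.

Let ge0_density (f : T -> R) : measurable_fun setT f -> (forall z, 0 <= f z) ->
  (\int[p]_z (f z)%:E = \int[lam]_z (f z * r z)%:E)%E.
Proof.
move=> mf f0.
have mfE : measurable_fun setT (EFin \o f) by exact/measurable_EFinP.
rewrite -(@Radon_Nikodym_SigmaFinite.change_of_variables _ _ _ p lam pl (EFin \o f) setT)//.
apply: ae_eq_integral => //.
- exact: emeasurable_funM.
- by apply/measurable_EFinP; apply: measurable_funM => //; exact: L1_measurable ir.
- move: Dr; apply: filterS => z /(_ Logic.I) Dz _; rewrite -/(D z) Dz.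
  by rewrite -EFinM.
Qed.

(** The function r can be negative on a null set only, since it agrees almost
    everywhere with the Radon-Nikodym derivative of p. *)
Lemma L1_density (f : T -> R) : L1 p f -> L1 lam (fun z => f z * r z).
Proof.
move=> Lf; have mf := L1_measurable Lf; have mr := L1_measurable ir.
apply: L1_lty; first exact: measurable_funM.
have := L1_abs Lf => /integrableP[_].
rewrite (_ : \int[p]_z _ = \int[lam]_z (`|f z| * r z)%:E)%E; last first.
  rewrite -ge0_density//; last exact: measurableT_comp.
  by apply: eq_integral => z _; rewrite /= normr_id.
congr (_ < _)%E; apply: ae_eq_integral => //.
- by apply/measurable_EFinP; apply: measurable_funM => //; exact: measurableT_comp.
- by apply/measurable_EFinP; apply: measurableT_comp => //; exact: measurable_funM.
- move: Dr; apply: filterS => z /(_ Logic.I) Dz _; rewrite normrM; congr ((_ * _)%:E).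
  rewrite ger0_norm// -lee_fin -[(r z)%:E]Dz.
  exact: Radon_Nikodym_SigmaFinite.f_ge0.
Qed.

Lemma int_density (f : T -> R) : L1 p f ->
  \int[p]_z f z = \int[lam]_z (f z * r z).
Proof.
move=> Lf; have mf := L1_measurable Lf.
pose fp z : R := Num.max (f z) 0; pose fn z : R := Num.max (- f z) 0.
have fE z : f z = fp z - fn z.
  by rewrite /fp /fn; case: (leP (f z) 0) => ?; case: (leP (- f z) 0) => ?; lra.
have fp0 z : 0 <= fp z by rewrite le_max lexx orbT.
have fn0 z : 0 <= fn z by rewrite le_max lexx orbT.
have mfp : measurable_fun setT fp by exact: measurable_maxr.
have mfn : measurable_fun setT fn by apply: measurable_maxr => //; exact: measurableT_comp.
have fn_le z : `|fp z| <= `|f z|.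
  by rewrite ger0_norm// /fp ge_max normr_ge0 ler_norm.
have fn_le' z : `|fn z| <= `|f z|.
  by rewrite ger0_norm// /fn ge_max normr_ge0 -normrN ler_norm.
have Lfp : L1 p fp by apply: (L1_le mfp fn_le); exact: L1_abs.
have Lfn : L1 p fn by apply: (L1_le mfn fn_le'); exact: L1_abs.
have key h : L1 p h -> measurable_fun setT h -> (forall z, 0 <= h z) ->
    \int[p]_z h z = \int[lam]_z (h z * r z).
  by move=> Lh mh h0; rewrite /Rintegral ge0_density.
rewrite (@eq_Rintegral _ _ _ p setT (fun z => fp z - fn z) f) => [|z _]; last exact: fE.
rewrite (@eq_Rintegral _ _ _ lam setT (fun z => fp z * r z - fn z * r z) (fun z => f z * r z)) => [|z _]; last first.
  by rewrite fE mulrBl.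
rewrite !intB//; [|exact: L1_density|exact: L1_density].
by rewrite !key.
Qed.

End density.

Section L2_norm.
Context d {T : measurableType d} {R : realType}.
Variable P : probability T R.
Implicit Types h : T -> R.

Lemma Lnorm2E h : ('N[P]_2%:E[EFin \o h] = (\int[P]_z (h z ^+ 2)%:E) `^ 2^-1)%E.
Proof.
rewrite unlock /Lnorm/=; congr (poweR _ _).
apply: eq_integral => z _; congr EFin.
by rewrite -[2]/(2%:R) powR_mulrn// real_normK ?num_real.
Qed.

Lemma Lnorm2_le h (eta : R) : 0 <= eta ->
  (\int[P]_z (h z ^+ 2)%:E <= (eta ^+ 2)%:E)%E -> ('N[P]_2%:E[EFin \o h] <= eta%:E)%E.
Proof.
move=> e0 H; rewrite Lnorm2E.
have I0 : (0 <= \int[P]_z (h z ^+ 2)%:E)%E.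
  by apply: integral_ge0 => z _; rewrite lee_fin sqr_ge0.
apply: (@le_trans _ _ ((eta ^+ 2)%:E `^ 2^-1)%E).
  by apply: gt0_ler_poweR => //; rewrite in_itv/= ?leey ?andbT ?lee_fin ?sqr_ge0.
by rewrite poweR_EFin powR12_sqrt ?sqr_ge0// sqrtr_sqr ger0_norm.
Qed.

Lemma Lnorm2_lty h : measurable_fun setT h -> ('N[P]_2%:E[EFin \o h] < +oo)%E ->
  L1 P (fun z => h z ^+ 2).
Proof.
move=> mh; rewrite Lnorm2E => H.
apply: L1_lty; first exact: measurable_funX.
under eq_integral do rewrite ger0_norm ?sqr_ge0//.
by apply: lty_poweRy H; rewrite invr_eq0.
Qed.

Lemma L1_of_sqr h : measurable_fun setT h -> L1 P (fun z => h z ^+ 2) -> L1 P h.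
Proof.
move=> mh Lh; apply: (L1_le mh (g := fun z => 1 + h z ^+ 2)).
  move=> z; have := sqr_ge0 (`|h z| - 1); rewrite sqrrB1 real_normK ?num_real// -mulr_natl.
  by have := normr_ge0 (h z); lra.
by apply: L1D => //; exact: L1_cst.
Qed.

(** From h <= h ^+ 2 / (2 eta) + eta / 2, which is (h - eta) ^+ 2 >= 0. *)
Lemma int_le_Lnorm2 h (eta : R) : measurable_fun setT h -> (forall z, 0 <= h z) ->
  0 < eta -> ('N[P]_2%:E[EFin \o h] <= eta%:E)%E -> \int[P]_z h z <= eta.
Proof.
move=> mh h0 e0 H.
have Lh2 : L1 P (fun z => h z ^+ 2) by apply: Lnorm2_lty => //; apply: le_lt_trans H (ltry _).
have Lh := L1_of_sqr mh Lh2.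
have H2 : \int[P]_z (h z ^+ 2) <= eta ^+ 2.
  have I0 : 0 <= \int[P]_z (h z ^+ 2) by apply: int_ge0 => z; exact: sqr_ge0.
  move: H; rewrite Lnorm2E -EFin_int// poweR_EFin powR12_sqrt// lee_fin => H.
  by rewrite -(sqr_sqrtr I0) lerXn2r// nnegrE ?sqrtr_ge0// ltW.
have L2 : L1 P (fun z => (2 * eta)^-1 * h z ^+ 2 + eta / 2).
  by apply: L1D; [exact: L1Z|exact: L1_cst].
apply: (@le_trans _ _ (\int[P]_z ((2 * eta)^-1 * h z ^+ 2 + eta / 2))).
  apply: int_le => // z; have e20 : 0 < 2 * eta by rewrite mulr_gt0.
  rewrite -(ler_pM2l e20) mulrDr mulVKf ?gt_eqF//.
  by have := sqr_ge0 (h z - eta); rewrite sqrrB -mulr_natl; nra.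
rewrite intD//; [|exact: L1Z|exact: L1_cst].
rewrite (int_cst P (eta / 2)) intZ//.
apply: (@le_trans _ _ ((2 * eta)^-1 * eta ^+ 2 + eta / 2)).
  by rewrite lerD2r ler_wpM2l// invr_ge0 mulr_ge0// ltW.
by rewrite le_eqVlt; apply/orP; left; apply/eqP; field; rewrite gt_eqF.
Qed.

End L2_norm.

(** * Continuity in time of second moments and of cross terms *)

Section local_properties.
Context {R : realType}.

Lemma close_sub (a b a' b' e : R) : `|a - a'| <= e / 2 -> `|b - b'| <= e / 2 ->
  `|a - b - (a' - b')| <= e.
Proof.
by rewrite !ler_norml => /andP[? ?] /andP[? ?]; apply/andP; split; lra.
Qed.

Lemma clip_close (x : R) (N : nat) : `|Num.max (- N%:R) (Num.min x N%:R) - x| <= `|x|.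
Proof.
have N0 : 0 <= N%:R :> R by [].
rewrite ler_norml; have := ler_norm x; have := ler_norm (- x); rewrite normrN => h1 h2.
apply/andP; have [a|a] := leP x N%:R.
  by have [b|b] := leP (- N%:R) x; split; lra.
by have [b|b] := leP (- N%:R : R) N%:R; split; lra.
Qed.

Lemma close_chain (a b b1 c1 c e : R) : `|a - b| <= e / 4 -> `|b1 - b| <= e / 4 ->
  `|c1 - c| <= e / 4 -> `|b1 - c1| <= e / 4 -> `|a - c| <= e.
Proof.
rewrite !ler_norml => /andP[? ?] /andP[? ?] /andP[? ?] /andP[? ?].
by apply/andP; split; lra.
Qed.

Lemma local_of_sequences (Q : R -> Prop) (t : R) :
  (forall u : nat -> R, (forall j, 0 <= u j) -> u @ \oo --> t ->
     exists j, Q (u j)) ->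
  exists2 r : R, 0 < r & forall s : R, 0 <= s -> `|s - t| < r -> Q s.
Proof.
move=> H; apply: contrapT => nex.
have sP (j : nat) : {s : R | [/\ 0 <= s, `|s - t| < j.+1%:R^-1 & ~ Q s]}.
  apply: cid; apply: contrapT => nj; apply: nex; exists j.+1%:R^-1 => // s s0 sj.
  by apply: contrapT => nQ; apply: nj; exists s.
have [||j] := H (fun j => sval (sP j)).
- by move=> j; case: (sP j) => s [].
- apply/cvgrPdist_lt => e e0; near=> j; rewrite distrC.
  apply: (@lt_trans _ _ j.+1%:R^-1); first by case: (sP j) => s [].
  by near: j; exact: (near_infty_natSinv_lt (PosNum e0)).
- by case: (sP j) => s [].
Unshelve. all: by end_near.
Qed.

End local_properties.

Section equal_second_moments.
Context {R : realType} d {T : measurableType d}.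
Variables (P : probability T R) (x : R -> T -> R) (M : R).
Hypothesis mx : forall s : R, 0 <= s -> measurable_fun setT (x s).
Hypothesis Lx2 : forall s : R, 0 <= s -> L1 P (fun w => x s w ^+ 2).
Hypothesis xM : forall s : R, 0 <= s -> \int[P]_w (x s w ^+ 2) = M.

(** When all second moments are equal to M, the second moment of x_s - x_t is
    4 M minus that of x_s + x_t.  The latter is lower semicontinuous, with value
    4 M at s = t, because its truncations are continuous. *)
Lemma L2_continuity (t e : R) : 0 <= t -> 0 < e ->
  (forall w (u : nat -> R), (forall j, 0 <= u j) -> u @ \oo --> t ->
     x (u j) w @[j --> \oo] --> x t w) ->
  exists2 r : R, 0 < r & forall s : R, 0 <= s -> `|s - t| < r ->
    \int[P]_w ((x s w - x t w) ^+ 2) <= e.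
Proof.
move=> t0 e0 xc; apply: local_of_sequences => u u0 ut.
pose S j w := (x (u j) w + x t w) ^+ 2.
have S0 j w : 0 <= S j w by exact: sqr_ge0.
pose S' w := (x t w + x t w) ^+ 2.
have S'0 w : 0 <= S' w by exact: sqr_ge0.
have sqD s : 0 <= s -> measurable_fun setT (fun w => (x s w + x t w) ^+ 2) /\
    L1 P (fun w => (x s w + x t w) ^+ 2).
  move=> s0.
  have ms : measurable_fun setT (fun w => (x s w + x t w) ^+ 2).
    by apply: measurable_funX; apply: measurable_funD; exact: mx.
  split=> //; apply: (L1_le ms (g := fun w => 2 * x s w ^+ 2 + 2 * x t w ^+ 2)).
    move=> w; rewrite ger0_norm ?sqr_ge0//.
    by have h := sqr_ge0 (x s w - x t w); rewrite !expr2 in h *; lra.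
  by apply: L1D; apply: L1Z; exact: Lx2.
have [mS' LS'] := sqD t t0.
have intS s : 0 <= s -> \int[P]_w ((x s w - x t w) ^+ 2) = 4 * M - \int[P]_w ((x s w + x t w) ^+ 2).
  move=> s0; have [_ LS] := sqD s s0.
  have -> : 4 * M = \int[P]_w (2 * x s w ^+ 2 + 2 * x t w ^+ 2).
    rewrite intD; [|by apply: L1Z; exact: Lx2|by apply: L1Z; exact: Lx2].
    rewrite !intZ; [|exact: Lx2|exact: Lx2]; rewrite !xM//; ring.
  rewrite -intB//; last by apply: L1D; apply: L1Z; exact: Lx2.
  by apply: eq_Rintegral => w _; ring.
have S'M : \int[P]_w S' w = 4 * M.
  rewrite -(xM t0) -intZ; last exact: Lx2.
  by apply: eq_Rintegral => w _; rewrite /S'; ring.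
have mmin (N : nat) (h : T -> R) : measurable_fun setT h -> measurable_fun setT (fun w => Num.min (h w) N%:R).
  by move=> mh; exact: measurable_minr.
have cvgN : (fun N : nat => \int[P]_w Num.min (S' w) N%:R) @ \oo --> 4 * M.
  rewrite -S'M; apply: (int_cvg _ _ _ LS') => //.
  - by move=> N; exact: mmin.
  - move=> w; apply: cvg_near_cst; near=> N; rewrite min_l//.
    by near: N; exact: nbhs_infty_ger.
  - by move=> N w; rewrite ger0_norm ?ge_min ?lexx// le_min S'0/=.
have eM : 4 * M - e < 4 * M by lra.
have [N _ /(_ N (leqnn _)) MN] := cvgr_gt _ cvgN _ eM.
have cvgj : (fun j => \int[P]_w Num.min (S j w) N%:R) @ \oo --> \int[P]_w Num.min (S' w) N%:R.
  apply: (int_cvg _ _ _ (L1_cst P N%:R)).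
  - by move=> j; apply: mmin; exact: (sqD _ (u0 j)).1.
  - exact: mmin.
  - move=> w; apply: cvg_minr.
    have xw := xc w u u0 ut.
    have : (x (u j) w + x t w) * (x (u j) w + x t w) @[j --> \oo] --> (x t w + x t w) * (x t w + x t w).
      by apply: cvgM; apply: cvgD => //; exact: cvg_cst.
    by [].
  - by move=> j w; rewrite ger0_norm ?ge_min ?lexx ?orbT// le_min S0/=.
have [j _ /(_ j (leqnn _)) Mj] := cvgr_gt _ cvgj _ MN.
exists j; rewrite intS//.
have [mS LS] := sqD _ (u0 j).
have : \int[P]_w Num.min (S j w) N%:R <= \int[P]_w S j w.
  apply: int_le => //; last by move=> w; rewrite ge_min lexx.
  apply: (L1_le (mmin N _ mS) _ LS) => w.
  by rewrite ger0_norm ?ge_min ?lexx// le_min sqr_ge0/=.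
by move: Mj; rewrite /S; lra.
Unshelve. all: by end_near.
Qed.

End equal_second_moments.

Section cross_term.
Context {R : realType} d d' d'' {T : measurableType d} {U : measurableType d'} {E : measurableType d''}.
Variables (P : probability T R) (q : probability E R) (Z : R -> T -> U) (pr : U -> E).
Variables (h : R -> E -> R) (phi : U -> R) (B : R).
Hypothesis mZ : forall s : R, 0 <= s -> measurable_fun setT (Z s).
Hypothesis mpr : measurable_fun setT pr.
Hypothesis mphi : measurable_fun setT phi.
Hypothesis phiB : forall z, `|phi z| <= B.
Hypothesis law : forall s : R, 0 <= s -> forall A, measurable A ->
  q A = P ((pr \o Z s) @^-1` A).
Hypothesis weak : forall t : R, 0 <= t -> forall (Phi : U -> R) (M e : R),
  measurable_fun setT Phi -> (forall z, `|Phi z| <= M) -> 0 < e ->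
  exists2 r : R, 0 < r & forall s : R, 0 <= s -> `|s - t| < r ->
    `|\int[P]_w Phi (Z s w) - \int[P]_w Phi (Z t w)| <= e.
Hypothesis Lh : forall s : R, 0 <= s -> L1 q (h s).
Hypothesis hc : forall t : R, 0 <= t -> forall e : R, 0 < e ->
  exists2 r : R, 0 < r & forall s : R, 0 <= s -> `|s - t| < r ->
    \int[q]_u `|h s u - h t u| <= e.

(** Replace h s by h t, at a cost controlled by the L1 distance of h s and h t
    because the law of pr (Z s) is always q; then replace h t by a truncation,
    at a cost that is uniform in time for the same reason; the remaining
    integrand is bounded and does not depend on time except through the law of
    Z s. *)
Lemma cross_term_continuous (t e : R) : 0 <= t -> 0 < e ->
  exists2 r : R, 0 < r & forall s : R, 0 <= s -> `|s - t| < r ->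
    `|\int[P]_w (phi (Z s w) * h s (pr (Z s w))) -
      \int[P]_w (phi (Z t w) * h t (pr (Z t w)))| <= e.
Proof.
move=> t0 e0.
have B0 : 0 <= B.
  have : 0 <= \int[P]_w `|phi (Z t w)| by exact: int_ge0.
  have mp := measurableT_comp mphi (mZ t0).
  have Lp : L1 P (fun w => phi (Z t w)) by exact: (L1_bounded P mp (fun w => phiB _)).
  move=> /le_trans; apply; rewrite -[leRHS](int_cst P).
  by apply: int_le => //; [exact: L1_abs|exact: L1_cst].
have mprZ s : 0 <= s -> measurable_fun setT (pr \o Z s).
  by move=> s0; exact: (measurableT_comp mpr (mZ s0)).
have mphiZ s : 0 <= s -> measurable_fun setT (fun w => phi (Z s w)).
  by move=> s0; exact: (measurableT_comp mphi (mZ s0)).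
have Lk s (k : E -> R) : 0 <= s -> L1 q k -> L1 P (fun w => k (pr (Z s w))).
  by move=> s0 Lk; apply/(L1_law (mprZ s s0) (law s0)) => //; exact: L1_measurable Lk.
have Lpk s (k : E -> R) : 0 <= s -> L1 q k -> L1 P (fun w => phi (Z s w) * k (pr (Z s w))).
  by move=> s0 Lqk; apply: (L1M (mphiZ s s0) (fun w => phiB _)); exact: Lk.
have bound s (k : E -> R) : 0 <= s -> L1 q k ->
    `|\int[P]_w (phi (Z s w) * k (pr (Z s w)))| <= B * \int[q]_u `|k u|.
  move=> s0 Lqk; rewrite (le_trans (int_abs (Lpk s k s0 Lqk)))//.
  rewrite (int_law (mprZ s s0) (law s0) (L1_abs Lqk)) -intZ; last exact/L1_abs/Lk.
  apply: int_le; [exact/L1_abs/Lpk|exact/L1Z/L1_abs/Lk|].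
  by move=> w; rewrite normrM ler_wpM2r.
have B1 : 0 < B + 1 by lra.
pose e1 := e / 4 / (B + 1).
have e10 : 0 < e1 by rewrite !divr_gt0.
have Be : B * e1 <= e / 4.
  by rewrite /e1 mulrA ler_pdivrMr// mulrC ler_wpM2l ?divr_ge0 ?(ltW e0)//; lra.
have mht : measurable_fun setT (h t) := L1_measurable (Lh t0).
pose clip (N : nat) u : R := Num.max (- N%:R) (Num.min (h t u) N%:R).
have mclip N : measurable_fun setT (clip N).
  by apply: measurable_maxr => //; exact: measurable_minr.
have clipN N u : `|clip N u| <= N%:R.
  have N0 : 0 <= N%:R :> R by [].
  by rewrite ler_norml /clip le_max lexx/= ge_max ge_min lexx orbT andbT; lra.
have cliph N u : `|clip N u - h t u| <= `|h t u| by exact: clip_close.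
have Lclip N : L1 q (clip N) by exact: (L1_bounded q (mclip N) (clipN N)).
have cvgN : (fun N => \int[q]_u `|clip N u - h t u|) @ \oo --> \int[q]_u (cst 0 u : R).
  apply: (int_cvg (g := fun u => `|h t u|)) => //.
  - by move=> N; apply: measurableT_comp => //; exact: measurable_funB.
  - move=> u; apply: cvg_near_cst; near=> N.
    have hN : `|h t u| <= N%:R by near: N; exact: nbhs_infty_ger.
    rewrite ler_norml in hN; move/andP: hN => [h1 h2].
    by rewrite /clip min_l// max_r// subrr normr0.
  - exact/L1_abs/Lh.
  - by move=> N u; rewrite normr_id.
have i0 : \int[q]_u (cst 0 u : R) < e1 by rewrite /Rintegral integral0.
have [N _ /(_ N (leqnn _)) clipe] := cvgr_lt _ cvgN _ i0.
have [r1 r10 Hh] := hc t0 e10.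
have e40 : 0 < e / 4 by rewrite divr_gt0.
pose Phi z := phi z * clip N (pr z).
have mPhi : measurable_fun setT Phi.
  by apply: measurable_funM => //; exact: (measurableT_comp (mclip N) mpr).
have PhiB z : `|Phi z| <= B * N%:R by rewrite normrM ler_pM.
have [r2 r20 Hw] := weak t0 mPhi PhiB e40.
exists (Num.min r1 r2); first by rewrite lt_min r10.
move=> s s0; rewrite lt_min => /andP[sr1 sr2].
have Lst : L1 q (fun u => h s u - h t u) by apply: L1B; exact: Lh.
have Lct : L1 q (fun u => clip N u - h t u) by apply: L1B => //; exact: Lh.
have b1 := bound s _ s0 Lst.
have b2 := bound s _ s0 Lct.
have b3 := bound t _ t0 Lct.
have hw := Hw s s0 sr2.
have split_int s' (k k' : E -> R) : 0 <= s' -> L1 q k -> L1 q k' ->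
   \int[P]_w (phi (Z s' w) * (k (pr (Z s' w)) - k' (pr (Z s' w)))) =
   \int[P]_w (phi (Z s' w) * k (pr (Z s' w))) - \int[P]_w (phi (Z s' w) * k' (pr (Z s' w))).
  move=> s'0 Lk1 Lk2; under eq_Rintegral do rewrite mulrBr.
  by rewrite intB//; exact: Lpk.
rewrite split_int ?Lh// in b1.
rewrite split_int ?Lh// in b2.
rewrite split_int ?Lh// in b3.
have c1 : B * \int[q]_u `|h s u - h t u| <= e / 4.
  by apply: le_trans Be; rewrite ler_wpM2l// Hh.
have c2 : B * \int[q]_u `|clip N u - h t u| <= e / 4.
  by apply: le_trans Be; rewrite ler_wpM2l// ltW.
exact: (close_chain (le_trans b1 c1) (le_trans b2 c2) (le_trans b3 c2) hw).
Unshelve. all: by end_near.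
Qed.

End cross_term.

(** * Derivatives on the half-line and Euclidean norms *)

(** Near t the increments of F lie between those of the affine functions of
    slopes psi t - e and psi t + e. *)
Lemma derive_halfline_squeeze {R : realType} (F psi : R -> R) (t : R) : 0 <= t ->
  (forall a b L, 0 <= a -> a <= b -> (forall s, a <= s <= b -> psi s <= L) ->
     F b - F a <= L * (b - a)) ->
  (forall a b L, 0 <= a -> a <= b -> (forall s, a <= s <= b -> L <= psi s) ->
     L * (b - a) <= F b - F a) ->
  (forall e : R, 0 < e -> exists2 r : R, 0 < r &
     forall s : R, 0 <= s -> `|s - t| < r -> `|psi s - psi t| <= e) ->
  derive_halfline F t (psi t).
Proof.
move=> t0 Fle Fge psic; apply/cvgrPdist_le => e e0.
have [r r0 psir] := psic e e0.
rewrite near_withinE; near=> h => /= th.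
have h0 : h != 0 by near: h; exact: nbhs_dnbhs_neq.
have hr : `|h| < r.
  near: h; apply: dnbhs0_lt => //.
rewrite distrC.
have -> : h^-1 *: (F (t + h) - F t) - psi t = h^-1 * (F (t + h) - F t - psi t * h).
  by rewrite mulrBr [psi t * h]mulrC mulKf.
rewrite normrM normfV ler_pdivrMl ?normr_gt0// mulrC.
have [hp|hn] := ltP 0 h.
  have near_t s : t <= s <= t + h -> `|psi s - psi t| <= e.
    move=> /andP[ts sth]; apply: psir; first exact: le_trans ts.
    by rewrite ger0_norm ?subr_ge0//; move: hr; rewrite gtr0_norm//; lra.
  have := Fle t (t + h) (psi t + e) t0; have := Fge t (t + h) (psi t - e) t0.
  rewrite lerDl (ltW hp) [t + h - t]addrAC subrr add0r (gtr0_norm hp).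
  move=> /(_ isT) F1 /(_ isT) F2; rewrite ler_norml.
  apply/andP; split.
    have : (psi t - e) * h <= F (t + h) - F t.
      by apply: F1 => s /near_t; rewrite ler_norml => /andP[]; lra.
    lra.
  have : F (t + h) - F t <= (psi t + e) * h.
    by apply: F2 => s /near_t; rewrite ler_norml => /andP[]; lra.
  lra.
have {}hn : h < 0 by rewrite lt_neqAle h0.
have near_t s : t + h <= s <= t -> `|psi s - psi t| <= e.
  move=> /andP[ths st]; apply: psir; first exact: le_trans ths.
  by rewrite distrC ger0_norm ?subr_ge0//; move: hr; rewrite ltr0_norm//; lra.
have ht : t + h <= t by lra.
have F1 := Fge (t + h) t (psi t - e) th ht; have F2 := Fle (t + h) t (psi t + e) th ht.
rewrite (ltr0_norm hn) ler_norml; apply/andP; split.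
  have : F t - F (t + h) <= (psi t + e) * (t - (t + h)).
    by apply: F2 => s /near_t; rewrite ler_norml => /andP[]; lra.
  lra.
have : (psi t - e) * (t - (t + h)) <= F t - F (t + h).
  by apply: F1 => s /near_t; rewrite ler_norml => /andP[]; lra.
lra.
Unshelve. all: by end_near.
Qed.

Section euclidean_norm.
Context {R : realType} {n : nat}.
Implicit Types (v : 'rV[R]_n) (z : 'rV[R]_n * 'rV[R]_n).

Lemma dotv_ge0 v : 0 <= dotv v v.
Proof. by apply: sumr_ge0 => i _; rewrite -expr2 sqr_ge0. Qed.

Lemma enorm_ge0 v : 0 <= enorm v.
Proof. exact: sqrtr_ge0. Qed.

Lemma enorm_sqr v : enorm v ^+ 2 = \sum_(i < n) v ord0 i ^+ 2.
Proof.
by rewrite sqr_sqrtr ?dotv_ge0//; apply: eq_bigr => i _; rewrite expr2.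
Qed.

Lemma coord_le_enorm v i : `|v ord0 i| <= enorm v.
Proof.
rewrite -(@ler_pXn2r _ 2)// ?nnegrE ?enorm_ge0// enorm_sqr real_normK ?num_real//.
by rewrite (bigD1 i)//= lerDl sumr_ge0// => j _; exact: sqr_ge0.
Qed.

Lemma enorm_le_sum v : enorm v <= \sum_(i < n) `|v ord0 i|.
Proof.
have s0 : 0 <= \sum_(i < n) `|v ord0 i| by exact: sumr_ge0.
rewrite -(@ler_pXn2r _ 2)// ?nnegrE ?enorm_ge0// enorm_sqr.
rewrite expr2 mulr_suml ler_sum// => i _.
rewrite -real_normK ?num_real// expr2 ler_wpM2l// (bigD1 i)//= lerDl.
exact: sumr_ge0.
Qed.

Lemma measurable_enorm : measurable_fun setT (@enorm R n).
Proof.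
have md : measurable_fun setT (fun v : 'rV[R]_n => dotv v v).
  by apply: measurable_sum => i; apply: measurable_funM; exact: measurable_mx_coord.
have ms : measurable_fun setT (@Num.sqrt R).
  by apply: continuous_measurable_fun; exact: sqrt_continuous.
exact: (measurableT_comp ms md).
Qed.

Lemma enorm2_sqr_pair z : enorm2 z ^+ 2 = enorm z.1 ^+ 2 + enorm z.2 ^+ 2.
Proof. by rewrite sqr_sqrtr// addr_ge0// sqr_ge0. Qed.

Lemma enorm2_sqr z : enorm2 z ^+ 2 = \sum_k crd z k ^+ 2.
Proof. by rewrite enorm2_sqr_pair !enorm_sqr sum_coords. Qed.

End euclidean_norm.

Lemma bounded_Lnorm_infty d (T : measurableType d) (R : realType)
    (mu : {measure set T -> \bar R}) (f : T -> R) (M : R) :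
  (forall x, `|f x| <= M) -> ('N[mu]_+oo[EFin \o f] < +oo)%E.
Proof.
move=> fM; rewrite unlock /Lnorm; case: ifPn => _; last by rewrite ltry.
apply: (@le_lt_trans _ _ M%:E); last exact: ltry.
by apply/ess_sup_inf.ess_supP; apply: aeW => x /=; rewrite lee_fin.
Qed.

Lemma derive_halfline_coord {R : realType} {n : nat} (f : R -> 'rV[R]_n) (t : R)
    (l : 'rV[R]_n) (i : 'I_n) : 0 <= t ->
  derive_halfline f t l ->
  deriv_on `[0, +oo[ (fun s => f s ord0 i) t (l ord0 i).
Proof.
move=> t0 fl e e0.
have /cvg_ballP/(_ e e0) := fl.
rewrite near_withinE => -[r /= r0 fr].
exists r => // s; rewrite in_itv/= andbT => s0 sr.
have [->|st] := eqVneq s t; first by rewrite !subrr mulr0 subr0 normr0 mulr0.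
have h0 : s - t != 0 by rewrite subr_eq0.
have := fr (s - t); rewrite /ball_/= sub0r normrN => /(_ sr h0).
rewrite addrC subrK => /(_ s0) [_ /(_ ord0 i)].
rewrite !mxE /ball/= => H.
have -> : f s ord0 i - f t ord0 i - l ord0 i * (s - t) =
   - ((l ord0 i - (s - t)^-1 * (f s ord0 i - f t ord0 i)) * (s - t)).
  by rewrite mulrBl mulrAC mulVf// mul1r; ring.
by rewrite normrN normrM ler_wpM2r// ltW.
Qed.

(** * Modification on a null set *)

Section off_null_set.
Context d {T : measurableType d} {R : realType}.
Variables (P : probability T R) (N : set T).
Hypotheses (mN : measurable N) (PN : P N = 0%E).

Lemma probability_off_null (A B : set T) : measurable A -> measurable B ->
  (forall w, ~ N w -> A w <-> B w) -> P A = P B.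
Proof.
move=> mA mB AB.
have off C : measurable C -> P C = P (C `\` N).
  move=> mC; rewrite [LHS](measureDI P mC mN).
  rewrite [X in (_ + X)%E](_ : _ = 0%E) ?adde0//.
  apply/eqP; rewrite -measure_le0 -PN; apply: le_measure; rewrite ?inE//.
  exact: measurableI.
rewrite (off A)// (off B)//; congr (P _).
by apply/seteqP; split => w [? ?]; split => //; apply/AB.
Qed.

Lemma ae_off_null (f g : T -> R) : (forall w, ~ N w -> f w = g w) ->
  {ae P, forall w, setT w -> (f w)%:E = (g w)%:E}.
Proof.
move=> fg; exists N; split => //.
move=> w /= nfg; apply: contrapT => nw; apply: nfg => _; by rewrite fg.
Qed.

Lemma int_off_null (f g : T -> R) : measurable_fun setT f -> measurable_fun setT g ->
  (forall w, ~ N w -> f w = g w) -> \int[P]_w f w = \int[P]_w g w.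
Proof.
move=> mf mg fg; rewrite /Rintegral; congr fine; apply: ae_eq_integral => //.
- exact/measurable_EFinP.
- exact/measurable_EFinP.
- exact: ae_off_null.
Qed.

Lemma L1_off_null (f g : T -> R) : measurable_fun setT f ->
  (forall w, ~ N w -> f w = g w) -> L1 P g -> L1 P f.
Proof.
move=> mf fg Lg; have mg := L1_measurable Lg.
apply: L1_lty => //; case/integrableP : Lg => _.
congr (_ < _)%E; apply: ae_eq_integral => //.
- by apply: measurableT_comp => //; exact/measurable_EFinP.
- by apply/measurable_EFinP; exact: measurableT_comp.
- have [N' [mN' N'0 sub]] := ae_off_null fg; exists N'; split => //.
  by apply: subset_trans sub; apply: subsetC => w /= h _; have [->] := h Logic.I.
Qed.

End off_null_set.

(** * The orthogonal coupling dynamics *)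

Section ocd.
Context {R : realType} {n : nat}.
Local Notation E := 'rV[R]_n.
Local Notation K := ('I_n + 'I_n)%type.
Variables (c : E * E -> R) (mX mY : R -> E -> E).
Variables (d : measure_display) (T : measurableType d) (P : probability T R).
Variables (X Y : R -> {mfun T >-> E}).
Local Notation p t := (joint_law P (X t) (Y t)).
Hypothesis XY2 : forall t, 0 <= t -> in_L2 P (X t) /\ in_L2 P (Y t).
Hypothesis ceX : forall t, 0 <= t -> is_condexp (p t) fst (grad_x c) (mX t).
Hypothesis ceY : forall t, 0 <= t -> is_condexp (p t) snd (grad_y c) (mY t).
Variable N : set T.
Hypotheses (mN : measurable N) (PN : P N = 0%E).
Hypothesis paths : forall w, ~ N w -> forall t, 0 <= t ->
  derive_halfline (fun s => X s w) t (ocd_vx c mX t (X t w, Y t w)) /\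
  derive_halfline (fun s => Y s w) t (ocd_vy c mY t (X t w, Y t w)).
Variable C : R.
Hypothesis growth : forall x y : E,
  enorm (grad_x c (x, y)) + enorm (grad_y c (x, y)) <= C * (1 + enorm x + enorm y).

Let inN (w : T) : bool := `[< N w >].

(** The process, set to 0 on the exceptional null set N.  Every path of the
    modified process is differentiable at all times, while all laws and
    integrals are unchanged. *)
Definition ocd_path (s : R) (w : T) : E * E := if inN w then 0 else (X s w, Y s w).

Definition ocd_field (s : R) (z : E * E) (k : K) : R :=
  crd (ocd_vx c mX s z, ocd_vy c mY s z) k.

Definition ocd_velocity (s : R) (w : T) (k : K) : R :=
  if inN w then 0 else ocd_field s (X s w, Y s w) k.

Local Notation Z := ocd_path.
Local Notation V := ocd_velocity.

Let offN w : ~ N w -> inN w = false.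
Proof. by move=> nw; apply/negbTE/asboolPn. Qed.

Let ZE s w : ~ N w -> Z s w = (X s w, Y s w).
Proof. by move=> nw; rewrite /ocd_path offN. Qed.

Let VE s w k : ~ N w -> V s w k = ocd_field s (Z s w) k.
Proof. by move=> nw; rewrite /ocd_velocity ZE// offN. Qed.

Let m_inN : measurable_fun setT inN.
Proof.
apply: (measurable_fun_bool true); rewrite setTI.
by rewrite (_ : _ @^-1` _ = N)//; apply/seteqP; split => w /= /asboolP.
Qed.

Let mXY s : measurable_fun setT (fun w => (X s w, Y s w)).
Proof. exact: measurable_fun_pair. Qed.

Lemma measurable_ocd_path s : measurable_fun setT (Z s).
Proof. exact: measurable_fun_ifT. Qed.

Lemma ocd_path_law s A : measurable A -> p s A = P (Z s @^-1` A).
Proof.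
move=> mA; apply: (probability_off_null mN PN).
- by rewrite -[X in measurable X]setTI; exact: mXY.
- by rewrite -[X in measurable X]setTI; exact: measurable_ocd_path.
- by move=> w nw; rewrite /preimage/= ZE.
Qed.

Lemma ocd_fieldE s z k : ocd_field s z k =
  match k with inl i => mX s z.1 ord0 i | inr j => mY s z.2 ord0 j end - grd c z k.
Proof.
by case: k => i; rewrite /ocd_field /= !mxE addrC.
Qed.

Lemma L1_grd s k : 0 <= s -> L1 (p s) (fun z => grd c z k).
Proof.
move=> s0; case: k => i.
  have [_ /(_ i) + _ _] := ceX s0.
  by rewrite /L1; congr (is_true (_.-integrable _ _)); apply/funext => z; rewrite /= mxE.
have [_ /(_ i) + _ _] := ceY s0.
by rewrite /L1; congr (is_true (_.-integrable _ _)); apply/funext => z; rewrite /= mxE.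
Qed.

Lemma L1_ocd_field s k : 0 <= s -> L1 (p s) (fun z => ocd_field s z k).
Proof.
move=> s0.
have -> : (fun z => ocd_field s z k) = (fun z =>
  match k with inl i => mX s z.1 ord0 i | inr j => mY s z.2 ord0 j end - grd c z k).
  by apply/funext => z; exact: ocd_fieldE.
apply: L1B; last exact: L1_grd.
by case: k => i; [have [_ _ /(_ i)] := ceX s0|have [_ _ /(_ i)] := ceY s0].
Qed.

Let on_path s f : L1 (p s) f -> L1 P (fun w => f (Z s w)).
Proof.
move=> Lf; apply/(L1_law (measurable_ocd_path s) (@ocd_path_law s)) => //.
exact: L1_measurable Lf.
Qed.

Lemma measurable_ocd_velocity s k : 0 <= s -> measurable_fun setT (fun w => V s w k).
Proof.
move=> s0; apply: measurable_fun_ifT => //.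
exact: (measurableT_comp (L1_measurable (L1_ocd_field k s0)) (mXY s)).
Qed.

Lemma L1_ocd_velocity s k : 0 <= s -> L1 P (fun w => V s w k).
Proof.
move=> s0; apply: (L1_off_null mN PN (g := fun w => ocd_field s (Z s w) k)).
- exact: measurable_ocd_velocity.
- by move=> w nw; rewrite VE.
- exact: (on_path (L1_ocd_field k s0)).
Qed.

Lemma ocd_path_deriv w s k : 0 <= s ->
  deriv_on `[0, +oo[ (fun t => crd (Z t w) k) s (V s w k).
Proof.
move=> s0; have [Nw|nw] := pselect (N w).
  have inNw : inN w = true by exact/asboolP.
  move=> e e0; exists 1 => // y _ _; rewrite /ocd_path /ocd_velocity inNw.
  by rewrite subrr mul0r subr0 normr0 mulr_ge0// ltW.
have [dX dY] := paths nw s0.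
case: k => i.
  rewrite (_ : (fun t => _) = (fun t => X t w ord0 i)); last by apply/funext => t; rewrite ZE.
  by rewrite VE// ZE//; exact: derive_halfline_coord.
rewrite (_ : (fun t => _) = (fun t => Y t w ord0 i)); last by apply/funext => t; rewrite ZE.
by rewrite VE// ZE//; exact: derive_halfline_coord.
Qed.

Let L1_sqr_enorm (U : {mfun T >-> E}) : in_L2 P U -> L1 P (fun w => enorm (U w) ^+ 2).
Proof.
move=> [mU U2]; apply: Lnorm2_lty => //.
exact: (measurableT_comp measurable_enorm mU).
Qed.

Lemma L1_crd_sqr s k : 0 <= s -> L1 P (fun w => crd (Z s w) k ^+ 2).
Proof.
move=> s0; have [X2 Y2] := XY2 s0.
apply: (L1_le (g := fun w => enorm (X s w) ^+ 2 + enorm (Y s w) ^+ 2)).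
- by apply: measurable_funX; exact: (measurableT_comp (measurable_crd k) (measurable_ocd_path s)).
- move=> w; rewrite normrX /ocd_path; case: (inN w).
    have -> : crd (0 : E * E) k = 0 by case: k => i; rewrite /= mxE.
    by rewrite normr0 expr0n/= addr_ge0// sqr_ge0.
  case: k => i /=.
    by rewrite ler_wpDr ?sqr_ge0// lerXn2r ?nnegrE ?enorm_ge0// coord_le_enorm.
  by rewrite ler_wpDl ?sqr_ge0// lerXn2r ?nnegrE ?enorm_ge0// coord_le_enorm.
- by apply: L1D; exact: L1_sqr_enorm.
Qed.

Lemma L1_crd s k : 0 <= s -> L1 P (fun w => crd (Z s w) k).
Proof.
move=> s0; apply: L1_of_sqr; last exact: L1_crd_sqr.
exact: (measurableT_comp (measurable_crd k) (measurable_ocd_path s)).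
Qed.

Lemma growth_ge0 : 0 <= C.
Proof.
have := growth 0 0.
have -> : enorm (0 : E) = 0.
  rewrite /enorm (_ : dotv _ _ = 0) ?sqrtr0// /dotv big1// => i _.
  by rewrite mxE mulr0.
rewrite !addr0 mulr1; apply: le_trans.
by rewrite addr_ge0// enorm_ge0.
Qed.

(** The linear growth of the gradient of the cost, with the norms bounded by
    sums of coordinates so as to be compared with [moment]. *)
Lemma grd_growth z k : `|grd c z k| <= C * (1 + \sum_j `|crd z j|).
Proof.
case: z => x y.
apply: (@le_trans _ _ (C * (1 + enorm x + enorm y))); last first.
  rewrite ler_wpM2l ?growth_ge0// sum_coords -addrA lerD2l lerD// ; exact: enorm_le_sum.
apply: le_trans (growth x y).
case: k => i.
  rewrite ler_wpDr ?enorm_ge0//; have := coord_le_enorm (grad_x c (x, y)) i.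
  by rewrite mxE.
rewrite ler_wpDl ?enorm_ge0//; have := coord_le_enorm (grad_y c (x, y)) i.
by rewrite mxE.
Qed.

(** The velocity is a gradient minus its conditional expectation, and the latter
    is no larger in L1 than the former; whence the factor 2. *)
Lemma ocd_velocity_moment s k : 0 <= s ->
  \int[P]_w `|V s w k| <= (2 * C) * (1 + moment P Z s).
Proof.
move=> s0.
have Lf := L1_ocd_field k s0; have Lg := L1_grd k s0.
have -> : \int[P]_w `|V s w k| = \int[P]_w `|ocd_field s (Z s w) k|.
  apply: (int_off_null mN PN).
  - by apply: measurableT_comp => //; exact: measurable_ocd_velocity.
  - by apply: measurableT_comp => //; exact/L1_measurable/(on_path Lf).
  - by move=> w nw; rewrite VE.
rewrite -(int_law (measurable_ocd_path s) (@ocd_path_law s) (L1_abs Lf)).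
have g2 : \int[p s]_z `|grd c z k| <= C * (1 + moment P Z s).
  rewrite (int_law (measurable_ocd_path s) (@ocd_path_law s) (L1_abs Lg)).
  have Lc j : L1 P (fun w => `|crd (Z s w) j|) by exact/L1_abs/L1_crd.
  apply: (@le_trans _ _ (\int[P]_w (C * (1 + \sum_j `|crd (Z s w) j|)))).
    apply: int_le; first exact/L1_abs/(on_path Lg).
      by apply: L1Z; apply: L1D; [exact: L1_cst|exact: L1_sum].
    by move=> w; exact: grd_growth.
  rewrite intZ; last by apply: L1D; [exact: L1_cst|exact: L1_sum].
  rewrite intD; [|exact: L1_cst|exact: L1_sum].
  by rewrite int_cst int_sum// /moment (max_l s0).
pose m z : R := match k with inl i => mX s z.1 ord0 i | inr j => mY s z.2 ord0 j end.
have [Lm mg] : L1 (p s) m /\ \int[p s]_z `|m z| <= \int[p s]_z `|grd c z k|.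
  rewrite /m; case: (k) => i; split.
  - by have [_ _ /(_ i)] := ceX s0.
  - have := condexp_contraction measurable_fst (ceX s0) i.
    by under [X in _ <= X -> _]eq_Rintegral do rewrite mxE.
  - by have [_ _ /(_ i)] := ceY s0.
  - have := condexp_contraction measurable_snd (ceY s0) i.
    by under [X in _ <= X -> _]eq_Rintegral do rewrite mxE.
apply: (@le_trans _ _ (\int[p s]_z (`|m z| + `|grd c z k|))).
  apply: int_le; [exact: L1_abs|by apply: L1D; exact: L1_abs|].
  by move=> z; rewrite ocd_fieldE; exact: ler_normB.
by rewrite intD; [lra|exact: L1_abs|exact: L1_abs].
Qed.

(** The x-velocity is minus the part of grad_x c that is orthogonal to the
    functions of the x variable. *)
Lemma ocd_velocity_orthogonal_x s i (phi : E -> R) (B : R) : 0 <= s ->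
  measurable_fun setT phi -> (forall x, `|phi x| <= B) ->
  \int[P]_w (phi (Z s w).1 * V s w (inl i)) = 0.
Proof.
move=> s0 mphi phiB.
have Lf : L1 (p s) (fun z => phi z.1 * ocd_field s z (inl i)).
  apply: (L1M (M := B)) => //; last exact: L1_ocd_field.
  exact: (measurableT_comp mphi measurable_fst).
rewrite -(condexp_orthogonal measurable_fst (ceX s0) i mphi phiB).
rewrite [RHS](_ : _ = \int[p s]_z (phi z.1 * ocd_field s z (inl i))); last first.
  by apply: eq_Rintegral => z _; rewrite ocd_fieldE mxE.
rewrite (int_law (measurable_ocd_path s) (@ocd_path_law s) Lf).
apply: (int_off_null mN PN).
- apply: measurable_funM; last exact: measurable_ocd_velocity.
  exact: (measurableT_comp mphi (measurableT_comp measurable_fst (measurable_ocd_path s))).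
- exact/L1_measurable/(on_path Lf).
- by move=> w nw; rewrite VE.
Qed.

Lemma ocd_velocity_orthogonal_y s i (phi : E -> R) (B : R) : 0 <= s ->
  measurable_fun setT phi -> (forall x, `|phi x| <= B) ->
  \int[P]_w (phi (Z s w).2 * V s w (inr i)) = 0.
Proof.
move=> s0 mphi phiB.
have Lf : L1 (p s) (fun z => phi z.2 * ocd_field s z (inr i)).
  apply: (L1M (M := B)) => //; last exact: L1_ocd_field.
  exact: (measurableT_comp mphi measurable_snd).
rewrite -(condexp_orthogonal measurable_snd (ceY s0) i mphi phiB).
rewrite [RHS](_ : _ = \int[p s]_z (phi z.2 * ocd_field s z (inr i))); last first.
  by apply: eq_Rintegral => z _; rewrite ocd_fieldE mxE.
rewrite (int_law (measurable_ocd_path s) (@ocd_path_law s) Lf).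
apply: (int_off_null mN PN).
- apply: measurable_funM; last exact: measurable_ocd_velocity.
  exact: (measurableT_comp mphi (measurableT_comp measurable_snd (measurable_ocd_path s))).
- exact/L1_measurable/(on_path Lf).
- by move=> w nw; rewrite VE.
Qed.

Variables (mu nu : probability E R).
Hypothesis start : is_coupling (p 0) mu nu.

Let conserved (th : pred K) a s : 0 <= s ->
  (forall k, th k -> forall b m u, 0 <= u ->
     \int[P]_w (soft_orthant_grad th b m (Z u w) k * V u w k) = 0) ->
  P (Z s @^-1` orthant th a) = P (Z 0 @^-1` orthant th a).
Proof.
move=> s0 orth.
have C20 : 0 <= 2 * C by rewrite mulr_ge0// growth_ge0.
apply: (@orthant_conserved R n d T P Z V (fun u _ => measurable_ocd_path u)
  ocd_path_deriv (fun u k u0 => L1_crd k u0) (fun u k u0 => L1_ocd_velocity k u0)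
  (2 * C) C20 (fun u k u0 => ocd_velocity_moment k u0) th) => //.
Qed.

Lemma measurable_lower_orthant (a : 'I_n -> R) :
  measurable [set x : E | forall i, x ord0 i <= a i].
Proof.
pose th (k : K) := if k is inl _ then true else false.
pose a' (k : K) := if k is inl i then a i else 0.
have mi : measurable_fun setT (fun x : E => (x, 0 : E)) by exact: measurable_fun_pair.
have := mi measurableT _ (measurable_orthant th a'); rewrite setTI.
congr measurable; apply/seteqP; split => x /=; first by move=> h i; exact: (h (inl i)).
by move=> h [i _|//]; exact: h.
Qed.

(** The approximations of an orthant in the x variable have a gradient that is a
    function of x in the x directions and 0 in the y directions, so that
    [ocd_velocity_orthogonal_x] makes their expectations constant in time. *)
Lemma marginal_x s A : 0 <= s -> measurable A -> mu A = P ((fst \o Z s) @^-1` A).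
Proof.
move=> s0 mA.
have m1 := measurableT_comp measurable_fst (measurable_ocd_path s).
rewrite (@law_determined R n mu (distribution P (as_rv m1 : {mfun T >-> E})))// => a.
pose th (k : K) := if k is inl _ then true else false.
pose a' (k : K) := if k is inl i then a i else 0.
have orthE u : (fst \o Z u) @^-1` [set x : E | forall i, x ord0 i <= a i] = Z u @^-1` orthant th a'.
  apply/seteqP; split => w /=; first by move=> h [i _|//]; exact: h.
  by move=> h i; exact: (h (inl i)).
transitivity (P ((fst \o Z s) @^-1` [set x : E | forall i, x ord0 i <= a i])) => //.
rewrite orthE conserved//; last first.
  move=> [i|//] _ b m u u0.
  pose phi (x : E) := soft_orthant_grad th b m (x, 0) (inl i).
  have phiE z : soft_orthant_grad th b m z (inl i) = phi z.1.
    rewrite /phi /soft_orthant_grad /soft_orthant /=.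
    suff -> : penalty th b z = penalty th b (z.1, 0) by [].
    by apply: eq_bigr => -[j|].
  under eq_Rintegral do rewrite phiE.
  apply: (@ocd_velocity_orthogonal_x _ _ _ m%:R u0).
    have mi : measurable_fun setT (fun x : E => (x, 0 : E)) by exact: measurable_fun_pair.
    exact: (measurableT_comp (measurable_soft_orthant_grad th b m (inl i)) mi).
  by move=> x; exact: soft_orthant_grad_norm.
rewrite -orthE -(proj1 start)//; last exact: measurable_lower_orthant.
rewrite ocd_path_law; last by apply: measurableX => //; exact: measurable_lower_orthant.
by congr (P _); apply/seteqP; split => w //= -[].
Qed.

Lemma marginal_y s A : 0 <= s -> measurable A -> nu A = P ((snd \o Z s) @^-1` A).
Proof.
move=> s0 mA.
have m1 := measurableT_comp measurable_snd (measurable_ocd_path s).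
rewrite (@law_determined R n nu (distribution P (as_rv m1 : {mfun T >-> E})))// => a.
pose th (k : K) := if k is inr _ then true else false.
pose a' (k : K) := if k is inr i then a i else 0.
have orthE u : (snd \o Z u) @^-1` [set x : E | forall i, x ord0 i <= a i] = Z u @^-1` orthant th a'.
  apply/seteqP; split => w /=; first by move=> h [//|i _]; exact: h.
  by move=> h i; exact: (h (inr i)).
transitivity (P ((snd \o Z s) @^-1` [set x : E | forall i, x ord0 i <= a i])) => //.
rewrite orthE conserved//; last first.
  move=> [//|i] _ b m u u0.
  pose phi (x : E) := soft_orthant_grad th b m (0, x) (inr i).
  have phiE z : soft_orthant_grad th b m z (inr i) = phi z.2.
    rewrite /phi /soft_orthant_grad /soft_orthant /=.
    suff -> : penalty th b z = penalty th b (0, z.2) by [].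
    by apply: eq_bigr => -[|j].
  under eq_Rintegral do rewrite phiE.
  apply: (@ocd_velocity_orthogonal_y _ _ _ m%:R u0).
    have mi : measurable_fun setT (fun x : E => (0 : E, x)) by exact: measurable_fun_pair.
    exact: (measurableT_comp (measurable_soft_orthant_grad th b m (inr i)) mi).
  by move=> x; exact: soft_orthant_grad_norm.
rewrite -orthE -(proj2 start)//; last exact: measurable_lower_orthant.
rewrite ocd_path_law; last by apply: measurableX => //; exact: measurable_lower_orthant.
by congr (P _); apply/seteqP; split => w //= -[].
Qed.

Lemma joint_law_in_Pi s : 0 <= s -> in_Pi mu nu (p s).
Proof.
move=> s0; split; last split.
- rewrite (ge0_int_law (measurable_ocd_path s) (@ocd_path_law s)); last 2 first.
  + apply/measurable_EFinP; under eq_fun do rewrite enorm2_sqr.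
    by apply: measurable_sum => k; apply: measurable_funX; exact: measurable_crd.
  + by move=> z; rewrite lee_fin sqr_ge0.
  under eq_integral do rewrite enorm2_sqr.
  by rewrite -EFin_int ?ltry//; apply: L1_sum => k; exact: L1_crd_sqr.
- move=> A mA; rewrite (marginal_x s0 mA) ocd_path_law; last exact: measurableX.
  by congr (P _); apply/seteqP; split => w //= -[].
- move=> A mA; rewrite (marginal_y s0 mA) ocd_path_law; last exact: measurableX.
  by congr (P _); apply/seteqP; split => w //= -[].
Qed.

Let second_moment s k : 0 <= s ->
  \int[P]_w (crd (Z s w) k ^+ 2) = \int[P]_w (crd (Z 0 w) k ^+ 2).
Proof.
move=> s0.
have msq i : measurable_fun setT (fun x : E => x ord0 i ^+ 2).
  by apply: measurable_funX; exact: measurable_mx_coord.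
case: k => i.
  have m1 u := measurableT_comp measurable_fst (measurable_ocd_path u).
  have Lm : L1 mu (fun x : E => x ord0 i ^+ 2).
    by apply/(L1_law (m1 0) (fun A => marginal_x (lexx 0))) => //; exact: (L1_crd_sqr (inl i) (lexx 0)).
  by rewrite -(int_law (m1 s) (fun A => marginal_x s0) Lm) -(int_law (m1 0) (fun A => marginal_x (lexx 0)) Lm).
have m1 u := measurableT_comp measurable_snd (measurable_ocd_path u).
have Lm : L1 nu (fun x : E => x ord0 i ^+ 2).
  by apply/(L1_law (m1 0) (fun A => marginal_y (lexx 0))) => //; exact: (L1_crd_sqr (inr i) (lexx 0)).
by rewrite -(int_law (m1 s) (fun A => marginal_y s0) Lm) -(int_law (m1 0) (fun A => marginal_y (lexx 0)) Lm).
Qed.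

(** The joint law of Z s and Z t is a coupling of p s and p t. *)
Lemma coupling_bound s t (eta : R) : 0 <= s -> 0 <= t -> 0 <= eta ->
  \sum_k \int[P]_w ((crd (Z s w) k - crd (Z t w) k) ^+ 2) <= eta ^+ 2 ->
  (W2 (p s) (p t) <= eta%:E)%E.
Proof.
move=> s0 t0 eta0 H.
have mZZ : measurable_fun setT (fun w => (Z s w, Z t w)).
  by apply: measurable_fun_pair; exact: measurable_ocd_path.
pose g : probability ((E * E) * (E * E))%type R := distribution P (as_rv mZZ : {mfun T >-> ((E * E) * (E * E))%type}).
have gE A : measurable A -> g A = P ((fun w => (Z s w, Z t w)) @^-1` A) by [].
apply: (@le_trans _ _ ('N[g]_2%:E[EFin \o (fun w : (E * E) * (E * E) => enorm2 (w.1 - w.2)%R)])%E).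
  apply: ereal_inf_lbound; exists g => //; split => A mA.
    by rewrite ocd_path_law// gE; [congr (P _); apply/seteqP; split => w //= -[]|exact: measurableX].
  by rewrite ocd_path_law// gE; [congr (P _); apply/seteqP; split => w //= -[]|exact: measurableX].
apply: Lnorm2_le => //.
have msum : measurable_fun setT (fun w : (E * E) * (E * E) => \sum_k (crd w.1 k - crd w.2 k) ^+ 2).
  apply: measurable_sum => k; apply: measurable_funX; apply: measurable_funB.
    exact: (measurableT_comp (measurable_crd k) measurable_fst).
  exact: (measurableT_comp (measurable_crd k) measurable_snd).
have E2 (w : (E * E) * (E * E)) : enorm2 (w.1 - w.2) ^+ 2 = \sum_k (crd w.1 k - crd w.2 k) ^+ 2.
  by rewrite enorm2_sqr; apply: eq_bigr => k _; rewrite crdB.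
under eq_integral do rewrite E2.
rewrite (ge0_int_law mZZ gE); last 2 first.
- exact/measurable_EFinP.
- by move=> w; rewrite lee_fin sumr_ge0// => k _; exact: sqr_ge0.
have LD k : L1 P (fun w => (crd (Z s w) k - crd (Z t w) k) ^+ 2).
  have mD : measurable_fun setT (fun w => (crd (Z s w) k - crd (Z t w) k) ^+ 2).
    by apply: measurable_funX; apply: measurable_funB; exact/L1_measurable/L1_crd.
  apply: (L1_le mD (g := fun w => 2 * crd (Z s w) k ^+ 2 + 2 * crd (Z t w) k ^+ 2)).
    move=> w; rewrite ger0_norm ?sqr_ge0//.
    by have h := sqr_ge0 (crd (Z s w) k + crd (Z t w) k); rewrite !expr2 in h *; lra.
  by apply: L1D; apply: L1Z; exact: L1_crd_sqr.
rewrite -EFin_int; last exact: L1_sum.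
by rewrite lee_fin int_sum.
Qed.

(** Second moments of the coordinates are constant in time because the marginals
    are, so each coordinate is continuous in L2 by [L2_continuity]. *)
Lemma W2_continuous t (e : R) : 0 <= t -> 0 < e ->
  exists2 r : R, 0 < r & forall s, 0 <= s -> `|s - t| < r -> (W2 (p s) (p t) <= e%:E)%E.
Proof.
move=> t0 e0.
have K1 : 0 < #|{: K}|%:R + 1 :> R by rewrite ltr_wpDl.
have e1 : 0 < e ^+ 2 / (#|{: K}|%:R + 1) by rewrite divr_gt0// exprn_gt0.
have loc k : exists2 r : R, 0 < r & forall s, 0 <= s -> `|s - t| < r ->
    \int[P]_w ((crd (Z s w) k - crd (Z t w) k) ^+ 2) <= e ^+ 2 / (#|{: K}|%:R + 1).
  apply: (L2_continuity (M := \int[P]_w (crd (Z 0 w) k ^+ 2))) => //.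
  - by move=> s s0; exact/L1_measurable/L1_crd.
  - by move=> s s0; exact: L1_crd_sqr.
  - by move=> s s0; exact: second_moment.
  - move=> w u u0 ut; apply/cvgrPdist_lt => e' e'0.
    have [r r0 zr] := deriv_on_continuous (ocd_path_deriv w k t0) e'0.
    near=> j; rewrite distrC; apply: zr; first by rewrite /= in_itv/= u0.
    by rewrite distrC; near: j; move/cvgrPdist_lt : ut; exact.
have [r r0 Hr] := common_radius loc.
exists r => // s s0 sr; apply: coupling_bound => //; first exact: ltW.
apply: (@le_trans _ _ (\sum_(k : K) e ^+ 2 / (#|{: K}|%:R + 1))).
  by apply: ler_sum => k _; have [r' rr'] := Hr k; apply => //; exact: lt_le_trans rr'.
rewrite sumr_const -[leLHS]mulr_natl mulrA ler_pdivrMr// mulrC.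
by rewrite [leRHS]mulrDr mulr1 lerDl sqr_ge0.
Unshelve. all: by end_near.
Qed.

Variable rho : R -> E * E -> R.
Local Notation lam := (lebesgue_rV2 R n).
Hypothesis dens : forall t, 0 <= t -> L1 lam (rho t) /\
  forall A, measurable A -> p t A = (\int[lam]_(z in A) (rho t z)%:E)%E.
Hypothesis wcont : forall phi : E * E -> R, measurable_fun setT phi ->
  ('N[lam]_+oo[EFin \o phi] < +oo)%E ->
  {within `[0, +oo[, continuous (fun t => \int[lam]_z (phi z * rho t z))}.
Hypothesis ceL2 : forall t, 0 <= t -> in_L2 mu (mX t) /\ in_L2 nu (mY t).
Variable L : R.
Hypothesis L0 : 0 < L.
Hypothesis lipX : forall q1 q2, in_Pi mu nu q1 -> in_Pi mu nu q2 -> forall a b : E -> E,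
  is_condexp q1 fst (grad_x c) a -> is_condexp q2 fst (grad_x c) b ->
  ('N[mu]_2%:E[EFin \o (fun x => enorm (a x - b x)%R)] <= L%:E * W2 q1 q2)%E.
Hypothesis lipY : forall q1 q2, in_Pi mu nu q1 -> in_Pi mu nu q2 -> forall a b : E -> E,
  is_condexp q1 snd (grad_y c) a -> is_condexp q2 snd (grad_y c) b ->
  ('N[nu]_2%:E[EFin \o (fun x => enorm (a x - b x)%R)] <= L%:E * W2 q1 q2)%E.
Hypothesis c1 : is_Ck 1 c.

Lemma L1_joint_law_density t f : 0 <= t -> L1 (p t) f -> L1 lam (fun z => f z * rho t z).
Proof. by move=> t0; have [Lr pr] := dens t0; exact: (@L1_density _ _ _ (p t) lam (rho t) Lr pr). Qed.

Lemma int_path_density t f : 0 <= t -> L1 (p t) f ->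
  \int[P]_w f (Z t w) = \int[lam]_z (f z * rho t z).
Proof.
move=> t0 Lf; have [Lr pr] := dens t0.
rewrite -(@int_density _ _ _ (p t) lam (rho t) Lr pr)//.
by rewrite (int_law (measurable_ocd_path t) (@ocd_path_law t) Lf).
Qed.

(** The weak L1 continuity of the densities, in terms of the process. *)
Lemma weak_continuity t : 0 <= t -> forall (Phi : E * E -> R) (M e : R),
  measurable_fun setT Phi -> (forall z, `|Phi z| <= M) -> 0 < e ->
  exists2 r : R, 0 < r & forall s : R, 0 <= s -> `|s - t| < r ->
    `|\int[P]_w Phi (Z s w) - \int[P]_w Phi (Z t w)| <= e.
Proof.
move=> t0 Phi M e mPhi PhiM e0.
have := wcont mPhi (bounded_Lnorm_infty lam PhiM).
have t_in : `[0, +oo[%classic t by rewrite /= in_itv/= t0.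
move=> /subspace_continuousP/(_ t t_in)/cvgrPdist_le/(_ e e0).
rewrite near_withinE => -[r /= r0 Hr]; exists r => // s s0 sr.
have LPhi u : L1 (p u) Phi by exact: (L1_bounded (p u) mPhi PhiM).
rewrite !int_path_density// distrC.
apply: Hr; first by rewrite /ball_/= distrC.
by rewrite /= in_itv/= s0.
Qed.

(** The Lipschitz hypothesis, for either marginal, with [W2_continuous]. *)
Let diff_continuous (mm : R -> E -> E) (q : probability E R) (i : 'I_n) :
  (forall t, 0 <= t -> in_L2 q (mm t)) ->
  (forall s t, 0 <= s -> 0 <= t ->
    ('N[q]_2%:E[EFin \o (fun x => enorm (mm s x - mm t x)%R)] <= L%:E * W2 (p s) (p t))%E) ->
  (forall s, 0 <= s -> L1 q (fun x => mm s x ord0 i)) /\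
  forall t : R, 0 <= t -> forall e : R, 0 < e ->
  exists2 r : R, 0 < r & forall s : R, 0 <= s -> `|s - t| < r ->
    \int[q]_u `|mm s u ord0 i - mm t u ord0 i| <= e.
Proof.
move=> mmL2 lip.
have mmi s : 0 <= s -> measurable_fun setT (fun x => mm s x ord0 i).
  by move=> s0; have [/measurable_fun_mxP] := mmL2 s s0.
have Lmm s : 0 <= s -> L1 q (fun x => mm s x ord0 i).
  move=> s0; have [m2 n2] := mmL2 s s0.
  have me : measurable_fun setT (fun x => enorm (mm s x)) by exact: (measurableT_comp measurable_enorm m2).
  apply: (L1_le (mmi s s0) (fun x => coord_le_enorm (mm s x) i)).
  by apply: L1_of_sqr => //; exact: Lnorm2_lty.
split => // t t0 e e0.
have [r r0 Hr] := W2_continuous t0 (divr_gt0 e0 L0).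
exists r => // s s0 sr.
have md : measurable_fun setT (fun x => mm s x - mm t x).
  apply/measurable_fun_mxP => j k; rewrite (ord1 j).
  under eq_fun do rewrite !mxE.
  apply: measurable_funB.
    by have [/measurable_fun_mxP] := mmL2 s s0.
  by have [/measurable_fun_mxP] := mmL2 t t0.
have me : measurable_fun setT (fun x => enorm (mm s x - mm t x)).
  exact: (measurableT_comp measurable_enorm md).
have Ne : ('N[q]_2%:E[EFin \o (fun x => enorm (mm s x - mm t x)%R)] <= e%:E)%E.
  apply: le_trans (lip s t s0 t0) _.
  have L0' : (0 <= L%:E)%E by rewrite lee_fin ltW.
  apply: le_trans (lee_wpmul2l L0' (Hr s s0 sr)) _.
  by rewrite -EFinM mulrC divfK// gt_eqF.
have Le : L1 q (fun x => enorm (mm s x - mm t x)).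
  by apply: L1_of_sqr => //; apply: Lnorm2_lty => //; exact: le_lt_trans Ne (ltry _).
apply: le_trans (int_le_Lnorm2 me (fun x => enorm_ge0 _) e0 Ne).
apply: int_le => //.
  by apply: L1_abs; apply: L1B; exact: Lmm.
move=> x; have := coord_le_enorm (mm s x - mm t x) i.
by rewrite !mxE.
Qed.

Section test.
Variable g : E * E -> R.
Hypothesis tg : test_function g.

Let continuous_grd_test k : continuous (fun z => grd g z k).
Proof. by have [_] := test_function_grad (bvec k) tg. Qed.

Let continuous_grd_cost k : continuous (fun z => grd c z k).
Proof. by case: c1 => _ /(_ (bvec k)) [_ []]. Qed.

Let compact_support : compact (closure [set z | g z != 0]).
Proof. by case: tg. Qed.

Let continuous_test : continuous g.
Proof. by case: tg => /(_ 0%N) []. Qed.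

Lemma test_function_bounded : exists M, forall z, `|g z| <= M.
Proof.
apply: (compact_support_bounded compact_support continuous_test) => z.
exact: support_closure.
Qed.

Lemma grd_test_bounded : exists B, forall z k, `|grd g z k| <= B.
Proof.
have H k : exists B, forall z, `|grd g z k| <= B.
  apply: (compact_support_bounded compact_support (@continuous_grd_test k)) => z.
  exact: grad_support.
pose b k := sval (cid (H k)).
have bP k z : `|grd g z k| <= b k by rewrite /b; case: cid.
exists (\sum_k `|b k|) => z k; rewrite (le_trans (bP k z))// (le_trans (ler_norm _))//.
by rewrite (bigD1 k)//= lerDl sumr_ge0.
Qed.

Let psi s : R := \int[P]_w (\sum_k grd g (Z s w) k * V s w k).

Let measurable_grd_test k : measurable_fun setT (fun z => grd g z k).
Proof. exact: continuous_measurable_pair. Qed.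

(** The expectation splits into terms with the gradient of c, where the
    integrand is bounded because g has compact support and continuous so that
    weak continuity suffices, and terms with a conditional expectation, where
    [cross_term_continuous] applies. *)
Lemma drift_continuous t (e : R) : 0 <= t -> 0 < e ->
  exists2 r : R, 0 < r & forall s : R, 0 <= s -> `|s - t| < r -> `|psi s - psi t| <= e.
Proof.
move=> t0 e0; have [B gB] := grd_test_bounded.
pose m s k (z : E * E) : R := match k with inl i => mX s z.1 ord0 i | inr j => mY s z.2 ord0 j end.
have Lgm s k : 0 <= s -> L1 (p s) (fun z => grd g z k * m s k z).
  move=> s0; apply: (L1M (M := B)) => //.
  by rewrite /m; case: k => i; [have [_ _ /(_ i)] := ceX s0|have [_ _ /(_ i)] := ceY s0].
have Lgc s k : 0 <= s -> L1 (p s) (fun z => grd g z k * grd c z k).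
  by move=> s0; apply: (L1M (M := B)) => //; exact: L1_grd.
have psiE s : 0 <= s -> psi s = \sum_k (\int[P]_w (grd g (Z s w) k * m s k (Z s w)) -
    \int[P]_w (grd g (Z s w) k * grd c (Z s w) k)).
  move=> s0; rewrite /psi int_sum; last first.
    move=> k; apply: (L1M (M := B)) => //; last exact: L1_ocd_velocity.
    exact: (measurableT_comp (measurable_grd_test k) (measurable_ocd_path s)).
  apply: eq_bigr => k _; rewrite -intB; [|exact: (on_path (Lgm s k s0))|exact: (on_path (Lgc s k s0))].
  apply: (int_off_null mN PN).
  - apply: measurable_funM; last exact: measurable_ocd_velocity.
    exact: (measurableT_comp (measurable_grd_test k) (measurable_ocd_path s)).
  - by apply: measurable_funB; apply: L1_measurable; [exact: (on_path (Lgm s k s0))|exact: (on_path (Lgc s k s0))].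
  - by move=> w nw; rewrite VE// ocd_fieldE mulrBr.
pose Q := #|{: K}|%:R + 1 : R.
have Q0 : 0 < Q by rewrite ltr_wpDl.
have e1 : 0 < e / Q / 2 by rewrite !divr_gt0.
have cross k : exists2 r : R, 0 < r & forall s : R, 0 <= s -> `|s - t| < r ->
    `|\int[P]_w (grd g (Z s w) k * m s k (Z s w)) - \int[P]_w (grd g (Z t w) k * m t k (Z t w))| <= e / Q / 2.
  have mZ s : 0 <= s -> measurable_fun setT (Z s) by move=> _; exact: measurable_ocd_path.
  case: k => i.
    have [Lh hc] := diff_continuous i (fun s s0 => (ceL2 s0).1)
      (fun s u s0 u0 => lipX (joint_law_in_Pi s0) (joint_law_in_Pi u0) (ceX s0) (ceX u0)).
    exact: (cross_term_continuous mZ measurable_fst (measurable_grd_test (inl i))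
      (fun z => gB z (inl i)) (fun s s0 A mA => marginal_x s0 mA) weak_continuity Lh hc t0 e1).
  have [Lh hc] := diff_continuous i (fun s s0 => (ceL2 s0).2)
    (fun s u s0 u0 => lipY (joint_law_in_Pi s0) (joint_law_in_Pi u0) (ceY s0) (ceY u0)).
  exact: (cross_term_continuous mZ measurable_snd (measurable_grd_test (inr i))
    (fun z => gB z (inr i)) (fun s s0 A mA => marginal_y s0 mA) weak_continuity Lh hc t0 e1).
have cost k : exists2 r : R, 0 < r & forall s : R, 0 <= s -> `|s - t| < r ->
    `|\int[P]_w (grd g (Z s w) k * grd c (Z s w) k) - \int[P]_w (grd g (Z t w) k * grd c (Z t w) k)| <= e / Q / 2.
  have cgc : continuous (fun z => grd g z k * grd c z k).
    by move=> z; apply: cvgM; [exact: continuous_grd_test|exact: continuous_grd_cost].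
  have [M gcM] : exists M, forall z, `|grd g z k * grd c z k| <= M.
    apply: (compact_support_bounded compact_support cgc) => z nz.
    by rewrite /grd grad_support// mul0r.
  exact: (weak_continuity t0 (continuous_measurable_pair cgc) gcM e1).
have [r1 r10 H1] := common_radius cross.
have [r2 r20 H2] := common_radius cost.
exists (Num.min r1 r2); first by rewrite lt_min r10.
move=> s s0; rewrite lt_min => /andP[sr1 sr2].
rewrite !psiE// -sumrB (le_trans (ler_norm_sum _ _ _))//.
apply: (@le_trans _ _ (\sum_(k : K) e / Q)).
  apply: ler_sum => k _.
  have [d1 rd1 /(_ s s0 (lt_le_trans sr1 rd1)) a1] := H1 k.
  have [d2 rd2 /(_ s s0 (lt_le_trans sr2 rd2)) a2] := H2 k.
  exact: close_sub a1 a2.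
rewrite sumr_const -[leLHS]mulr_natl mulrA ler_pdivrMr// mulrC.
by rewrite /Q [leRHS]mulrDr mulr1 lerDl ltW.
Qed.

Lemma weak_formulation t : 0 <= t ->
  let rhs z := dotv (grad_x g z) (ocd_vx c mX t z) + dotv (grad_y g z) (ocd_vy c mY t z) in
  [/\ L1 lam (fun z => g z * rho t z), L1 lam (fun z => rhs z * rho t z) &
      derive_halfline (fun s => \int[lam]_z (g z * rho s z)) t (\int[lam]_z (rhs z * rho t z))].
Proof.
move=> t0 rhs; have [M gM] := test_function_bounded; have [B gB] := grd_test_bounded.
have mg : measurable_fun setT g by exact: continuous_measurable_pair.
have Lg s : 0 <= s -> L1 (p s) g by move=> s0; exact: L1_bounded gM.
have rhsE : rhs = fun z => \sum_k grd g z k * ocd_field t z k.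
  by apply/funext => z; rewrite /rhs dotv_grad.
have Lgf k : L1 (p t) (fun z => grd g z k * ocd_field t z k).
  by apply: (L1M (M := B)) => //; exact: L1_ocd_field.
have Lrhs : L1 (p t) rhs by rewrite rhsE; exact: L1_sum.
split; [exact: L1_joint_law_density (Lg t t0)|exact: L1_joint_law_density|].
have psit : psi t = \int[lam]_z (rhs z * rho t z).
  rewrite -int_path_density//; apply: (int_off_null mN PN).
  - apply: measurable_sum => k; apply: measurable_funM; last exact: measurable_ocd_velocity.
    exact: (measurableT_comp (measurable_grd_test k) (measurable_ocd_path t)).
  - exact/L1_measurable/(on_path Lrhs).
  - by move=> w nw; rewrite rhsE; apply: eq_bigr => k _; rewrite VE.
have C20 : 0 <= 2 * C by rewrite mulr_ge0// growth_ge0.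
rewrite -psit.
suff D : derive_halfline (fun s => \int[P]_w g (Z s w)) t (psi t).
  apply: cvg_trans D; apply: near_eq_cvg; rewrite near_withinE.
  apply: nearW => h /= th.
  by rewrite !(int_path_density _ (Lg _ _)).
apply: derive_halfline_squeeze => //.
- move=> a b k a0 ab psik.
  exact: (expected_increment_le (fun u _ => measurable_ocd_path u)
    ocd_path_deriv (fun u k u0 => L1_crd k u0) (fun u k u0 => L1_ocd_velocity k u0)
    C20 (fun u k u0 => ocd_velocity_moment k u0) (test_function_has_gradient tg)
    mg measurable_grd_test gM gB a0 ab psik).
- move=> a b k a0 ab psik.
  exact: (expected_increment_ge (fun u _ => measurable_ocd_path u)
    ocd_path_deriv (fun u k u0 => L1_crd k u0) (fun u k u0 => L1_ocd_velocity k u0)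
    C20 (fun u k u0 => ocd_velocity_moment k u0) (test_function_has_gradient tg)
    mg measurable_grd_test gM gB a0 ab psik).
- by move=> e e0; exact: drift_continuous.
Qed.

End test.

End ocd.

Theorem theorem2p4 (R : realType) (n : nat)
    (c : 'rV[R]_n * 'rV[R]_n -> R)
    (mu nu : probability 'rV[R]_n R)
    (pi : probability ('rV[R]_n * 'rV[R]_n)%type R)
    (d : measure_display) (T : measurableType d) (P : probability T R)
    (X Y : R -> {mfun T >-> 'rV[R]_n})
    (mX mY : R -> 'rV[R]_n -> 'rV[R]_n)
    (rho : R -> 'rV[R]_n * 'rV[R]_n -> R) :
  (forall z, 0 <= c z) -> smooth c ->
  in_P2 mu -> in_P2 nu -> in_Pi mu nu pi ->
  (forall t, 0 <= t -> in_L2 P (X t) /\ in_L2 P (Y t)) ->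
  ocd_solution c mX mY P X Y ->
  (forall A, measurable A -> joint_law P (X 0) (Y 0) A = pi A) ->
  regularity c mX mY P X Y mu nu rho ->
  weak_solution rho (fun t z => - S_x c (mX t) z) (fun t z => - S_y c (mY t) z).
Proof.
move=> _ _ _ _ [_ [piX piY]] XY2 [ceX ceY [N [mN PN sub]]] start reg.
have paths w : ~ N w -> forall t, 0 <= t ->
    derive_halfline (fun s => X s w) t (ocd_vx c mX t (X t w, Y t w)) /\
    derive_halfline (fun s => Y s w) t (ocd_vy c mY t (X t w, Y t w)).
  move=> nw; apply: contrapT => h; apply: nw; exact: sub.
have coupling0 : is_coupling (joint_law P (X 0) (Y 0)) mu nu.
  split=> A mA; rewrite start; try exact: measurableX.
    exact: piX.
  exact: piY.
have [C growth] := reg_growth reg.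
have [L L0 lip] := reg_lipschitz reg.
have vxE : (fun t z => - S_x c (mX t) z) = ocd_vx c mX.
  by apply/funext => t; apply/funext => z; rewrite /S_x /ocd_vx opprB addrC.
have vyE : (fun t z => - S_y c (mY t) z) = ocd_vy c mY.
  by apply/funext => t; apply/funext => z; rewrite /S_y /ocd_vy opprB addrC.
rewrite vxE vyE => g tg t t0.
exact: (weak_formulation XY2 ceX ceY mN PN paths growth coupling0
  (reg_density reg) (reg_weak_continuous reg) (reg_condexp reg) L0
  (fun q1 q2 h1 h2 => (lip q1 q2 h1 h2).1) (fun q1 q2 h1 h2 => (lip q1 q2 h1 h2).2)
  (reg_C1 reg) tg t0).
Qed.
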